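(* Assume (A) and (C) below. Suppose that $\alpha=\alpha_m\in(0,1-p)$, $\alpha\to\alpha_\infty<1$, and $$f/\alpha\to\infty,\qquad \frac{\log(f/\alpha)}{n}\to C_0<\infty,$$ where $C_0$ is such that $\nu(-\sigma\sqrt{2C_0},\sigma\sqrt{2C_0})<1$ and $\nu$ has no atoms at $\pm\sigma\sqrt{2C_0}$. Then the threshold value $c_B$ of the rule controlling BFDR at level $\alpha$ satisfies $$c_B^2=2\log\left(\frac f\alpha\right)-\log\left(2\log\left(\frac f\alpha\right)\right)+2\log\left(\frac{\sqrt2\,(1-\alpha_\infty)}{\sqrt\pi\,C_1}\right)+o(1),$$ where $C_1=1-\nu(-\sigma\sqrt{2C_0},\sigma\sqrt{2C_0})$. The BFDR controlling rule is ABOS if and only if $$\frac{\log(f\delta\sqrt n)}{\log(f/\alpha)}\to1\quad\text{and}\quad 2\log(\alpha\delta\sqrt n)-\log\log(f/\alpha)\to-\infty .$$ In that case $C_0=C/2$ and therefore $C_1=1-\nu(-T,T)$.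
   Context: Setting. All quantities are indexed by $m$ and all limits are for $m\to\infty$; the index $m$ is suppressed. $n=n_m\in\mathbb N$, $p=p_m\in(0,1)$, $\delta_0,\delta_A>0$ may depend on $m$; $\sigma>0$ and $\nu$ are fixed, where $\nu$ is a probability measure on $\mathbb R$ with $\nu(\{0\})=0$, $\nu(-\infty,0)>0$, $\nu(0,\infty)>0$. The effects $\mu_1,\dots,\mu_m$ are i.i.d. with law $(1-p)d_0+p\nu$ ($d_0$ = Dirac measure at $0$); given them, $X_{ji}$ ($1\le j\le n$, $1\le i\le m$) are independent with $X_{ji}\sim N(\mu_i,\sigma^2)$, and $\bar X_i=\frac1n\sum_{j=1}^nX_{ji}$. One tests $H_{0i}:\mu_i=0$ against $\mu_i\ne0$, $i=1,\dots,m$. Put $\delta=\delta_0/\delta_A$, $f=(1-p)/p$. The risk $R$ of a multiple testing rule is $\delta_0$ times the expected number of false rejections plus $\delta_A$ times the expected number of false non-rejections. Bayes oracle: for large $n$ it accepts $H_{0i}$ iff $\bar X_i\in(a_n,b_n)$, where $a_n<0<b_n$ are the unique solutions $a$ of $(1-p)\delta_0=p\,\delta_A\int_{\mathbb R}\exp\left(n\left(a\frac{\mu}{\sigma^2}-\frac{\mu^2}{2\sigma^2}\right)\right)d\nu(\mu)$; it minimizes the risk, and its risk is $R^B$. A rule with risk $R$ is ABOS (asymptotically Bayes optimal under sparsity) if $R/R^B\to1$. Assumption (A): $n\to\infty$, $\delta f\to c\in(0,\infty]$, and $\frac{2\log(\delta f)}{n}\to C$ with $0\le C<\infty$. Assumption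 (C): with $T:=\sigma\sqrt C$, there is $\epsilon>0$ such that $\nu$ has a positive bounded density $\rho$ w.r.t. Lebesgue measure on $[-T-\epsilon,-T+\epsilon]$ and $[T-\epsilon,T+\epsilon]$; if $C=0$, moreover $\rho(0^-)=\lim_{\mu\uparrow0}\rho(\mu)$ and $\rho(0^+)=\lim_{\mu\downarrow0}\rho(\mu)$ exist and are finite and positive. BFDR rule: the Bayesian false discovery rate of a fixed threshold rule with individual type I and II error probabilities $t_1,t_2$ is $BFDR=\frac{(1-p)t_1}{(1-p)t_1+p(1-t_2)}$. The rule controlling BFDR at level $\alpha\in(0,1-p)$ is the symmetric rule rejecting $H_{0i}$ iff $\frac{n\bar X_i^2}{\sigma^2}\ge c_B^2$, where $c_B>0$ is the unique number for which $BFDR=\alpha$, i.e. $$\frac{\alpha}{f(1-\alpha)}=\frac{2(1-\Phi(c_B))}{2-\int_{\mathbb R}\left[\Phi(c_B+\sqrt n\mu/\sigma)+\Phi(c_B-\sqrt n\mu/\sigma)\right]d\nu(\mu)},$$ with $\Phi$ the standard normal cdf. *)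

(* Defs.v *)
From HB Require Import structures.
From mathcomp Require Import all_boot all_order all_algebra.
From mathcomp Require Import all_classical all_reals all_analysis.

Set Implicit Arguments.
Unset Strict Implicit.
Unset Printing Implicit Defensive.

Import Order.TTheory GRing.Theory Num.Theory.
Import numFieldNormedType.Exports.

Local Open Scope classical_set_scope.
Local Open Scope ring_scope.

Section TwoGroupsModel.
Context {R : realType}.
Implicit Types (nu : probability (measurableTypeR R) R).

Definition effect_law (p : R) nu (A : set R) : \bar R :=
  ((1 - p)%:E * \d_(0%R : measurableTypeR R) A + p%:E * nu A)%E.

(* The first clause says that the effects are i.i.d. with law [effect_law p nu]
   (marginal laws are obtained by taking the other [A i] equal to [setT]).
   The second one says that the conditional law of the whole array [X] given
   all the effects is the product over (j, i) of the laws N(mu_i, sigma^2);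
   the events {mu_i in A_i for all i} form a pi-system generating the sigma-algebra
   of the effects.  The second parameter of [normal_prob] is the standard
   deviation. *)
Definition two_groups_model (d : measure_display) (Om : measurableType d)
    (P : probability Om R) (m n : nat) (p sigma : R) nu
    (mu : 'I_m -> {RV P >-> R}) (X : 'I_n -> 'I_m -> {RV P >-> R}) : Prop :=
  (forall A : 'I_m -> set R, (forall i, measurable (A i)) ->
    P [set w | forall i, A i (mu i w)] =
      (\prod_(i < m) effect_law p nu (A i))%E) /\
  (forall (A : 'I_m -> set R) (B : 'I_n -> 'I_m -> set R),
    (forall i, measurable (A i)) -> (forall j i, measurable (B j i)) ->
    P [set w | (forall i, A i (mu i w)) /\ (forall j i, B j i (X j i w))] =
      (\int[P]_(w in [set w | forall i, A i (mu i w)])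
         \prod_(i < m) \prod_(j < n) normal_prob (mu i w) sigma (B j i))%E).

Definition sample_mean (Om : Type) (m n : nat) (X : 'I_n -> 'I_m -> Om -> R)
    (i : 'I_m) (w : Om) : R :=
  (\sum_(j < n) X j i w) / n%:R.

(* A multiple testing rule is represented by its decisions: [rej i w] is true
   iff H_{0i} : mu_i = 0 is rejected at the outcome [w]. *)
Section Risk.
Context {d : measure_display} {Om : measurableType d} (P : probability Om R).

Definition false_rejections (m : nat) (mu : 'I_m -> Om -> R)
    (rej : 'I_m -> Om -> bool) (w : Om) : nat :=
  #|[pred i : 'I_m | (mu i w == 0) && rej i w]|.

Definition false_nonrejections (m : nat) (mu : 'I_m -> Om -> R)
    (rej : 'I_m -> Om -> bool) (w : Om) : nat :=
  #|[pred i : 'I_m | (mu i w != 0) && ~~ rej i w]|.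

Definition risk (delta0 deltaA : R) (m : nat) (mu : 'I_m -> Om -> R)
    (rej : 'I_m -> Om -> bool) : R :=
  delta0 * fine ('E_P[fun w => (false_rejections mu rej w)%:R])%E +
  deltaA * fine ('E_P[fun w => (false_nonrejections mu rej w)%:R])%E.

Definition type1_error (mu : Om -> R) (rej : Om -> bool) : R :=
  fine (P [set w | mu w = 0 /\ rej w]) / fine (P [set w | mu w = 0]).

Definition type2_error (mu : Om -> R) (rej : Om -> bool) : R :=
  fine (P [set w | mu w <> 0 /\ ~~ rej w]) / fine (P [set w | mu w <> 0]).

End Risk.

Definition BFDR (p t1 t2 : R) : R :=
  (1 - p) * t1 / ((1 - p) * t1 + p * (1 - t2)).

Definition symmetric_rule (Om : Type) (m n : nat) (sigma c : R)
    (X : 'I_n -> 'I_m -> Om -> R) (i : 'I_m) (w : Om) : bool :=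
  c ^+ 2 <= n%:R * sample_mean X i w ^+ 2 / sigma ^+ 2.

Definition interval_rule (Om : Type) (m n : nat) (a b : R)
    (X : 'I_n -> 'I_m -> Om -> R) (i : 'I_m) (w : Om) : bool :=
  ~~ (a < sample_mean X i w < b).

(* For large n this equation in [x] has exactly one negative solution a and one
   positive solution b, and the Bayes oracle is [interval_rule a b]. *)
Definition oracle_equation (n : nat) (p delta0 deltaA sigma : R) nu (x : R) :=
  (1 - p) * delta0 =
  p * deltaA * \int[nu]_t
    expR (n%:R * (x * (t / sigma ^+ 2) - t ^+ 2 / (2 * sigma ^+ 2))).

Definition assumptionA (n : nat -> nat) (delta f : nat -> R) (C : R) : Prop :=
  [/\ n @ \oo --> \oo,
      exists2 c : \bar R, (0 < c)%E &
        (delta m * f m)%:E @[m --> \oo] --> c,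
      2 * ln (delta m * f m) / (n m)%:R @[m --> \oo] --> C
    & 0 <= C].

Definition assumptionC nu (sigma C : R) : Prop :=
  let T := sigma * Num.sqrt C in
  exists2 eps : R, 0 < eps &
  exists rho : R -> R,
    let K := `[- T - eps, - T + eps]%classic `|` `[T - eps, T + eps]%classic in
    [/\ measurable_fun K rho,
        exists M : R, forall x, K x -> 0 < rho x <= M,
        forall A : set R, measurable A -> A `<=` K ->
          nu A = (\int[lebesgue_measure]_(x in A) (rho x)%:E)%E
      & C = 0 ->
        (exists2 l : R, 0 < l & rho x @[x --> 0^'-] --> l) /\
        (exists2 r : R, 0 < r & rho x @[x --> 0^'+] --> r)].

End TwoGroupsModel.

(* Main.v *)
(* In standardized units the statistic of one test is Z ~ N(0,1) under the null
   and k t + Z with t ~ nu, k = sqrt n / sigma, under the alternative. So up to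
   a common factor the risk of a rule accepting on ]l, r[ is
   D (1 - P(l < Z < r)) + P(l < k t + Z < r) with D = f delta.

   The oracle interval minimizes this quantity (its likelihood ratio is convex).
   Put L = 2 ln (D sqrt n). Comparison with ]- sqrt L, sqrt L[ bounds the oracle
   risk from above; from below, an oracle endpoint noticeably closer to 0 than
   sqrt L would make the type I part of the risk explode. Hence the oracle risk
   is equivalent to kap s with s = sqrt (L / n) and kap > 0 depending on nu and C.

   Mills' ratio turns the equation defining c_B into its expansion. The same
   equation makes the type I part of the risk of the BFDR rule equal to
   delta alpha (1 - t2) / (1 - alpha), where t2 ~ kap c_B / sqrt n if 2 C0 = C.
   The risk divided by s thus tends to kap iff delta alpha / s -> 0 and
   c_B^2 ~ L, and these are the two conditions in logarithmic form. If the
   limit holds, then 2 C0 <= C by monotonicity of the nu-measure of symmetric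
   intervals and C <= 2 C0 since delta alpha / s is bounded. *)
Require Import Defs.
From HB Require Import structures.
From mathcomp Require Import all_boot all_order all_algebra.
From mathcomp Require Import all_classical all_reals all_analysis.
From mathcomp Require Import measurable_realfun ring lra.
Set Implicit Arguments.
Unset Strict Implicit.
Unset Printing Implicit Defensive.
Import Order.TTheory GRing.Theory Num.Theory.
Import numFieldNormedType.Exports.
Local Open Scope classical_set_scope.
Local Open Scope ring_scope.

(** * Gaussian laws *)

(** The model fixes the joint law of effects and observations on rectangles only, so even the normal
    law of a sample mean given its effect has to be derived: the joint law of a partial sum and the
    next observation is identified with a mixture of product measures, and convolution absorbs the
    observations one by one.

    Two regimes are treated together. For [C > 0] the type II error of the relevant rules has a
    positive limit; for [C = 0] it vanishes, and its order comes from the one-sided limits of the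
    density at 0. Dividing by c / sqrt n gives a positive limit [kap] in both cases. The oracle
    endpoints need not be symmetric, and no expansion of them is computed: it is enough that the
    oracle interval contains a slightly shrunk symmetric one.

    The threshold is circular: its size depends on the power, and the limit of the power depends on
    its size. Moreover 2 C0 may differ from C at that stage, so no density is at hand near the
    limiting radius. A crude bound on c_B^2 / n, drawn from a lower bound of the power, breaks the
    circle. *)

Definition pushforward_measure d1 d2 (T1 : measurableType d1) (T2 : measurableType d2)
  (R : realType) (m : {measure set T1 -> \bar R}) (g : T1 -> T2)
  (mg : measurable_fun [set: T1] g) : {measure set T2 -> \bar R} :=
  measure_function_pushforward__canonical__measure_function_Measure m mg.

Section affine.
Context {R : realType}.
Local Notation leb := (@lebesgue_measure R).

(** Lebesgue measure is determined by its values on the intervals []u, v]], where the rescaled image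
    measure is explicit. *)
Lemma lebesgue_measure_affine (a s : R) (A : set R) : 0 < s -> measurable A ->
  leb A = (s%:E * leb ((fun z => a + s * z)%R @^-1` A))%E.
Proof.
move=> s0 mA.
have mf : measurable_fun [set: measurableTypeR R]
    ((fun z => a + s * z) : measurableTypeR R -> measurableTypeR R).
  by apply: measurable_funD => //; apply: measurable_funM.
have sge0 : 0 <= s by exact: ltW.
pose m' := mscale (NngNum sge0) (pushforward_measure leb mf).
change (leb A = m' A).
apply: lebesgue_measure_unique => // X [[u v]] /= _ <-.
rewrite /m' /mscale /= /pushforward.
have -> : (fun z => a + s * z) @^-1` `]u, v]%classic = `](u - a) / s, (v - a) / s]%classic.
  apply/seteqP; split => x /=; rewrite !in_itv /= => /andP[h1 h2]; apply/andP; split.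
  - by rewrite ltr_pdivrMr//; lra.
  - by rewrite ler_pdivlMr//; lra.
  - by move: h1; rewrite ltr_pdivrMr//; lra.
  - by move: h2; rewrite ler_pdivlMr//; lra.
rewrite !lebesgue_measure_itv /= !lte_fin.
have -> : ((u - a) / s < (v - a) / s) = (u < v).
  by rewrite ltr_pM2r ?invr_gt0// ltrD2r.
case: ifPn => // uv; last by rewrite mule0.
by rewrite -!EFinD -EFinM; congr EFin; field; rewrite gt_eqF.
Qed.

Lemma ge0_integral_affine (a s : R) (D : set R) (g : R -> \bar R) : 0 < s ->
  measurable D -> measurable_fun D (g : measurableTypeR R -> \bar R) -> (forall x, D x -> 0 <= g x)%E ->
  (\int[leb]_(x in D) g x =
   s%:E * \int[leb]_(x in (fun z => a + s * z)%R @^-1` D) g (a + s * x)%R)%E.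
Proof.
move=> s0 mD mg g0.
have mf : measurable_fun [set: measurableTypeR R]
    ((fun z => a + s * z) : measurableTypeR R -> measurableTypeR R).
  by apply: measurable_funD => //; apply: measurable_funM.
have sge0 : 0 <= s by exact: ltW.
pose m' := mscale (NngNum sge0) (pushforward_measure leb mf).
rewrite (@eq_measure_integral _ _ _ _ m'); last first.
  by move=> A mA _; exact: lebesgue_measure_affine.
rewrite ge0_integral_mscale//= ge0_integral_pushforward//.
by move=> y /[!inE] /g0.
Qed.

Lemma normal_pdf_affine (m s u t : R) (z : R) : s != 0 -> 0 < t ->
  (t * normal_pdf (u + t * m) (t * s) (u + t * z) = normal_pdf m s z).
Proof.
move=> s0 t0; rewrite !normal_pdfE ?mulf_neq0 ?(gt_eqF t0)//.
rewrite /normal_peak /normal_fun.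
have -> : (t * s) ^+ 2 * pi *+ 2 = t ^+ 2 * (s ^+ 2 * pi *+ 2).
  by rewrite exprMn mulrnAr mulrA.
rewrite sqrtrM ?sqr_ge0// sqrtr_sqr gtr0_norm// invfM !mulrA divff ?(gt_eqF t0)//.
rewrite mul1r; congr (_ * expR _).
by field; rewrite s0 gt_eqF.
Qed.

Lemma normal_prob_affine (m s u t : R) (A : set R) : s != 0 -> 0 < t -> measurable A ->
  normal_prob (u + t * m) (t * s) A = normal_prob m s ((fun z => u + t * z) @^-1` A).
Proof.
move=> s0 t0 mA; rewrite /normal_prob (@ge0_integral_affine u t)//; last 2 first.
- by apply/measurable_EFinP; apply: measurable_funTS; exact: measurable_normal_pdf.
- by move=> x _; rewrite lee_fin normal_pdf_ge0.
have mpre : measurable ((fun z => u + t * z) @^-1` A).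
  rewrite -[X in measurable X]setTI.
  have mf : measurable_fun [set: measurableTypeR R]
      ((fun z => u + t * z) : measurableTypeR R -> measurableTypeR R).
    by apply: measurable_funD => //; apply: measurable_funM.
  exact: mf.
rewrite -ge0_integralZl//; last 3 first.
- apply/measurable_EFinP; apply: measurable_funTS.
  apply: measurableT_comp; first exact: measurable_normal_pdf.
  by apply: measurable_funD => //; apply: measurable_funM.
- by move=> x _; rewrite lee_fin normal_pdf_ge0.
- by rewrite lee_fin ltW.
by apply: eq_integral => x _; rewrite -EFinM normal_pdf_affine.
Qed.

Lemma normal_prob_std (m s : R) (A : set R) : 0 < s -> measurable A ->
  normal_prob m s A = normal_prob 0 1 ((fun z => m + s * z) @^-1` A).
Proof.
by move=> s0 mA; rewrite -normal_prob_affine// mulr0 addr0 mulr1.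
Qed.

End affine.

(** * Convolution of normal laws *)

Section gaussian_convolution.
Context {R : realType}.
Local Notation leb := (@lebesgue_measure R).
Local Notation RN := Radon_Nikodym_SigmaFinite.f.

(** The density and the Radon-Nikodym derivative of the normal law have the same integral over every
    measurable set, hence agree almost everywhere; this extends the formula from sets to
    functions. *)
Lemma integral_normal_prob (m s : R) (D : set R) (g : R -> \bar R) :
  measurable D -> measurable_fun D (g : measurableTypeR R -> \bar R) ->
  (forall x, 0 <= g x)%E ->
  (\int[normal_prob m s]_(x in D) g x =
   \int[leb]_(x in D) (g x * (normal_pdf m s x)%:E))%E.
Proof.
move=> mD mg g0.
rewrite -(@Radon_Nikodym_SigmaFinite.change_of_variables _ _ _ _ leb)//; last first.
  exact: normal_prob_dominates.
have intRN := Radon_Nikodym_SigmaFinite.f_integrable (@normal_prob_dominates R m s).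
apply: ae_eq_integral => //.
- apply: emeasurable_funM => //.
  by apply: measurable_funTS; exact: measurable_int intRN.
- apply: emeasurable_funM => //.
  by apply: measurable_funTS; apply/measurable_EFinP; exact: measurable_normal_pdf.
- apply: ae_eqe_mul2l.
  apply: integral_ae_eq => //.
  + exact: integrableS intRN.
  + by apply: measurable_funTS; apply/measurable_EFinP; exact: measurable_normal_pdf.
  + move=> A AD mA.
    by rewrite -Radon_Nikodym_SigmaFinite.f_integral//; exact: normal_prob_dominates.
Qed.

Lemma normal_peakE (s : R) : 0 < s -> normal_peak s = s^-1 * (Num.sqrt (pi *+ 2))^-1.
Proof.
move=> s0; rewrite /normal_peak -mulrnAr sqrtrM ?sqr_ge0//.
by rewrite sqrtr_sqr gtr0_norm// invfM.
Qed.

(** Bayes' formula for normal laws, by completing the square: the joint density of a summand and the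
    sum is the density of the sum times the conditional density of the summand, which is again
    normal. *)
Lemma normal_pdf_conv (m1 m2 s1 s2 s x y : R) : 0 < s1 -> 0 < s2 -> 0 < s ->
  s ^+ 2 = s1 ^+ 2 + s2 ^+ 2 ->
  normal_pdf (x + m2) s2 y * normal_pdf m1 s1 x =
  normal_pdf (m1 + m2) s y *
  normal_pdf (m1 + s1 ^+ 2 * (y - m1 - m2) / s ^+ 2) (s1 * s2 / s) x.
Proof.
move=> s10 s20 s0 ss.
have s'0 : 0 < s1 * s2 / s by rewrite divr_gt0// mulr_gt0.
rewrite !normal_pdfE ?gt_eqF// !normal_peakE//.
set k := (Num.sqrt _)^-1.
rewrite mulrACA [RHS]mulrACA; congr (_ * _).
  by field; rewrite !gt_eqF.
rewrite /normal_fun -!expRD; congr expR.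
have -> : (s1 * s2 / s) ^+ 2 = s1 ^+ 2 * s2 ^+ 2 / s ^+ 2.
  by field; rewrite gt_eqF.
rewrite ss; field; rewrite !gt_eqF// -?ss ?exprn_gt0//.
Qed.

(** After Tonelli, the conditional density in [normal_pdf_conv] is integrated over its own variable
    and contributes 1. *)
Lemma normal_prob_conv (m1 m2 s1 s2 s : R) (B : set R) : 0 < s1 -> 0 < s2 -> 0 < s ->
  s ^+ 2 = s1 ^+ 2 + s2 ^+ 2 -> measurable B ->
  (normal_prob m1 s1 \x normal_prob m2 s2)%E [set x | B (x.1 + x.2)] =
  normal_prob (m1 + m2) s B.
Proof.
move=> s10 s20 s0 ss mB.
rewrite /product_measure1 /=.
transitivity (\int[normal_prob m1 s1]_x normal_prob (x + m2) s2 B)%E.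
  apply: eq_integral => x _ /=.
  rewrite -[in RHS](mulr1 s2) -[in RHS](mul1r m2) -[in RHS](mulrC 1 s2) normal_prob_affine//; last first.
    by rewrite gt_eqF.
  congr normal_prob; apply/seteqP; split => y /=.
  - by rewrite /xsection /= inE /= mul1r.
  - by rewrite /xsection /= inE /= mul1r.
pose g x y : R := normal_pdf (x + m2) s2 y * normal_pdf m1 s1 x.
have mpdf (t u : R) : u != 0 -> measurable_fun [set: measurableTypeR R * measurableTypeR R]
   (fun x : measurableTypeR R * measurableTypeR R => normal_pdf (x.1 + t) u x.2).
  move=> u0; rewrite (_ : (fun _ => _) = normal_pdf t u \o (fun x => x.2 - x.1)).
    apply: measurableT_comp; first exact: measurable_normal_pdf.
    by apply: measurable_funB.
  apply/funext => x /=; rewrite !normal_pdfE// /normal_fun; congr (_ * expR _).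
  by congr (- _ / _); congr (_ ^+ 2); ring.
have mgg : measurable_fun [set: measurableTypeR R * measurableTypeR R]
   (fun x : measurableTypeR R * measurableTypeR R => (g x.1 x.2)%:E).
  apply/measurable_EFinP; apply: measurable_funM.
    by apply: mpdf; rewrite gt_eqF.
  by apply: measurableT_comp => //; exact: measurable_normal_pdf.
(* Writing N(x + m2, s2^2) as an affine image of the fixed law N(0, 1) turns the kernel into the
   measure of a section, whose measurability in [x] is known. *)
have mker : measurable_fun [set: measurableTypeR R]
   (fun x : measurableTypeR R => normal_prob (x + m2) s2 B).
  have mA : measurable [set z : measurableTypeR R * measurableTypeR R | B (z.1 + m2 + s2 * z.2)].
    rewrite -[X in measurable X]setTI.
    have mf : measurable_fun [set: measurableTypeR R * measurableTypeR R]
      (fun z => z.1 + m2 + s2 * z.2 : measurableTypeR R).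
      apply: measurable_funD; first by apply: measurable_funD.
      by apply: measurable_funM.
    exact: mf.
  have := measurable_fun_xsection (normal_prob 0 1) mA.
  apply: eq_measurable_fun => x _ /=.
  rewrite [RHS]normal_prob_std//; congr normal_prob.
  by apply/seteqP; split => y; rewrite /xsection /= inE.
rewrite integral_normal_prob//.
transitivity (\int[leb]_x \int[leb]_y ((g x y)%:E * (\1_B y)%:E))%E.
  apply: eq_integral => x _; rewrite /normal_prob.
  rewrite muleC -ge0_integralZl//; last 3 first.
  - by apply/measurable_EFinP; apply: measurable_funTS; exact: measurable_normal_pdf.
  - by move=> y _; rewrite lee_fin normal_pdf_ge0.
  - by rewrite lee_fin normal_pdf_ge0.
  rewrite integral_mkcond; apply: eq_integral => y _.
  rewrite patchE indicE; case: ifPn => yB; rewrite ?(mule1,mule0)//.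
  by rewrite -EFinM /g mulrC.
rewrite (@fubini_tonelli _ _ _ _ _ leb leb (fun x => ((g x.1 x.2)%:E * (\1_B x.2)%:E)%E))//=; last 2 first.
- apply: emeasurable_funM => //.
  by apply/measurable_EFinP; apply: measurableT_comp => //; exact: measurable_indic.
- by move=> x; rewrite -EFinM lee_fin !mulr_ge0// ?normal_pdf_ge0.
rewrite /normal_prob [RHS]integral_mkcond; apply: eq_integral => y _.
rewrite patchE indicE; case: ifPn => yB; last first.
  by under eq_integral do rewrite mule0; rewrite integral0.
under eq_integral do rewrite mule1 /g (normal_pdf_conv _ _ _ _ s10 s20 s0 ss) EFinM.
rewrite ge0_integralZl//; last 3 first.
- by apply/measurable_EFinP; exact: measurable_normal_pdf.
- by move=> x _; rewrite lee_fin normal_pdf_ge0.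
- by rewrite lee_fin normal_pdf_ge0.
by rewrite integral_normal_pdf mule1.
Qed.

End gaussian_convolution.

(** * Mixtures of product laws *)

Section mixture.
Context {R : realType} d (Om : measurableType d) (P : {measure set Om -> \bar R}).

(** A mixture has to be a measure in order to be compared with a joint law by uniqueness on a
    pi-system. Countable additivity is the exchange of the integral with a series of nonnegative
    terms. *)
Lemma mixture_measure d' (T : measurableType d') (c : Om -> R)
    (k : Om -> {measure set T -> \bar R}) :
  (forall w, 0 <= c w) ->
  (forall A, measurable A -> measurable_fun [set: Om] (fun w => (c w)%:E * k w A)%E) ->
  exists mix : {measure set T -> \bar R},
    forall A, mix A = (\int[P]_w ((c w)%:E * k w A))%E.
Proof.
move=> c0 mck.
pose mix A := (\int[P]_w ((c w)%:E * k w A))%E.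
have mix0 : mix set0 = 0%E.
  by rewrite /mix; under eq_integral do rewrite measure0 mule0; rewrite integral0.
have mix_ge0 A : (0 <= mix A)%E.
  by apply: integral_ge0 => w _; apply: mule_ge0; rewrite ?lee_fin.
have mix_sa : semi_sigma_additive mix.
  move=> F mF tF mUF.
  have -> : mix (\bigcup_n F n) = (\sum_(n <oo) mix (F n))%E.
    rewrite /mix -integral_nneseries//; last 2 first.
    - by move=> n; exact: mck.
    - by move=> n w _; apply: mule_ge0; rewrite ?lee_fin//; exact: measure_ge0.
    apply: eq_integral => w _.
    rewrite nneseriesZl//.
    congr (_ * _)%E; apply/esym/cvg_lim => //.
    exact: measure_semi_sigma_additive.
  apply: is_cvg_ereal_nneg_natsum_cond => n _ _; exact: mix_ge0.
by exists (HB.pack_for {measure set T -> \bar R} mix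
  (isMeasure.Build _ _ _ mix mix0 mix_ge0 mix_sa)).
Qed.

(** All the product laws are images of one fixed pair of standard normals under an affine map
    depending on [w], so that again only the measure of a section has to be measurable. *)
Lemma measurable_normal_prob2 (u v : Om -> R) (s t : R) (D : set (measurableTypeR R * measurableTypeR R)) :
  measurable_fun [set: Om] u -> measurable_fun [set: Om] v ->
  0 < s -> 0 < t -> measurable D ->
  measurable_fun [set: Om]
    (fun w => (normal_prob (u w) s \x normal_prob (v w) t)%E D).
Proof.
move=> mu mv s0 t0 mD.
pose T := (measurableTypeR R * measurableTypeR R)%type.
pose h (x : Om * T) : T := (u x.1 + s * x.2.1, v x.1 + t * x.2.2).
have mh : measurable_fun setT h.
  apply/measurable_fun_pairP; split => /=.
    apply: (@measurable_realfun.measurable_funD _ (Om * T)%type R setT (fun x => u x.1) (fun x => s * x.2.1)).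
      by apply: measurableT_comp.
    apply: measurable_funM => //.
    exact: (measurableT_comp measurable_fst measurable_snd).
  apply: (@measurable_realfun.measurable_funD _ (Om * T)%type R setT (fun x => v x.1) (fun x => t * x.2.2)).
    by apply: measurableT_comp.
  apply: measurable_funM => //.
  exact: (measurableT_comp measurable_snd measurable_snd).
have mhD : measurable (h @^-1` D) by rewrite -[X in measurable X]setTI; exact: mh.
pose N2 : probability T R := (normal_prob (0%R : R) 1%R \x normal_prob (0%R : R) 1%R)%E.
have := measurable_fun_xsection N2 mhD.
apply: eq_measurable_fun => w _ /=.
have mhw : measurable_fun setT (fun y : T => h (w, y)).
  exact: measurableT_comp mh (measurable_pair1 _).
pose m' := pushforward_measure N2 mhw.
transitivity (m' D).
  by rewrite /m' /= /pushforward; congr product_measure1; apply/seteqP; split => y; rewrite /xsection /= inE.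
apply/esym; apply: product_measure_unique => // A B mA mB.
rewrite /= (normal_prob_std (u w))// [in RHS](normal_prob_std (v w))//.
rewrite /m' /= /pushforward /=.
rewrite -product_measure1E//.
- rewrite -[X in measurable X]setTI.
  have m1 : measurable_fun [set: measurableTypeR R] (fun z : measurableTypeR R => u w + s * z : measurableTypeR R).
    by apply: measurable_funD => //; apply: measurable_funM.
  exact: m1.
- rewrite -[X in measurable X]setTI.
  have m1 : measurable_fun [set: measurableTypeR R] (fun z : measurableTypeR R => v w + t * z : measurableTypeR R).
    by apply: measurable_funD => //; apply: measurable_funM.
  exact: m1.
Qed.

(* The joint law of [S] and [X] on [E] is a mixture of products of Gaussian laws:
   both measures agree on rectangles. *)
Lemma mixture_normal_sum (E : set Om) (S X : Om -> R) (c : Om -> R) (u v : Om -> R) (s t r : R) :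
  measurable E -> (P E < +oo)%E ->
  measurable_fun [set: Om] S -> measurable_fun [set: Om] X ->
  measurable_fun [set: Om] c -> (forall w, 0 <= c w) ->
  measurable_fun [set: Om] u -> measurable_fun [set: Om] v ->
  0 < s -> 0 < t -> 0 < r -> r ^+ 2 = s ^+ 2 + t ^+ 2 ->
  (forall B B' : set R, measurable B -> measurable B' ->
    P (E `&` (S @^-1` B `&` X @^-1` B')) =
    (\int[P]_w ((c w)%:E * (normal_prob (u w) s B * normal_prob (v w) t B')))%E) ->
  forall D : set R, measurable D ->
    P (E `&` (S \+ X) @^-1` D) =
    (\int[P]_w ((c w)%:E * normal_prob (u w + v w) r D))%E.
Proof.
move=> mE PE mS mX mc c0 mu mv s0 t0 r0 rst H D mD.
pose T := (measurableTypeR R * measurableTypeR R)%type.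
have mck A : measurable A -> measurable_fun [set: Om]
    (fun w => (c w)%:E * (normal_prob (u w) s \x normal_prob (v w) t) A)%E.
  by move=> mA; apply: emeasurable_funM; [exact/measurable_EFinP|exact: measurable_normal_prob2].
have [mix mixE] := @mixture_measure _ T c
  (fun w => (normal_prob (u w) s \x normal_prob (v w) t)%E) c0 mck.
have mSX : measurable_fun [set: Om] (fun w => (S w, X w) : T).
  by apply/measurable_fun_pairP.
pose m1 := pushforward_measure (mrestr P mE) mSX.
pose DD : set T := [set x | D (x.1 + x.2)].
have mDD : measurable DD.
  rewrite -[X in measurable X]setTI.
  have madd : measurable_fun [set: T] (fun x : T => x.1 + x.2 : measurableTypeR R).
    by apply: measurable_funD.
  exact: madd.
transitivity (m1 DD).
  by rewrite /m1 /= /pushforward /mrestr setIC.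
transitivity (mix DD); last first.
  by rewrite mixE; apply: eq_integral => w _; congr (_ * _)%E; exact: normal_prob_conv.
apply: (measure_unique [set C : set T| exists A, measurable A /\ exists B, measurable B /\ C = A `*` B] (fun=> setT)) => //.
- rewrite measurable_prod_measurableType//; congr (<<s _ >>).
  apply/seteqP; split => [_ [A mA [B mB <-]]|_ [A [mA [B [mB ->]]]]].
    by exists A; split => //; exists B.
  by exists A => //; exists B.
- move=> _ _ [A1 [mA1 [A2 [mA2 ->]]]] [B1 [mB1 [B2 [mB2 ->]]]].
  rewrite -setXI; exists (A1 `&` B1); split; first exact: measurableI.
  by exists (A2 `&` B2); split; first exact: measurableI.
- by move=> _; exists setT; split => //; exists setT; split => //; rewrite setXTT.
- by rewrite bigcup_const.
- move=> _ [A [mA [B [mB ->]]]].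
  rewrite mixE.
  transitivity (P (E `&` (S @^-1` A `&` X @^-1` B))).
    by rewrite /m1 /= /pushforward /mrestr setIC.
  rewrite H//; apply: eq_integral => w _; congr (_ * _)%E.
  by apply/esym; exact: product_measure1E.
- by move=> _; rewrite /m1 /= /pushforward /mrestr preimage_setT setTI.
Qed.

End mixture.

(** * Sums along one column of the array *)

Section gaussian_array.
Context {R : realType} d (Om : measurableType d) (P : probability Om R).

Lemma measurable_normal_prob (u : Om -> R) (s : R) (B : set R) :
  measurable_fun [set: Om] u -> 0 < s -> measurable B ->
  measurable_fun [set: Om] (fun w => normal_prob (u w) s B).
Proof.
move=> mu s0 mB.
have mA : measurable [set z : Om * measurableTypeR R | B (u z.1 + s * z.2)].
  rewrite -[X in measurable X]setTI.
  have mf : measurable_fun [set: Om * measurableTypeR R]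
      (fun z => u z.1 + s * z.2 : measurableTypeR R).
    apply: measurable_realfun.measurable_funD; first by apply: measurableT_comp.
    by apply: measurable_funM.
  exact: mf.
have := measurable_fun_xsection (normal_prob 0 1) mA.
apply: eq_measurable_fun => x _ /=.
rewrite [RHS]normal_prob_std//; congr normal_prob.
by apply/seteqP; split => y; rewrite /xsection /= inE.
Qed.

(* Stated for partial sums so that the induction on [k] can move the coordinates
   from the product into the sum one at a time. *)
Lemma gaussian_array_sum (n : nat) (M : {RV P >-> R}) (X : 'I_n -> {RV P >-> R}) (sigma : R) :
  0 < sigma ->
  (forall (A : set R) (B : 'I_n -> set R), measurable A -> (forall j, measurable (B j)) ->
    P [set w | A (M w) /\ (forall j, B j (X j w))] =
    (\int[P]_(w in M @^-1` A) \prod_(j < n) normal_prob (M w) sigma (B j))%E) ->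
  forall k : nat, (0 < k <= n)%N ->
  forall (A D : set R) (B : 'I_n -> set R), measurable A -> measurable D ->
    (forall j, measurable (B j)) ->
    P [set w | [/\ A (M w), D (\sum_(j < n | (j < k)%N) X j w)
         & forall j : 'I_n, (k <= j)%N -> B j (X j w)]] =
    (\int[P]_w ((\1_A (M w))%:E * (normal_prob (k%:R * M w) (Num.sqrt k%:R * sigma) D *
       \prod_(j < n | (k <= j)%N) normal_prob (M w) sigma (B j))))%E.
Proof.
move=> s0 H; elim => // k IHk /andP[_ kn] A D B mA mD mB.
(* For a sum with one term, the constraint [D] simply takes the place of the constraint on
   coordinate 0. *)
have [k0|k_gt0] := posnP k.
  subst k.
  pose o : 'I_n := Ordinal kn.
  pose B' j := if j == o then D else B j.
  have mB' j : measurable (B' j) by rewrite /B'; case: ifP.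
  have jo (j : 'I_n) : (j < 1)%N = (j == o) by rewrite ltnS leqn0.
  transitivity (P [set w | A (M w) /\ (forall j, B' j (X j w))]).
    congr (P _); apply/seteqP; split => w /=.
      under eq_bigl do rewrite jo.
      rewrite big_pred1_eq => -[AM DX BX]; split => // j; rewrite /B'.
      case: eqP => [->//|/eqP jno]; apply: BX.
      by rewrite lt0n; apply: contra jno => /eqP j0; apply/eqP/val_inj.
    move=> [AM BX]; split => //.
      under eq_bigl do rewrite jo.
      by rewrite big_pred1_eq; have := BX o; rewrite /B' eqxx.
    by move=> j j1; have := BX j; rewrite /B' -jo ltnNge j1.
  rewrite H// [LHS]integral_mkcond; apply: eq_integral => w _.
  rewrite patchE indicE.
  have -> : (w \in M @^-1` A) = (M w \in A).
    by apply/idP/idP; rewrite !inE.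
  case: ifPn => MA; rewrite ?mul0e// mul1e.
  rewrite (bigD1 o)//= {1}/B' eqxx sqrtr1 !mul1r; congr (_ * _)%E.
  apply: eq_big => [j|j jno]; first by rewrite -jo -leqNgt.
  by rewrite /B' (negPf jno).
have kn' : (k <= n)%N by exact: ltnW.
pose o : 'I_n := Ordinal kn.
pose E := [set w | A (M w) /\ forall j : 'I_n, (k < j)%N -> B j (X j w)].
pose S w := \sum_(j < n | (j < k)%N) X j w.
(* Given the effect, the constraints on the coordinates beyond [o] are independent of the partial
   sum and of [X o]; they enter the mixture as a weight. *)
pose c w : R := \1_A (M w) * \prod_(j < n | (k < j)%N) fine (normal_prob (M w) sigma (B j)).
have cE w : (c w)%:E = ((\1_A (M w))%:E *
   \prod_(j < n | (k < j)%N) normal_prob (M w) sigma (B j))%E.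
  rewrite /c EFinM; congr (_ * _)%E.
  rewrite -prodEFin.
  apply: eq_bigr => j _; rewrite fineK//; exact: (fin_num_measure (normal_prob (M w) sigma) _ (mB j)).
have mXj j : measurable_fun [set: Om] (X j) by exact: measurable_funPT.
have mM : measurable_fun [set: Om] M by exact: measurable_funPT.
have mE : measurable E.
  have -> : E = M @^-1` A `&` \bigcap_(j in [set j : 'I_n | (k < j)%N]) (X j @^-1` B j).
    by apply/seteqP; split => w /= [h1 h2]; split => // j; exact: h2.
  apply: measurableI.
    by rewrite -[X in measurable X]setTI; exact: mM.
  apply: fin_bigcap_measurable => // j _.
  by rewrite -[X in measurable X]setTI; exact: mXj.
have mS : measurable_fun [set: Om] S.
  rewrite (_ : S = fun w => \sum_(j < n) (if (j < k)%N then X j w else 0)); last first.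
    by apply/funext => w; exact: big_mkcond.
  by apply: measurable_sum => j; case: (j < k)%N.
have mc : measurable_fun [set: Om] c.
  apply: measurable_funM.
    by apply: measurableT_comp => //; exact: measurable_indic.
  rewrite (_ : (fun _ => _) = fun w => \prod_(j < n)
      (if (k < j)%N then fine (normal_prob (M w) sigma (B j)) else 1)); last first.
    by apply/funext => w; exact: big_mkcond.
  apply: measurable_prod => j _; case: (k < j)%N => //.
  by apply: measurableT_comp => //; exact: measurable_normal_prob.
have c0 w : 0 <= c w.
  by rewrite mulr_ge0// prodr_ge0// => j _; exact: fine_ge0.
have E1 : (P E < +oo)%E by rewrite (le_lt_trans (probability_le1 P mE))// ltry.
have kR : 0 < k%:R :> R by rewrite ltr0n.
have r0 : 0 < Num.sqrt k%:R * sigma by rewrite mulr_gt0// sqrtr_gt0.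
have r1 : 0 < Num.sqrt k.+1%:R * sigma by rewrite mulr_gt0// sqrtr_gt0.
have rr : (Num.sqrt k.+1%:R * sigma) ^+ 2 = (Num.sqrt k%:R * sigma) ^+ 2 + sigma ^+ 2.
  by rewrite !exprMn !sqr_sqrtr// -natr1; ring.
have mkM : measurable_fun [set: Om] (fun w => k%:R * M w) by exact: measurable_funM.
transitivity (P (E `&` (S \+ X o) @^-1` D)).
  congr (P _); apply/seteqP; split => w /=.
    move=> [AM DX BX]; split => //=; rewrite /S.
    move: DX; rewrite (bigD1 o)//= addrC.
    congr (D (_ + _)); apply: eq_bigl => j.
    by rewrite ltnS [RHS]ltn_neqAle andbC.
  move=> [[AM BX] DX]; split => //.
  rewrite (bigD1 o)//= addrC; move: DX; rewrite /S.
  congr (D (_ + _)); apply: eq_bigl => j.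
  by rewrite ltnS [LHS]ltn_neqAle andbC.
rewrite (@mixture_normal_sum R _ _ P E S (X o) c (fun w => k%:R * M w) M _ _ _
  mE E1 mS (mXj o) mc c0 mkM mM r0 s0 r1 rr)//.
  apply: eq_integral => w _; rewrite cE -muleA; congr (_ * _)%E.
  by rewrite muleC -natr1 mulrDl mul1r.
(* The rectangle formula is the induction hypothesis with [D2] imposed on coordinate [o]. *)
move=> D1 D2 mD1 mD2.
  pose B' j := if j == o then D2 else B j.
  have mB' j : measurable (B' j) by rewrite /B'; case: ifP.
  have := IHk _ A D1 B' mA mD1 mB'.
  rewrite k_gt0 kn' => /(_ isT) => HH.
  transitivity (P [set w | [/\ A (M w), D1 (\sum_(j < n | (j < k)%N) X j w)
         & forall j : 'I_n, (k <= j)%N -> B' j (X j w)]]).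
    congr (P _); apply/seteqP; split => w /=.
      move=> [[AM BX] [SD1 XD2]]; split => // j; rewrite leq_eqVlt /B'.
      case: (eqVneq j o) => [->//|jno] /orP[/eqP kj|]; last exact: BX.
      by case/eqP: jno; apply/val_inj.
    move=> [AM SD1 BX]; split; [split => //|split => //].
      move=> j kj; have := BX j (ltnW kj); rewrite /B'; case: eqP => // jo.
      by move: kj; rewrite jo ltnn.
    by have := BX o (leqnn _); rewrite /B' eqxx.
  rewrite HH; apply: eq_integral => w _.
  rewrite cE -!muleA; congr (_ * _)%E.
  rewrite (bigD1 o)//= {1}/B' eqxx [RHS]muleC -muleA; congr (_ * (_ * _))%E.
  apply: eq_big => [j|j /andP[_ jno]]; last by rewrite /B' (negPf jno).
  rewrite ltn_neqAle andbC; congr (_ && _).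
  by rewrite eq_sym.
Qed.
End gaussian_array.

(** * Errors of threshold rules in the two-groups model *)

Section accept.
Context {R : realType}.

Definition std_prob (l r : R) : R := fine (normal_prob (0 : R) 1 `]l, r[%classic).

(* Power is measured in standardized units: [k] plays the role of
   [sqrt n / sigma], so that [k * t] is the mean of the test statistic. *)
Definition accept_set (k l r : R) : set (measurableTypeR R * measurableTypeR R) :=
  [set x | l < k * x.1 + x.2 < r].

(** Effect and noise are kept as two coordinates, so that acceptance is a planar event that can be
    sliced along either of them. *)
Definition effect_noise (nu : probability (measurableTypeR R) R) :
    probability (measurableTypeR R * measurableTypeR R)%type R :=
  (nu \x normal_prob (0%R : R) 1%R)%E.

Definition accept (nu : probability (measurableTypeR R) R) (k l r : R) : R :=
  fine (effect_noise nu (accept_set k l r)).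

Lemma measurable_accept_set (k l r : R) : measurable (accept_set k l r).
Proof.
have mf : measurable_fun [set: measurableTypeR R * measurableTypeR R]
    (fun x => k * x.1 + x.2 : measurableTypeR R).
  by apply: measurable_funD => //; apply: measurable_funM.
have -> : accept_set k l r = (fun x => k * x.1 + x.2) @^-1` `]l, r[%classic.
  by apply/seteqP; split => x /=; rewrite /accept_set /= in_itv.
by rewrite -[X in measurable X]setTI; exact: mf.
Qed.

End accept.

(** * Law of the sample mean and exact risks *)

Section model_errors.
Context {R : realType} (nu : probability (measurableTypeR R) R).

Lemma integral_effect_law d (Om : measurableType d) (P : probability Om R) (p : R)
    (M : {RV P >-> R}) (h : R -> \bar R) : 0 < p < 1 ->
  (forall A : set R, measurable A -> P (M @^-1` A) = effect_law p nu A) ->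
  measurable_fun [set: measurableTypeR R] (h : measurableTypeR R -> \bar R) ->
  (forall x, 0 <= h x)%E ->
  (\int[P]_w h (M w) = (1 - p)%:E * h 0%R + p%:E * \int[nu]_t h t)%E.
Proof.
move=> /andP[p0 p1] HM mh h0.
have p'0 : 0 <= 1 - p by rewrite subr_ge0 ltW.
have p0' : 0 <= p by exact: ltW.
have mM : measurable_fun [set: Om] (M : Om -> measurableTypeR R).
  have mM0 : measurable_fun [set: Om] M by exact: measurable_funPT.
  exact: mM0.
pose D0 : {measure set (measurableTypeR R) -> \bar R} := \d_(0 : measurableTypeR R).
pose m' := measure_add (mscale (NngNum p'0) D0) (mscale (NngNum p0') nu).
transitivity (\int[pushforward_measure P mM]_t h t)%E.
  by rewrite ge0_integral_pushforward.
rewrite (@eq_measure_integral _ _ _ _ m'); last first.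
  by move=> A mA _; rewrite [RHS]measure_addE; exact: HM.
rewrite ge0_integral_measure_add// !ge0_integral_mscale//= integral_dirac//.
by rewrite diracT mul1e.
Qed.

Context d (Om : measurableType d) (P : probability Om R) (m n : nat) (p sigma : R)
  (mu : 'I_m -> {RV P >-> R}) (X : 'I_n -> 'I_m -> {RV P >-> R}).
Hypotheses (hn : (0 < n)%N) (hp : 0 < p < 1) (hsigma : 0 < sigma).
Hypothesis hmodel : two_groups_model p sigma nu mu X.

Local Notation k := (Num.sqrt n%:R / sigma).

Let nR : 0 < n%:R :> R. Proof. by rewrite ltr0n. Qed.
Let sn : 0 < Num.sqrt n%:R :> R. Proof. by rewrite sqrtr_gt0. Qed.
Let k0 : 0 < k. Proof. by rewrite divr_gt0. Qed.

Lemma effect_marginal (i : 'I_m) (A : set R) : measurable A ->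
  P (mu i @^-1` A) = effect_law p nu A.
Proof.
move=> mA; have [H _] := hmodel.
have := H (fun j => if j == i then A else setT).
have mAA (j : 'I_m) : measurable (if j == i then A else setT) by case: ifP.
move=> /(_ mAA).
rewrite (bigD1 i)//= eqxx big1 ?mule1; last first.
  move=> j /negPf ->; rewrite /effect_law diracT probability_setT !mule1.
  by rewrite -EFinD subrK.
move=> <-; congr (P _); apply/seteqP; split => w /=.
  by move=> Aw j; case: eqP => // ->.
by move=> /(_ i); rewrite eqxx.
Qed.

Lemma sum_law (i : 'I_m) (A D : set R) : measurable A -> measurable D ->
  P [set w | A (mu i w) /\ D (\sum_(j < n) X j i w)] =
  (\int[P]_w ((\1_A (mu i w))%:E *
     normal_prob (n%:R * mu i w) (Num.sqrt n%:R * sigma) D))%E.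
Proof.
move=> mA mD; have [_ H] := hmodel.
have H' (A0 : set R) (B : 'I_n -> set R) : measurable A0 -> (forall j, measurable (B j)) ->
    P [set w | A0 (mu i w) /\ (forall j, B j (X j i w))] =
    (\int[P]_(w in mu i @^-1` A0) \prod_(j < n) normal_prob (mu i w) sigma (B j))%E.
  move=> mA0 mB.
  have := H (fun l => if l == i then A0 else setT) (fun j l => if l == i then B j else setT).
  have mAA (j : 'I_m) : measurable (if j == i then A0 else setT) by case: ifP.
  have mBB j (l : 'I_m) : measurable (if l == i then B j else setT) by case: ifP.
  move=> /(_ mAA mBB).
  have -> : [set w | forall i0, (if i0 == i then A0 else [set: R]) (mu i0 w)] = mu i @^-1` A0.
    apply/seteqP; split => w /=; first by move=> /(_ i); rewrite eqxx.
    by move=> Aw j; case: eqP => // ->.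
  under eq_integral => w _.
    rewrite (bigD1 i)//= eqxx [X in (_ * X)%E]big1 ?mule1; last first.
      move=> l /negPf ->; rewrite big1// => j _.
      exact: (@probability_setT _ _ _ (normal_prob (mu l w) sigma)).
    over.
  move=> <-; congr (P _); apply/seteqP; split => w /=.
    by move=> [Aw Bw]; split => [l|j l]; case: eqP => // ->.
  by move=> [/(_ i) + Bw]; rewrite eqxx => Aw; split => // j; have := Bw j i; rewrite eqxx.
have hnn : (0 < n <= n)%N by rewrite hn leqnn.
have := gaussian_array_sum hsigma H' hnn mA mD (fun=> measurableT).
have -> : [set w | [/\ A (mu i w), D (\sum_(j < n | (j < n)%N) X j i w)
      & forall j : 'I_n, (n <= j)%N -> [set: R] (X j i w)]] =
   [set w | A (mu i w) /\ D (\sum_(j < n) X j i w)].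
  have E w : \sum_(j < n | (j < n)%N) X j i w = \sum_(j < n) X j i w.
    by apply: eq_bigl => j; rewrite ltn_ord.
  by apply/seteqP; split => w /=; rewrite E => -[].
move=> ->; apply: eq_integral => w _; rewrite big1 ?mule1// => j.
by rewrite leqNgt ltn_ord.
Qed.

Lemma mean_law (i : 'I_m) (A : set R) (a b : R) : measurable A ->
  P [set w | A (mu i w) /\ a < sample_mean X i w < b] =
  ((1 - p)%:E * ((\1_A (0 : R))%:E * (std_prob (k * a) (k * b))%:E) +
   p%:E * \int[nu]_t ((\1_A t)%:E *
      normal_prob 0 1 [set z : R | (k * a < k * t + z < k * b)%R]))%E.
Proof.
move=> mA.
(* Given the effect [x], the sum is N(n x, n sigma^2). Dividing by sqrt n * sigma leaves k x + z,
   and the endpoints n a, n b become k a, k b. *)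
have preE (x : R) : (fun z : R => n%:R * x + Num.sqrt n%:R * sigma * z) @^-1`
   `]n%:R * a, n%:R * b[%classic = [set z : R | k * a < k * x + z < k * b].
  have nk : n%:R = (Num.sqrt n%:R * sigma) * k.
    rewrite -{1}(@sqr_sqrtr _ n%:R)//; field; by rewrite gt_eqF.
  have c0 : 0 < Num.sqrt n%:R * sigma by rewrite mulr_gt0.
  have ea : n%:R * a = (Num.sqrt n%:R * sigma) * (k * a) by rewrite mulrA -nk.
  have eb : n%:R * b = (Num.sqrt n%:R * sigma) * (k * b) by rewrite mulrA -nk.
  have ez z : n%:R * x + Num.sqrt n%:R * sigma * z = (Num.sqrt n%:R * sigma) * (k * x + z).
    by rewrite mulrDr mulrA -nk.
  by apply/seteqP; split => z /=; rewrite in_itv /= ea eb ez !ltr_pM2l.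
have mI (x : R) : measurable [set z : R | k * a < k * x + z < k * b].
  rewrite -preE -[X in measurable X]setTI.
  have mf : measurable_fun [set: measurableTypeR R]
    (fun z => n%:R * x + Num.sqrt n%:R * sigma * z : measurableTypeR R).
    by apply: measurable_funD => //; apply: measurable_funM.
  exact: mf.
have E0 : (std_prob (k * a) (k * b))%:E = normal_prob 0 1 [set z : R | k * a < k * 0 + z < k * b].
  have -> : [set z : R | k * a < k * 0 + z < k * b] = `]k * a, k * b[%classic.
    by apply/seteqP; split => z /=; rewrite in_itv /= mulr0 add0r.
  by rewrite fineK//; exact: (fin_num_measure (normal_prob (0 : R) 1)).
rewrite E0.
have -> : [set w | A (mu i w) /\ a < sample_mean X i w < b] =
    [set w | A (mu i w) /\ `]n%:R * a, n%:R * b[%classic (\sum_(j < n) X j i w)].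
  by apply/seteqP; split => w /=; rewrite in_itv /= /sample_mean ltr_pdivlMr// ltr_pdivrMr//
     (mulrC a) (mulrC b).
rewrite sum_law//.
have c0 : 0 < Num.sqrt n%:R * sigma by rewrite mulr_gt0.
under eq_integral do rewrite normal_prob_std// preE.
pose h t := ((\1_A t)%:E * normal_prob 0 1 [set z : R | (k * a < k * t + z < k * b)%R])%E.
rewrite -[LHS]/(\int[P]_w h (mu i w))%E.
apply: (@integral_effect_law _ _ _ p (mu i) h) => //.
- exact: effect_marginal.
- apply: emeasurable_funM.
    by apply/measurable_EFinP; exact: measurable_indic.
  have mset : measurable (accept_set k (k * a) (k * b)) by exact: measurable_accept_set.
  have := measurable_fun_xsection (normal_prob 0 1) mset.
  by apply: eq_measurable_fun => x _ /=; congr normal_prob; apply/seteqP; split => y;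
    rewrite /xsection /= inE.
- by move=> x; rewrite mule_ge0// lee_fin.
Qed.

Hypothesis nu0 : nu [set 0] = 0%E.

Let mset0 : measurable ([set 0] : set R). Proof. exact: measurable_set1. Qed.

Let mE0 (A : set R) : measurable A -> forall i, measurable [set w | A (mu i w)].
Proof.
move=> mA i; have mM : measurable_fun [set: Om] (mu i) by exact: measurable_funPT.
by rewrite -[X in measurable X]setTI; exact: mM.
Qed.

Lemma measurable_sample_mean (i : 'I_m) : measurable_fun [set: Om] (sample_mean X i).
Proof.
apply: measurable_funM => //.
by apply: measurable_sum => j; exact: measurable_funPT.
Qed.

Let mEI (a b : R) i : measurable [set w | a < sample_mean X i w < b].
Proof.
rewrite -[X in measurable X]setTI.
have -> : [set w | a < sample_mean X i w < b] = sample_mean X i @^-1` `]a, b[%classic.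
  by apply/seteqP; split => w /=; rewrite in_itv.
exact: measurable_sample_mean.
Qed.

Let g (a b t : R) := normal_prob 0 1 [set z : R | (k * a < k * t + z < k * b)%R].

Let mg a b : measurable_fun [set: measurableTypeR R] (g a b : measurableTypeR R -> \bar R).
Proof.
have mset : measurable (accept_set k (k * a) (k * b)) by exact: measurable_accept_set.
have := measurable_fun_xsection (normal_prob 0 1) mset.
by apply: eq_measurable_fun => x _ /=; congr normal_prob; apply/seteqP; split => y;
    rewrite /xsection /= inE.
Qed.

Let g0 a b t : (0 <= g a b t)%E.
Proof. exact: (measure_ge0 (normal_prob (0 : R) 1)). Qed.

Let mindg a b (A : set R) : measurable A ->
  measurable_fun [set: measurableTypeR R]
    ((fun t => (\1_A t)%:E * g a b t)%E : measurableTypeR R -> \bar R).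
Proof.
move=> mA; apply: emeasurable_funM; last exact: mg.
by apply/measurable_EFinP; exact: measurable_indic.
Qed.

(** Since [nu] does not charge 0, the value 0 of an effect marks the null hypotheses up to
    probability zero. *)
Let null_int (h : measurableTypeR R -> \bar R) :
  measurable_fun [set: measurableTypeR R] h -> (forall t, 0 <= h t)%E ->
  (\int[nu]_t h t = \int[nu]_(t in [set: R] `\` [set 0%R]) h t)%E.
Proof. by move=> mh h0; apply: ge0_negligible_integral. Qed.

Lemma acceptE (a b : R) : (accept nu k (k * a) (k * b))%:E = (\int[nu]_t g a b t)%E.
Proof.
rewrite /accept fineK; last first.
  by apply: fin_num_measure; exact: measurable_accept_set.
apply: eq_integral => t _ /=; congr normal_prob.
by apply/seteqP; split => y; rewrite /xsection /= inE.
Qed.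

Lemma effect_null i : P [set w | mu i w = 0] = (1 - p)%:E.
Proof.
have := effect_marginal i mset0; rewrite /effect_law nu0 mule0 adde0 diracE.
by rewrite mem_set// mule1.
Qed.

Lemma effect_nonnull i : P [set w | mu i w <> 0] = p%:E.
Proof.
have -> : [set w | mu i w <> 0] = ~` [set w | mu i w = 0] by [].
rewrite probability_setC; last exact: (mE0 mset0 i).
by rewrite effect_null -EFinB; congr EFin; ring.
Qed.

Lemma null_accept i (a b : R) :
  P [set w | mu i w = 0 /\ a < sample_mean X i w < b] =
  ((1 - p) * std_prob (k * a) (k * b))%:E.
Proof.
rewrite (mean_law i a b mset0) indicE mem_set// mul1e.
have -> : (\int[nu]_t ((\1_[set (0 : R)] t)%:E * g a b t) = 0)%E.
  apply: (etrans (null_int (mindg a b mset0) _)).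
    by move=> t; rewrite mule_ge0// lee_fin.
  by rewrite integral0_eq// => t [_ /= t0]; rewrite indicE memNset ?mul0e.
by rewrite mule0 adde0 EFinM.
Qed.

Lemma nonnull_accept i (a b : R) :
  P [set w | mu i w <> 0 /\ a < sample_mean X i w < b] =
  (p * accept nu k (k * a) (k * b))%:E.
Proof.
have mC0 : measurable (~` [set 0] : set R) by exact: measurableC.
rewrite (mean_law i a b mC0) indicE memNset ?mul0e ?mule0 ?add0e; last by move=> /(_ erefl).
rewrite EFinM acceptE; congr (_ * _)%E.
apply: (etrans (null_int (mindg a b mC0) _)).
  by move=> t; rewrite mule_ge0// lee_fin.
apply/esym; apply: (etrans (null_int (mg a b) (g0 a b))); apply/esym.
apply: eq_integral => t; rewrite inE => -[_ /= t0].
by rewrite indicE mem_set ?mul1e.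
Qed.

Lemma null_reject i (a b : R) :
  P [set w | mu i w = 0 /\ ~~ (a < sample_mean X i w < b)] =
  ((1 - p) * (1 - std_prob (k * a) (k * b)))%:E.
Proof.
have m0 := mE0 mset0 i; have mI := mEI a b i.
have -> : [set w | mu i w = 0 /\ ~~ (a < sample_mean X i w < b)] =
    [set w | mu i w = 0] `\` [set w | mu i w = 0 /\ a < sample_mean X i w < b].
  apply/seteqP; split => w /=; first by move=> [h1 /negP h2]; split => // -[].
  by move=> [h1 h2]; split => //; apply/negP => h3; apply: h2.
transitivity (P [set w | mu i w = 0%R] - P [set w | mu i w = 0%R /\ (a < sample_mean X i w < b)%R])%E.
  rewrite measureD; last 3 first.
  - exact: m0.
  - exact: measurableI.
  - by rewrite (le_lt_trans (probability_le1 _ _)) ?ltry//; exact: m0.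
  by rewrite setIidr// => w [].
by rewrite effect_null null_accept -EFinB; congr EFin; ring.
Qed.

(** A count is a sum of indicators, so its expectation only involves the individual probabilities,
    whatever the dependence between the tests. *)
Lemma expected_count (Q : 'I_m -> Om -> bool) (q : R) :
  (forall i, measurable [set w | Q i w]) -> (forall i, P [set w | Q i w] = q%:E) ->
  ('E_P[fun w => (#|[pred i : 'I_m | Q i w]|)%:R] = (m%:R * q)%:E)%E.
Proof.
move=> mQ HQ; rewrite unlock.
under eq_integral => w _.
  rewrite -sum1_card big_mkcond natr_sum -sumEFin /=.
  under eq_bigr => i _.
    rewrite (_ : _%:E = (\1_[set w | Q i w] w)%:E); last first.
      rewrite indicE; have -> : (w \in [set w | Q i w]) = Q i w.
        by apply/idP/idP; rewrite inE.
      by rewrite inE; case: (Q i w).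
    over.
  over.
rewrite ge0_integral_sum//; last first.
  by move=> i; apply/measurable_EFinP; exact: measurable_indic.
transitivity (\sum_(i < m) q%:E)%E.
  by apply: eq_bigr => i _; rewrite integral_indic// setIT; exact: HQ.
by rewrite sumEFin sumr_const card_ord mulr_natl.
Qed.

Lemma risk_interval_rule (delta0 deltaA a b : R) :
  risk P delta0 deltaA mu (interval_rule a b X) =
  m%:R * (delta0 * ((1 - p) * (1 - std_prob (k * a) (k * b))) +
          deltaA * (p * accept nu k (k * a) (k * b))).
Proof.
rewrite /risk /false_rejections /false_nonrejections.
have E1 i : [set w | (mu i w == 0) && interval_rule a b X i w] =
    [set w | mu i w = 0 /\ ~~ (a < sample_mean X i w < b)].
  by apply/seteqP; split => w /=; [case/andP => /eqP|case=> -> h; rewrite eqxx].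
have E2 i : [set w | (mu i w != 0) && ~~ interval_rule a b X i w] =
    [set w | mu i w <> 0 /\ a < sample_mean X i w < b].
  apply/seteqP; split => w /=; rewrite /interval_rule negbK.
    by case/andP => /eqP.
  by case=> /eqP h1 h2; rewrite h1.
rewrite (@expected_count _ ((1 - p) * (1 - std_prob (k * a) (k * b)))); last 2 first.
- move=> i; rewrite E1; apply: measurableI; first exact: (mE0 mset0 i).
  by have := measurableC (mEI a b i); congr (measurable _); apply/seteqP; split => w /= /negP.
- by move=> i; rewrite E1 null_reject.
rewrite (@expected_count _ (p * accept nu k (k * a) (k * b))); last 2 first.
- move=> i; rewrite E2; apply: measurableI; last exact: mEI.
  by apply: (mE0 (measurableC mset0)).
- by move=> i; rewrite E2 nonnull_accept.
rewrite /=; ring.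
Qed.

Lemma symmetric_ruleE (c : R) i w : 0 < c ->
  symmetric_rule sigma c X i w = interval_rule (- c / k) (c / k) X i w.
Proof.
move=> c0; rewrite /symmetric_rule /interval_rule.
set x := sample_mean X i w.
have -> : n%:R * x ^+ 2 / sigma ^+ 2 = (k * x) ^+ 2.
  by rewrite -{1}(@sqr_sqrtr _ n%:R)//; field; rewrite gt_eqF.
rewrite ltr_pdivrMr// ltr_pdivlMr// (mulrC x) -ltr_norml -leNgt.
by rewrite -[RHS](@ler_sqr _ c `|k * x|) ?nnegrE ?real_normK ?num_real// ltW.
Qed.

Let kK x : k * (x / k) = x.
Proof. by rewrite mulrC divfK// gt_eqF. Qed.

Lemma type1_error_symmetric i (c : R) : 0 < c ->
  type1_error P (mu i) (symmetric_rule sigma c X i) = 1 - std_prob (- c) c.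
Proof.
move=> c0; rewrite /type1_error effect_null.
under eq_set do rewrite symmetric_ruleE//.
rewrite null_reject /= !kK.
have p'0 : 1 - p != 0 by rewrite subr_eq0 gt_eqF//; case/andP: hp.
by field.
Qed.

Lemma type2_error_symmetric i (c : R) : 0 < c ->
  type2_error P (mu i) (symmetric_rule sigma c X i) = accept nu k (- c) c.
Proof.
move=> c0; rewrite /type2_error effect_nonnull.
under eq_set do rewrite symmetric_ruleE// /interval_rule negbK.
rewrite nonnull_accept /= !kK.
have p'0 : p != 0 by rewrite gt_eqF//; case/andP: hp.
by field.
Qed.

Lemma risk_symmetric_rule (delta0 deltaA c : R) : 0 < c ->
  risk P delta0 deltaA mu (symmetric_rule sigma c X) =
  m%:R * (delta0 * ((1 - p) * (1 - std_prob (- c) c)) +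
          deltaA * (p * accept nu k (- c) c)).
Proof.
move=> c0; have := risk_interval_rule delta0 deltaA (- c / k) (c / k).
rewrite !kK => <-.
by congr risk; apply/funext => i; apply/funext => w; exact: symmetric_ruleE.
Qed.

End model_errors.

(** * Gaussian tails *)

Section gaussian_tail.
Context {R : realType}.
Local Notation leb := (@lebesgue_measure R).
Local Notation N01 := (normal_prob (0 : R) 1).

Definition phi (x : R) : R := (Num.sqrt (pi *+ 2))^-1 * expR (- (x ^+ 2 / 2)).

Lemma phiE : normal_pdf (0 : R) 1 = phi.
Proof.
apply/funext => x; rewrite normal_pdfE// /normal_peak /normal_fun /phi.
by rewrite expr1n mul1r subr0 mulNr.
Qed.

Lemma phi_gt0 x : 0 < phi x.
Proof. by rewrite mulr_gt0 ?expR_gt0// invr_gt0 sqrtr_gt0 mulrn_wgt0// pi_gt0. Qed.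

Definition tail (x : R) : R := fine (N01 `]x, +oo[%classic).

Lemma tailE x : (tail x)%:E = N01 `]x, +oo[%classic.
Proof. by rewrite fineK//; exact: (fin_num_measure N01). Qed.

Lemma is_derive_millsF (x : R) : 0 < x ->
  is_derive x 1 (fun t => - (phi t / t)) (phi x * (1 + x ^- 2)).
Proof.
move=> x0; rewrite /phi; set c := (Num.sqrt _)^-1.
have h1 : is_derive x 1 (fun t : R => - (t ^+ 2 / 2)) (- x).
  by apply: is_derive_eq; rewrite /GRing.scale /=; field.
have h2 : is_derive x 1 (fun t : R => expR (- (t ^+ 2 / 2))) (- x * expR (- (x ^+ 2 / 2))).
  have := @is_derive1_comp R expR (fun t => - (t ^+ 2 / 2)) x _ _ (is_derive_expR _) h1.
  by rewrite mulrC.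
have h3 : is_derive x 1 (fun t : R => t^-1) (- x ^- 2).
  have xn0 : x != 0 by rewrite gt_eqF.
  have := @is_deriveV R id x 1 1 xn0 (is_derive_id x 1).
  by move=> h; apply: is_derive_eq; rewrite /GRing.scale /= mulr1.
have := is_deriveN (is_deriveM (is_deriveZ c h2) h3).
move=> h; apply: (@is_derive_eq _ _ _ _ _ _ _ _ h).
have alg (a e : R) : - (a * e * - x ^- 2 + x^-1 * (a * (- x * e))) = a * e * (1 + x ^- 2).
  by field; rewrite gt_eqF.
exact: alg.
Qed.

Lemma continuous_phi : continuous phi.
Proof. by rewrite -phiE; apply: continuous_normal_pdf; rewrite oner_eq0. Qed.

Lemma phi_le x : phi x <= normal_peak 1.
Proof. by rewrite -phiE; apply: normal_pdf_ub; rewrite oner_eq0. Qed.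

(** The antiderivative - phi t / t is chosen because the factor 1 + t^-2 in its derivative lies
    between 1 and 1 + x^-2 on [x, +oo[; both Mills bounds follow from this identity. *)
Lemma mills_identity (x : R) : 0 < x ->
  (\int[leb]_(t in `[x, +oo[) (phi t * (1 + t ^- 2))%:E = (phi x / x)%:E)%E.
Proof.
move=> x0.
rewrite (@ge0_continuous_FTC2y R _ (fun t => - (phi t / t)) x 0); last 6 first.
- move=> t xt; apply: mulr_ge0; first exact/ltW/phi_gt0.
  by rewrite addr_ge0// invr_ge0 exprn_ge0// (le_trans (ltW x0)).
- apply: continuous_in_subspaceT => t; rewrite inE /= in_itv/= andbT => xt.
  have t0 : t != 0 by rewrite gt_eqF// (lt_le_trans x0).
  apply: cvgM; first exact: continuous_phi.
  apply: cvgD; first exact: cvg_cst.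
  apply: cvgV; first by rewrite expf_neq0.
  exact: exprn_continuous.
- have h0 : (- (normal_peak 1 * t^-1)) @[t --> +oo] --> (0 : R).
    rewrite -oppr0 -[X in - X](mulr0 (normal_peak 1)).
    apply: cvgN; apply: cvgMr; apply/gtr0_cvgV0; last exact: cvg_id.
    by near=> t; near: t; exact: nbhs_pinfty_gt.
  apply: (squeeze_cvgr _ h0 (cvg_cst (0 : R))).
  near=> t; have t0 : 0 < t by near: t; exact: nbhs_pinfty_gt.
  rewrite lerN2 ler_wpM2r ?invr_ge0 ?(ltW t0) ?phi_le//= oppr_le0.
  by rewrite divr_ge0 ?ltW ?phi_gt0.
- by move=> t xt; have [] := is_derive_millsF (lt_trans x0 xt).
- apply: cvg_at_right_filter; apply: cvgN; apply: cvgM; first exact: continuous_phi.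
  by apply: cvgV; rewrite ?gt_eqF//; exact: cvg_id.
- move=> t; rewrite in_itv/= andbT => xt.
  by rewrite derive1E; have [_ ->] := is_derive_millsF (lt_trans x0 xt).
by rewrite -EFinB; congr EFin; rewrite sub0r opprK.
Unshelve. all: by end_near. Qed.

Let mphi (A : set R) : measurable_fun A (EFin \o phi : measurableTypeR R -> \bar R).
Proof.
apply: measurable_funTS; rewrite -phiE.
by apply/measurable_EFinP; exact: measurable_normal_pdf.
Qed.

Let phi_ge0 x : (0 <= (phi x)%:E)%E.
Proof. by rewrite lee_fin ltW// phi_gt0. Qed.

Lemma tail_integral (x : R) : (tail x)%:E = (\int[leb]_(t in `]x, +oo[) (phi t)%:E)%E.
Proof. by rewrite tailE /normal_prob phiE. Qed.

Lemma tail_integralc (x : R) : (tail x)%:E = (\int[leb]_(t in `[x, +oo[) (phi t)%:E)%E.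
Proof. by rewrite tail_integral integral_itv_obnd_cbnd//; exact: mphi. Qed.

Let mmills (x c : R) : 0 < x ->
  measurable_fun `[x, +oo[%classic (fun t : measurableTypeR R => (phi t * (1 + t ^- 2))%:E).
Proof.
move=> x0; apply/measurable_EFinP; apply: measurable_funM.
  by apply/measurable_EFinP; exact: mphi.
apply: subspace_continuous_measurable_fun => //.
apply: continuous_in_subspaceT => t; rewrite inE /= in_itv/= andbT => xt.
have t0 : t != 0 by rewrite gt_eqF// (lt_le_trans x0).
apply: cvgD; first exact: cvg_cst.
apply: cvgV; first by rewrite expf_neq0.
exact: exprn_continuous.
Qed.

Lemma mills_upper (x : R) : 0 < x -> tail x <= phi x / x.
Proof.
move=> x0; rewrite -lee_fin -mills_identity// tail_integralc.
apply: ge0_le_integral => //.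
- exact: mphi.
- exact: mmills.
- move=> t; rewrite /= in_itv/= andbT => xt; rewrite lee_fin ler_peMr ?(ltW (phi_gt0 _))//.
  by rewrite lerDl invr_ge0 exprn_ge0// (le_trans (ltW x0)).
Qed.

Lemma mills_lower (x : R) : 0 < x -> phi x / x <= (1 + x ^- 2) * tail x.
Proof.
move=> x0; have c0 : 0 <= 1 + x ^- 2 by rewrite addr_ge0// invr_ge0 exprn_ge0// ltW.
rewrite -lee_fin -mills_identity// EFinM tail_integralc.
rewrite -ge0_integralZl//; last exact: mphi.
apply: ge0_le_integral => //.
- move=> t; rewrite /= in_itv/= andbT => xt; rewrite lee_fin mulr_ge0 ?(ltW (phi_gt0 _))//.
  by rewrite addr_ge0// invr_ge0 exprn_ge0// (le_trans (ltW x0)).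
- exact: mmills.
- by apply/measurable_EFinP; apply: measurable_funM => //; apply/measurable_EFinP; exact: mphi.
- move=> t; rewrite /= in_itv/= andbT => xt.
  rewrite -EFinM lee_fin mulrC ler_wpM2r ?(ltW (phi_gt0 _))// lerD2l.
  have t0 := lt_le_trans x0 xt.
  by rewrite lef_pV2 ?posrE ?exprn_gt0// lerXn2r ?nnegrE ?(ltW x0) ?(ltW t0).
Qed.

Lemma tail_ge0 x : 0 <= tail x.
Proof. by rewrite -lee_fin tail_integral integral_ge0. Qed.

Lemma tail_nincr x y : x <= y -> tail y <= tail x.
Proof.
move=> xy; rewrite -lee_fin !tail_integral.
apply: ge0_subset_integral => //; first exact: mphi.
by move=> t /=; rewrite !in_itv/= !andbT; exact: le_lt_trans.
Qed.

Lemma tail_gt0 x : 0 < tail x.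
Proof.
have m0 : 0 < Num.max x 1 by rewrite lt_max ltr01 orbT.
apply: lt_le_trans (tail_nincr (_ : x <= Num.max x 1)); last by rewrite le_max lexx.
have := mills_lower m0.
have : 0 < phi (Num.max x 1) / Num.max x 1 by rewrite divr_gt0// phi_gt0.
move=> /lt_le_trans /[apply]; rewrite pmulr_rgt0//.
by rewrite addr_gt0// invr_gt0 exprn_gt0.
Qed.

(** Under translation by [v] the normal density gains the factor exp(t v - v^2 / 2), which is
    smallest at the left end [c]. This bounds the power from below in terms of the size of the same
    test. *)
Lemma tail_shift (c v : R) : 0 <= v ->
  expR (c * v - v ^+ 2 / 2) * tail c <= tail (c - v).
Proof.
move=> v0; rewrite -lee_fin EFinM !tail_integral.
rewrite -ge0_integralZl//; last exact: mphi.
rewrite (@ge0_integral_affine _ (- v) 1)//.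
rewrite mul1e.
have -> : (fun z => - v + 1 * z) @^-1` `]c - v, +oo[ = `]c, +oo[%classic.
  by apply/seteqP; split => z /=; rewrite !in_itv/= !andbT mul1r addrC ltrD2l.
apply: ge0_le_integral => //.
- by move=> t _; rewrite -EFinM lee_fin mulr_ge0 ?expR_ge0 ?(ltW (phi_gt0 _)).
- by apply/measurable_EFinP; apply: measurable_funM => //; apply/measurable_EFinP; exact: mphi.
- apply: measurable_funTS; apply/measurable_EFinP.
  rewrite (_ : (fun _ => _) = normal_pdf v 1); first exact: measurable_normal_pdf.
  apply/funext => t; rewrite -phiE !normal_pdfE// /normal_fun subr0 mul1r.
  by rewrite (addrC t).
move=> t; rewrite /= in_itv/= andbT => ct; rewrite lee_fin /phi mulrCA.
rewrite ler_wpM2l ?invr_ge0// -expRD ler_expR mul1r.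
have : c * v <= t * v by rewrite ler_wpM2r// ltW.
lra.
Qed.

Lemma tailN (x : R) : (tail (- x))%:E = N01 `]-oo, x[%classic.
Proof.
rewrite tail_integral /normal_prob phiE.
have mopp : measurable_fun [set: measurableTypeR R] (-%R : measurableTypeR R -> measurableTypeR R).
  by [].
transitivity (\int[pushforward_measure leb mopp]_(t in `](- x)%R, +oo[) (phi t)%:E)%E.
  by apply: eq_measure_integral => A mA _; rewrite -[LHS]lebesgue_measureN.
rewrite ge0_integral_pushforward//; last exact: mphi.
have -> : -%R @^-1` `](- x), +oo[ = `]-oo, x[%classic.
  by apply/seteqP; split => z /=; rewrite !in_itv/= !andbT ltrN2.
by apply: eq_integral => t _; rewrite /= /phi sqrrN.
Qed.

Lemma std_probE (l r : R) : l < r -> 1 - std_prob l r = tail (- l) + tail r.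
Proof.
move=> lr.
have fin A : measurable A -> N01 A \is a fin_num by move=> mA; exact: (fin_num_measure N01).
have E1 : N01 `]-oo, l]%classic = (tail (- l))%:E.
  by rewrite tailN /normal_prob phiE integral_itv_bndo_bndc//; exact: mphi.
have E2 : N01 `[r, +oo[%classic = (tail r)%:E by rewrite tail_integralc /normal_prob phiE.
have E3 : (N01 setT = N01 `]-oo, l] + (N01 `]l, r[ + N01 `[r, +oo[))%E.
  have -> : [set: R] = `]-oo, l]%classic `|` (`]l, r[%classic `|` `[r, +oo[%classic).
    apply/esym/seteqP; split => // t _ /=; rewrite !in_itv/= !andbT.
    have [tl|lt] := leP t l; first by left.
    by right; have [rt|tr] := leP r t; [right|left].
  have d1 : `]-oo, l]%classic `&` (`]l, r[%classic `|` `[r, +oo[%classic) = set0.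
    rewrite -subset0 => t /=; rewrite !in_itv/= !andbT => -[tl [/andP[lt _]|rt]].
      by move: lt; rewrite ltNge tl.
    by move: (lt_le_trans lr rt); rewrite ltNge tl.
  have d2 : `]l, r[%classic `&` `[r, +oo[%classic = set0.
    rewrite -subset0 => t /=; rewrite !in_itv/= !andbT => -[/andP[_ tr] rt].
    by move: tr; rewrite ltNge rt.
  rewrite (measureU N01)//; last exact: measurableU.
  by rewrite (measureU N01).
have E4 : N01 [set: R] = 1%E by exact: (@probability_setT _ _ _ N01).
move: E4; rewrite E3 E1 E2 -(fineK (fin _ (measurable_itv `]l, r[))) -!EFinD => -[] h.
have h' : tail (- l) + (std_prob l r + tail r) = 1 by exact: h.
lra.
Qed.

End gaussian_tail.

(** * Optimality of the oracle interval *)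

Section likelihood_ratio.
Context {R : realType} (nu : probability (measurableTypeR R) R) (k : R).
Local Notation leb := (@lebesgue_measure R).

Let e (y t : R) : R := expR (y * (k * t) - (k * t) ^+ 2 / 2).

(** Density at [y] of k t + Z, with t drawn from [nu], relative to the density of Z. *)
Definition lik_ratio (y : R) : R := \int[nu]_t expR (y * (k * t) - (k * t) ^+ 2 / 2).

(** Completing the square gives a bound free of [t], hence integrability with respect to [nu] at
    every [y]. *)
Let e_ub y t : e y t <= expR (y ^+ 2 / 2).
Proof.
rewrite /e ler_expR; have := sqr_ge0 (y - k * t).
by rewrite sqrrB => h; lra.
Qed.

Let me : measurable_fun [set: measurableTypeR R * measurableTypeR R]
  (fun x : measurableTypeR R * measurableTypeR R => e x.1 x.2).
Proof.
apply: measurableT_comp => //; apply: measurable_funB.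
  by apply: measurable_funM => //; apply: measurable_funM.
apply: measurable_funM => //; apply: measurable_funX.
by apply: measurable_funM.
Qed.

Let me' : measurable_fun [set: measurableTypeR R * measurableTypeR R]
  (fun x : measurableTypeR R * measurableTypeR R => e x.2 x.1).
Proof.
apply: measurableT_comp => //; apply: measurable_funB.
  by apply: measurable_funM => //; apply: measurable_funM.
apply: measurable_funM => //; apply: measurable_funX.
by apply: measurable_funM.
Qed.

Let me1 y : measurable_fun [set: measurableTypeR R] (e y : measurableTypeR R -> R).
Proof. exact: measurableT_comp me (measurable_pair1 _). Qed.

Let int_e y : nu.-integrable setT (fun t : measurableTypeR R => (e y t)%:E).
Proof.
apply: measurable_bounded_integrable => //.
- by rewrite (le_lt_trans (probability_le1 nu _))// ltry.
- exists (expR (y ^+ 2 / 2)); split => // M hM t _ /=.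
  by rewrite ger0_norm ?expR_ge0// (le_trans (e_ub _ _))// ltW.
Qed.

(** For each [t] the integrand is the exponential of an affine function of the observation. *)
Lemma lik_ratio_convex (s x y : R) : 0 <= s <= 1 ->
  lik_ratio (s * x + (1 - s) * y) <= s * lik_ratio x + (1 - s) * lik_ratio y.
Proof.
move=> /andP[s0 s1]; rewrite /lik_ratio.
rewrite -!RintegralZl//; [|exact: int_e..].
have iZ a z : nu.-integrable setT (fun t : measurableTypeR R => (a * e z t)%:E).
  under eq_fun do rewrite EFinM.
  by apply: integrableZl => //; exact: int_e.
rewrite -RintegralD//; [|exact: iZ..].
apply: le_Rintegral => //.
- exact: int_e.
- exact: (integrableD measurableT (iZ s x) (iZ (1 - s) y)).
move=> t _.
have cvx (a b : R) : expR (s * a + (1 - s) * b) <= s * expR a + (1 - s) * expR b.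
  set m := s * a + (1 - s) * b.
  (* Tangent line of exp at the mean [m]; in the weighted sum of the two tangent bounds the linear
     terms cancel. *)
  have tang c : expR m * (1 + (c - m)) <= expR c.
    have -> : expR c = expR m * expR (c - m) by rewrite -expRD addrC subrK.
    by rewrite ler_wpM2l ?expR_ge0// expR_ge1Dx.
  have := ler_wpM2l s0 (tang a).
  have s1' : 0 <= 1 - s by rewrite subr_ge0.
  have := ler_wpM2l s1' (tang b).
  have -> : s * expR a + (1 - s) * expR b = (1 - s) * expR b + s * expR a by rewrite addrC.
  move=> h1 h2; apply: le_trans (lerD h1 h2).
  rewrite le_eqVlt; apply/orP; left; apply/eqP.
  by rewrite /m; ring.
apply: le_trans (cvx _ _).
rewrite ler_expR le_eqVlt; apply/orP; left; apply/eqP; ring.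
Qed.

(** Inside the interval this is convexity. For [x] outside, the nearer endpoint is a convex
    combination of [x] and the other endpoint, so that a value below [D] at [x] would pull the value
    at that endpoint below [D]. *)
Lemma lik_ratio_level (l r D x : R) : l < r -> lik_ratio l = D -> lik_ratio r = D ->
  (l < x < r -> lik_ratio x <= D) /\ (~~ (l < x < r) -> D <= lik_ratio x).
Proof.
move=> lr El Er; split.
  move=> /andP[lx xr].
  pose s := (r - x) / (r - l).
  have rl0 : 0 < r - l by rewrite subr_gt0.
  have s01 : 0 <= s <= 1.
    by rewrite /s divr_ge0 ?subr_ge0 ?(ltW xr) ?(ltW lr)//= ler_pdivrMr// mul1r; lra.
  have xE : s * l + (1 - s) * r = x by rewrite /s; field; rewrite gt_eqF.
  by have := lik_ratio_convex l r s01; rewrite xE El Er -mulrDl addrC subrK mul1r.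
rewrite negb_and -!leNgt => /orP[xl|rx].
  have [->|xnl] := eqVneq x l; first by rewrite El.
  have {xl xnl} xl : x < l by rewrite lt_neqAle xnl.
  pose s := (r - l) / (r - x).
  have rx0 : 0 < r - x by rewrite subr_gt0; exact: lt_trans lr.
  have s0 : 0 < s by rewrite divr_gt0// subr_gt0.
  have s01 : 0 <= s <= 1 by rewrite (ltW s0) /s ler_pdivrMr//= mul1r; lra.
  have lE : s * x + (1 - s) * r = l by rewrite /s; field; rewrite gt_eqF.
  have := lik_ratio_convex x r s01; rewrite lE El Er => h.
  by rewrite -(ler_pM2l s0); lra.
have [->|xnr] := eqVneq x r; first by rewrite Er.
have {rx xnr} rx : r < x by rewrite lt_neqAle eq_sym xnr.
pose s := (r - l) / (x - l).
have xl0 : 0 < x - l by rewrite subr_gt0; exact: lt_trans rx.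
have s0 : 0 < s by rewrite divr_gt0// subr_gt0.
have s01 : 0 <= s <= 1 by rewrite (ltW s0) /s ler_pdivrMr//= mul1r; lra.
have rE : s * x + (1 - s) * l = r by rewrite /s; field; rewrite gt_eqF.
have := lik_ratio_convex x l s01; rewrite rE El Er => h.
by rewrite -(ler_pM2l s0); lra.
Qed.

Let LRe (y : R) := (\int[nu]_t (e y t)%:E)%E.

Let LReE y : LRe y = (lik_ratio y)%:E.
Proof. by rewrite /LRe /lik_ratio /Rintegral fineK//; exact: integrable_fin_num (int_e y). Qed.

Let mLRe : measurable_fun [set: measurableTypeR R] (LRe : measurableTypeR R -> \bar R).
Proof.
apply: (@measurable_fun_fubini_tonelli_F _ _ (measurableTypeR R) (measurableTypeR R) R nu (fun x => (e x.1 x.2)%:E)).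
- by apply/measurable_EFinP; exact: me.
- by move=> x; rewrite lee_fin expR_ge0.
Qed.

Let LRe0 y : (0 <= LRe y)%E.
Proof. by apply: integral_ge0 => t _; rewrite lee_fin expR_ge0. Qed.

Let mphi : measurable_fun [set: measurableTypeR R] (phi : measurableTypeR R -> R).
Proof. by rewrite -phiE; exact: measurable_normal_pdf. Qed.

(** The density of k t + Z is [phi] times the integrand of [lik_ratio]; by Tonelli the effect can be
    integrated out first. *)
Lemma accept_lik_ratio (l r : R) :
  (accept nu k l r)%:E =
  (\int[leb]_x ((\1_(`]l, r[%classic : set R) x * phi x)%:E * (lik_ratio x)%:E))%E.
Proof.
rewrite /accept fineK; last by apply: fin_num_measure; exact: measurable_accept_set.
pose G (x t : R) : \bar R := (\1_(`]l, r[%classic : set R) x * phi x * e x t)%:E.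
have mG : measurable_fun [set: measurableTypeR R * measurableTypeR R]
   (fun x : measurableTypeR R * measurableTypeR R => G x.2 x.1).
  apply/measurable_EFinP; apply: measurable_funM; first apply: measurable_funM.
  - by apply: measurableT_comp => //; exact: measurable_indic.
  - exact: (measurableT_comp mphi measurable_snd).
  - exact: me'.
have G0 x t : (0 <= G x t)%E by rewrite lee_fin !mulr_ge0 ?expR_ge0 ?(ltW (phi_gt0 _)).
transitivity (\int[nu]_t \int[leb]_x G x t)%E.
  apply: eq_integral => t _ /=.
  have -> : xsection (accept_set k l r) t = (fun z => k * t + 1 * z) @^-1` `]l, r[%classic.
    by apply/seteqP; split => z; rewrite /xsection /= inE /accept_set /= mul1r in_itv.
  rewrite -normal_prob_std// /normal_prob integral_mkcond; apply: eq_integral => x _.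
  rewrite patchE /G indicE; case: ifPn => _; last by rewrite !mul0r.
  congr EFin; rewrite mul1r normal_pdfE// /normal_peak /normal_fun /phi /e -[RHS]mulrA -expRD.
  by rewrite expr1n mul1r; congr (_ * expR _); field.
rewrite (@fubini_tonelli _ _ _ _ _ nu leb (fun x => G x.2 x.1))//=.
apply: eq_integral => x _.
rewrite -LReE /LRe -ge0_integralZl//; last 3 first.
- by apply/measurable_EFinP; exact: me1.
- by move=> t _; rewrite lee_fin expR_ge0.
- by rewrite lee_fin mulr_ge0// (ltW (phi_gt0 _)).
Qed.

Lemma std_prob_phi (l r : R) :
  (std_prob l r)%:E = (\int[leb]_x (\1_(`]l, r[%classic : set R) x * phi x)%:E)%E.
Proof.
rewrite /std_prob fineK; last by exact: (fin_num_measure (normal_prob (0:R) 1)).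
rewrite /normal_prob integral_mkcond; apply: eq_integral => x _.
by rewrite patchE phiE indicE; case: ifPn => _; rewrite ?mul1r ?mul0r.
Qed.

(* By convexity ]l, r[ is a sublevel set of the likelihood ratio, so that the
   Neyman-Pearson comparison holds pointwise in the observation. *)
Lemma lik_ratio_test_optimal (l r D l' r' : R) : 0 <= D -> l < r ->
  lik_ratio l = D -> lik_ratio r = D ->
  D * (1 - std_prob l r) + accept nu k l r <=
  D * (1 - std_prob l' r') + accept nu k l' r'.
Proof.
move=> D0 lr El Er.
(* Moving each [std_prob] to the other side makes both sides integrals of nonnegative functions,
   which can then be compared pointwise. *)
have cmp (u v w x : R) : u + D * w <= v + D * x -> D * (1 - x) + u <= D * (1 - w) + v.
  by rewrite !mulrBr; lra.
have riskE u v u' v' : (accept nu k u v + D * std_prob u' v')%:E =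
    (\int[leb]_x ((\1_(`]u, v[%classic : set R) x * phi x)%:E * (lik_ratio x)%:E) +
     D%:E * \int[leb]_x (\1_(`]u', v'[%classic : set R) x * phi x)%:E)%E.
  by rewrite EFinD EFinM std_prob_phi; congr (_ + _)%E; exact: accept_lik_ratio.
apply: cmp; rewrite -lee_fin (riskE l r l' r') (riskE l' r' l r).
have mI (u v : R) : measurable_fun [set: measurableTypeR R]
    (fun x : measurableTypeR R => (\1_(`]u, v[%classic : set R) x * phi x)%:E).
  apply/measurable_EFinP; apply: measurable_funM => //; exact: measurable_indic.
have mIL (u v : R) : measurable_fun [set: measurableTypeR R]
    (fun x : measurableTypeR R => (\1_(`]u, v[%classic : set R) x * phi x)%:E * (lik_ratio x)%:E)%E.
  apply: emeasurable_funM => //.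
  by rewrite (_ : (fun _ => _) = LRe)//; apply/funext => x; rewrite LReE.
have I0 (u v x : R) : (0 <= (\1_(`]u, v[%classic : set R) x * phi x)%:E)%E.
  by rewrite lee_fin mulr_ge0// (ltW (phi_gt0 _)).
have L0 x : (0 <= (lik_ratio x)%:E)%E by rewrite -LReE.
rewrite -!ge0_integralZl//.
have mDI (u v : R) : measurable_fun [set: measurableTypeR R]
    (fun x : measurableTypeR R => D%:E * (\1_(`]u, v[%classic : set R) x * phi x)%:E)%E.
  by apply: emeasurable_funM.
rewrite -!ge0_integralD//; try by move=> x _; rewrite mule_ge0.
apply: ge0_le_integral => //.
- by move=> x _; rewrite adde_ge0// mule_ge0.
- by apply: emeasurable_funD.
- by apply: emeasurable_funD.
move=> x _; rewrite -!EFinM -!EFinD lee_fin.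
have [in1 out1] := lik_ratio_level x lr El Er.
have p0 : 0 <= phi x by rewrite ltW ?phi_gt0.
rewrite !indicE !mem_setE !in_itv /=.
case: (boolP (l < x < r)) => h1; case: (boolP (l' < x < r')) => h2;
  rewrite ?mul1r ?mul0r ?mulr0 ?addr0 ?add0r//.
- by rewrite mulrC ler_wpM2r// in1.
- by rewrite mulrC ler_wpM2l// out1.
Qed.

End likelihood_ratio.

(** * Acceptance probabilities of large samples *)

Section accept_basics.
Context {R : realType} (nu : probability (measurableTypeR R) R).
Local Notation N01 := (normal_prob (0 : R) 1).

Lemma norm_eq_or (x t : R) : `|x| = t -> x = - t \/ x = t.
Proof. by case: (ger0P x) => _ <-; [right|left; rewrite opprK]. Qed.

Lemma fine_prob_le d (T : measurableType d) (P : probability T R) (A B : set T) :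
  measurable A -> measurable B -> A `<=` B -> fine (P A) <= fine (P B).
Proof.
by move=> mA mB AB; rewrite fine_le ?fin_num_measure// le_measure ?inE.
Qed.

Lemma fine_prob_ge0 d (T : measurableType d) (P : probability T R) (A : set T) :
  0 <= fine (P A).
Proof. exact: fine_ge0. Qed.

Lemma fine_prob_le1 d (T : measurableType d) (P : probability T R) (A : set T) :
  measurable A -> fine (P A) <= 1.
Proof.
by move=> mA; rewrite -lee_fin fineK ?fin_num_measure// probability_le1.
Qed.

Lemma accept_le (k l r l' r' : R) : l' <= l -> r <= r' ->
  accept nu k l r <= accept nu k l' r'.
Proof.
move=> ll rr; apply: fine_prob_le; try exact: measurable_accept_set.
move=> x /andP[h1 h2]; apply/andP; split; first exact: le_lt_trans h1.
exact: lt_le_trans rr.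
Qed.

Lemma accept_ge0 (k l r : R) : 0 <= accept nu k l r.
Proof. exact: fine_prob_ge0. Qed.

Lemma accept_le1 (k l r : R) : accept nu k l r <= 1.
Proof. by apply: fine_prob_le1; exact: measurable_accept_set. Qed.

Let N01T : N01 [set: measurableTypeR R] = 1%E.
Proof. exact: (@probability_setT _ _ _ N01). Qed.

Lemma effect_noise_rect (A B : set (measurableTypeR R)) : measurable A -> measurable B ->
  effect_noise nu (A `*` B) = (nu A * N01 B)%E.
Proof. by move=> mA mB; exact: product_measure1E. Qed.

(** Acceptance means |x + z / k| < c / k, whose limit is |x| < tau since the noise is scaled away.
    The indicators converge except where |x| = tau, a null set, and dominated convergence
    applies. *)
Lemma accept_cvg (k c : nat -> R) (tau : R) : 0 <= tau ->
  (forall m, 0 < k m) -> k @ \oo --> +oo -> (c m / k m) @[m --> \oo] --> tau ->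
  nu [set - tau] = 0%E -> nu [set tau] = 0%E ->
  accept nu (k m) (- c m) (c m) @[m --> \oo] --> fine (nu `]- tau, tau[%classic).
Proof.
move=> tau0 k0 koo ctau nul nur.
pose T := (measurableTypeR R * measurableTypeR R)%type.
pose B : set T := `]- tau, tau[%classic `*` setT.
have mB : measurable B by apply: measurableX.
have nuB : effect_noise nu B = nu `]- tau, tau[%classic.
  by rewrite /B effect_noise_rect// N01T mule1.
apply: fine_cvg; rewrite fineK; last exact: fin_num_measure.
have mset m := @measurable_accept_set R (k m) (- c m) (c m).
have indE (A : set T) : measurable A -> effect_noise nu A = (\int[effect_noise nu]_x (\1_A x)%:E)%E.
  by move=> mA; rewrite (integral_indic _ measurableT mA) setIT.
rewrite -nuB (indE _ mB); under eq_fun do rewrite (indE _ (mset _)).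
pose N : set T := ([set - tau] `|` [set tau]) `*` setT.
have mN : measurable N.
  by apply: measurableX => //; apply: measurableU; exact: measurable_set1.
have N0 : effect_noise nu N = 0%E.
  rewrite /N effect_noise_rect//; last first.
    by apply: measurableU; exact: measurable_set1.
  rewrite N01T mule1; apply/eqP; rewrite eq_le measure_ge0 andbT.
  apply: le_trans (measureU2 _ _ _) _; try exact: measurable_set1.
  rewrite (_ : (_ + _)%E = 0%E)//.
  by rewrite -[RHS](adde0 0%E); congr (_ + _)%E.
have := @dominated_convergence _ T R (effect_noise nu) setT measurableT
  (fun m x => (\1_(accept_set (k m) (- c m) (c m)) x)%:E) (fun x => (\1_B x)%:E) (cst 1%E).
move=> []//.
- by move=> m; apply/measurable_EFinP; exact: measurable_indic.
- by apply/measurable_EFinP; exact: measurable_indic.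
- exists N; split => // -[x z] /= /not_implyP[_ H]; apply: contrapT => xN; apply: H.
  have xk : (x + z / k m) @[m --> \oo] --> x.
    rewrite -[X in _ --> X]addr0; apply: cvgD; first exact: cvg_cst.
    rewrite -[X in _ --> X](mulr0 z); apply: cvgMr.
    by apply/gtr0_cvgV0 => //; exact: nearW.
  have axk : (`|x + z / k m|) @[m --> \oo] --> `|x| by exact: cvg_norm.
  have memE m : (x, z) \in accept_set (k m) (- c m) (c m) = (`|x + z / k m| < c m / k m).
    rewrite -[RHS](ltr_pM2r (k0 m)) divfK ?gt_eqF//.
    rewrite -[X in _ * X](gtr0_norm (k0 m)) -normrM mulrDl divfK ?gt_eqF// (mulrC x).
    by rewrite ltr_norml; apply/idP/idP; rewrite inE.
  have memBE : ((x, z) \in B) = (`|x| < tau).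
    rewrite ltr_norml; apply/idP/idP; rewrite inE /B /=; first by move=> [/= + _]; rewrite in_itv.
    by move=> h; split => //=; rewrite in_itv.
  have [xt|tx|xt] := ltgtP `|x| tau; last first.
  + exfalso; apply: xN; split => //=.
    exact: norm_eq_or.
  + apply: cvg_near_cst.
    have d0 : 0 < (`|x| - tau) / 2 by rewrite divr_gt0// subr_gt0.
    have /cvgrPdist_lt/(_ _ d0) h1 := axk; have /cvgrPdist_lt/(_ _ d0) h2 := ctau.
    have xtau : (`|x| < tau) = false by apply/negbTE; rewrite -leNgt ltW.
    near=> m; rewrite !indicE memE memBE xtau /=.
    have : `| `|x| - `|x + z / k m| | < (`|x| - tau) / 2 by near: m.
    have : `| tau - c m / k m | < (`|x| - tau) / 2 by near: m.
    rewrite !ltr_norml => /andP[a1 a2] /andP[a3 a4].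
    rewrite -ltr_norml; have -> : (`|x + z / k m| < c m / k m) = false by apply/negbTE; rewrite -leNgt; lra.
    by [].
  + apply: cvg_near_cst.
    have d0 : 0 < (tau - `|x|) / 2 by rewrite divr_gt0// subr_gt0.
    have /cvgrPdist_lt/(_ _ d0) h1 := axk; have /cvgrPdist_lt/(_ _ d0) h2 := ctau.
    near=> m; rewrite !indicE memE memBE xt /=.
    have : `| `|x| - `|x + z / k m| | < (tau - `|x|) / 2 by near: m.
    have : `| tau - c m / k m | < (tau - `|x|) / 2 by near: m.
    rewrite !ltr_norml => /andP[a1 a2] /andP[a3 a4].
    rewrite -ltr_norml; have -> : (`|x + z / k m| < c m / k m) = true by lra.
    by [].
- by apply: finite_measure_integrable_cst; exact: measurableT.
- apply: aeW => x m _ /=; rewrite indicE lee_fin.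
  by case: (_ \in _); rewrite ?normr1// normr0.
Unshelve. all: by end_near. Qed.

(** Slicing at a fixed noise value leaves an interval of effects, whose [nu]-mass a density bound
    controls. *)
Lemma effect_noise_ysection (A : set (measurableTypeR R * measurableTypeR R)) :
  measurable A -> effect_noise nu A = (\int[N01]_z nu (ysection A z))%E.
Proof.
move=> mA; rewrite /effect_noise.
transitivity ((nu \x^ N01)%E A) => //.
by apply: product_measure_unique => // B C mB mC; exact: product_measure2E.
Qed.

Lemma normal_two_tails (y : R) : 0 < y ->
  N01 (~` `]- y, y[%classic) = (2 * tail y)%:E.
Proof.
move=> y0; rewrite (@probability_setC _ _ _ N01)//.
have yy : - y < y by rewrite gtrN.
have := std_probE yy; rewrite opprK /std_prob => h.
rewrite -[X in (1 - X)%E](@fineK _ (N01 _)) ?(fin_num_measure N01)//.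
by rewrite -EFinB h; congr EFin; ring.
Qed.

(** A noise below eta c together with an effect below (1 - eta) c / k in absolute value forces
    acceptance, and this event is a rectangle. *)
Lemma accept_lower (k c eta : R) : 0 < k -> 0 < c -> 0 < eta < 1 ->
  (1 - 2 * tail (eta * c)) * fine (nu `]- ((1 - eta) * (c / k)), (1 - eta) * (c / k)[%classic)
  <= accept nu k (- c) c.
Proof.
move=> k0 c0 /andP[e0 e1].
set I := `]- _, _[%classic; set y := eta * c.
have y0 : 0 < y by rewrite mulr_gt0.
have mI : measurable (I : set (measurableTypeR R)) by exact: measurable_itv.
have std : (1 - 2 * tail y)%:E = N01 `]- y, y[%classic.
  have yy : - y < y by rewrite gtrN.
  have := std_probE yy; rewrite opprK /std_prob => h.
  rewrite -[RHS](@fineK _ (N01 _)) ?(fin_num_measure N01)//; congr EFin; lra.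
have mP : measurable (I `*` `]- y, y[%classic : set (measurableTypeR R * measurableTypeR R)).
  exact: measurableX.
apply: (@le_trans _ _ (fine (effect_noise nu (I `*` `]- y, y[%classic)))); last first.
  apply: fine_prob_le => //; first exact: measurable_accept_set.
  move=> [x z] [] /=; rewrite /I /= !in_itv /= -!ltr_norml /accept_set /= -ltr_norml => hx hz.
  apply: le_lt_trans (ler_normD _ _) _; rewrite normrM (gtr0_norm k0).
  have : k * `|x| < (1 - eta) * c.
    by move: hx; rewrite mulrA ltr_pdivlMr// mulrC.
  by move: hz; rewrite /y; lra.
rewrite effect_noise_rect//.
rewrite -lee_fin fineK; last by rewrite fin_numM// ?fin_num_measure//; exact: (fin_num_measure N01).
by rewrite EFinM std fineK ?fin_num_measure// muleC.
Qed.

(** Given the noise z, the accepted effects form an interval of length 2 c / k around - z / k. For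
    |z| < eta c it lies in the enlarged symmetric interval; for moderate |z| it stays where the
    density is at most [M], so its mass is at most 2 M c / k; for |z| >= k eps / 2 the trivial bound
    1 is used. The three terms correspond to these cases. *)
Lemma accept_upper (k c eta M eps : R) : 0 < k -> 0 < c -> 0 < eta < 1 -> 0 < eps -> 0 <= M ->
  (forall x y, - eps <= x -> x <= y -> y <= eps -> (nu `]x, y[%classic <= (M * (y - x))%:E)%E) ->
  c / k <= eps / 2 ->
  accept nu k (- c) c <=
  fine (nu `]- ((1 + eta) * (c / k)), (1 + eta) * (c / k)[%classic)
  + 4 * M * (c / k) * tail (eta * c) + 2 * tail (k * (eps / 2)).
Proof.
move=> k0 c0 /andP[e0 e1] eps0 M0 HM ck.
set I := `]- _, _[%classic; set y := eta * c; set w := k * (eps / 2).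
have y0 : 0 < y by rewrite mulr_gt0.
have w0 : 0 < w by rewrite mulr_gt0// divr_gt0.
have ck0 : 0 < c / k by rewrite divr_gt0.
have c20 : 0 <= 2 * M * (c / k) by apply: mulr_ge0; [exact: mulr_ge0|exact: ltW].
have mI : measurable (I : set (measurableTypeR R)) by exact: measurable_itv.
rewrite -lee_fin fineK; last by rewrite fin_num_measure//; exact: measurable_accept_set.
have mA := @measurable_accept_set R k (- c) c.
rewrite effect_noise_ysection//.
pose B y : set R := ~` `]- y, y[%classic.
have mB y' : measurable (B y' : set (measurableTypeR R)) by apply: measurableC; exact: measurable_itv.
pose g z : \bar R := ((nu I) * (\1_(setT : set (measurableTypeR R)) z)%:E
  + (2 * M * (c / k))%:E * (\1_(B y) z)%:E + (\1_(B w) z)%:E)%E.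
have sec z : ysection (accept_set k (- c) c) z = `](- c - z) / k, (c - z) / k[%classic.
  apply/seteqP; split => x; rewrite /ysection /= inE /accept_set /= in_itv /=.
    by move=> /andP[h1 h2]; rewrite ltr_pdivrMr// ltr_pdivlMr//; apply/andP; split; lra.
  by rewrite ltr_pdivrMr// ltr_pdivlMr// => /andP[h1 h2]; apply/andP; split; lra.
apply: (@le_trans _ _ (\int[N01]_z g z)%E).
  apply: ge0_le_integral => //.
  - by apply: measurable_fun_ysection.
  - apply: emeasurable_funD; first apply: emeasurable_funD.
    + by apply: emeasurable_funM => //; apply/measurable_EFinP; exact: measurable_indic.
    + by apply: emeasurable_funM => //; apply/measurable_EFinP; exact: measurable_indic.
    + by apply/measurable_EFinP; exact: measurable_indic.
  move=> z _; rewrite sec /g indicT mule1.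
  have z1 : (0 <= (\1_(B w) z : R)%:E)%E by rewrite lee_fin.
  have z2 : (0 <= (2 * M * (c / k))%:E * (\1_(B y) z : R)%:E)%E.
    by apply: mule_ge0; rewrite lee_fin.
  have [zy|yz] := ltP `|z| y.
    apply: (@le_trans _ _ (nu I)); last by rewrite -addeA leeDl// adde_ge0.
    apply: le_measure; rewrite ?inE//.
    have zyk : `|z| / k < eta * (c / k) by rewrite mulrA ltr_pM2r ?invr_gt0.
    have : - (`|z| / k) <= z / k <= `|z| / k.
      by rewrite -mulNr !ler_pM2r ?invr_gt0// -ler_norml.
    move=> /andP[b1 b2] x; rewrite /I /= !in_itv /= !mulrBl mulNr => /andP[h1 h2].
    by apply/andP; split; lra.
  have [zw|wz] := ltP `|z| w.
    apply: (@le_trans _ _ ((2 * M * (c / k))%:E)).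
      have : - (`|z| / k) <= z / k <= `|z| / k.
        by rewrite -mulNr !ler_pM2r ?invr_gt0// -ler_norml.
      have zwk : `|z| / k < eps / 2 by rewrite ltr_pdivrMr// mulrC.
      move=> /andP[b1 b2].
      have q1 : - eps <= (- c - z) / k by rewrite mulrBl mulNr; lra.
      have q2 : (- c - z) / k <= (c - z) / k by rewrite !mulrBl mulNr; lra.
      have q3 : (c - z) / k <= eps by rewrite mulrBl; lra.
      apply: (le_trans (HM _ _ q1 q2 q3)).
      by rewrite lee_fin !mulrBl mulNr; lra.
    have -> : \1_(B y) z = 1 :> R.
      by rewrite indicE mem_set// /B /= in_itv /= -ltr_norml; apply/negP; rewrite -leNgt.
    rewrite mule1 -addeA addeC -addeA leeDl// adde_ge0//.
  apply: (@le_trans _ _ 1%E); first by rewrite probability_le1.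
  have -> : \1_(B w) z = 1 :> R.
    by rewrite indicE mem_set// /B /= in_itv /= -ltr_norml; apply/negP; rewrite -leNgt.
  by rewrite leeDr// adde_ge0.
have mind (A : set (measurableTypeR R)) : measurable A ->
    measurable_fun [set: measurableTypeR R] (fun z : measurableTypeR R => (\1_A z)%:E : \bar R).
  by move=> mA'; apply/measurable_EFinP; exact: measurable_indic.
have n1 z : (0 <= nu I * (\1_(setT : set (measurableTypeR R)) z)%:E)%E.
  by apply: mule_ge0; rewrite ?lee_fin.
have n2 z : (0 <= (2 * M * (c / k))%:E * (\1_(B y) z : R)%:E)%E.
  by apply: mule_ge0; rewrite ?lee_fin.
have n3 z : (0 <= (\1_(B w) z : R)%:E)%E by rewrite lee_fin.
have m1 : measurable_fun [set: measurableTypeR R]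
   (fun z : measurableTypeR R => nu I * (\1_(setT : set (measurableTypeR R)) z)%:E)%E.
  by apply: emeasurable_funM => //; exact: mind.
have m2 : measurable_fun [set: measurableTypeR R]
   (fun z : measurableTypeR R => (2 * M * (c / k))%:E * (\1_(B y) z)%:E)%E.
  by apply: emeasurable_funM => //; exact: mind.
have m3 := mind _ (mB w).
rewrite /g (ge0_integralD N01 measurableT _ (emeasurable_funD m1 m2) _ m3); last 2 first.
- by move=> z _; exact: adde_ge0.
- by move=> z _; exact: n3.
rewrite (ge0_integralD N01 measurableT (fun z _ => n1 z) m1 (fun z _ => n2 z) m2).
rewrite !ge0_integralZl//; try exact: mind; try by move=> z _; rewrite lee_fin.
rewrite !integral_indic// !setIT.
have tB u : 0 < u -> N01 (B u) = (2 * tail u)%:E by exact: normal_two_tails.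
apply: (@le_trans _ _ (nu I * 1 + (2 * M * (c / k))%:E * (2 * tail y)%:E + (2 * tail w)%:E)%E).
  rewrite le_eqVlt; apply/orP; left; apply/eqP; congr (_ * _ + _ * _ + _)%E.
  - exact: N01T.
  - exact: tB.
  - exact: tB.
rewrite mule1 -{1}(@fineK _ (nu I)) ?fin_num_measure// -EFinM -!EFinD lee_fin.
lra.
Qed.

End accept_basics.

(** * Limits of real sequences *)

Section sequences.
Context {R : realType}.
Implicit Types (u v : nat -> R) (l : R).

(** The available bounds depend on an auxiliary parameter and converge only to within [e] of the
    limit, so an ordinary squeeze does not apply to them. *)
Lemma squeeze_eps u l :
  (forall e, 0 < e -> exists (v : nat -> R) L,
     [/\ \forall m \near \oo, u m <= v m, v m @[m --> \oo] --> L & L <= l + e]) ->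
  (forall e, 0 < e -> exists (v : nat -> R) L,
     [/\ \forall m \near \oo, v m <= u m, v m @[m --> \oo] --> L & l - e <= L]) ->
  u m @[m --> \oo] --> l.
Proof.
move=> up lo; apply/cvgrPdist_le => e e0.
have e2 : 0 < e / 2 by rewrite divr_gt0.
have [v [L [uv vL Ll]]] := up _ e2.
have [w [L' [wu wL L'l]]] := lo _ e2.
have /cvgrPdist_le/(_ _ e2) h1 := vL.
have /cvgrPdist_le/(_ _ e2) h2 := wL.
near=> m.
have a1 : u m <= v m by near: m.
have a2 : w m <= u m by near: m.
have a3 : `|L - v m| <= e / 2 by near: m.
have a4 : `|L' - w m| <= e / 2 by near: m.
by move: a3 a4; rewrite !ler_norml => /andP[b1 b2] /andP[b3 b4]; apply/andP; split; lra.
Unshelve. all: by end_near. Qed.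

Lemma cvg_sqrt u l : u m @[m --> \oo] --> l -> Num.sqrt (u m) @[m --> \oo] --> Num.sqrt l.
Proof. by move=> ul; apply: continuous_cvg ul; exact: sqrt_continuous. Qed.

Lemma cvg_ln u l : 0 < l -> u m @[m --> \oo] --> l -> ln (u m) @[m --> \oo] --> ln l.
Proof. by move=> l0 ul; apply: continuous_cvg ul; exact: continuous_ln. Qed.

Lemma near_gt_oo u (A : R) : u m @[m --> \oo] --> +oo -> \forall m \near \oo, A < u m.
Proof. by move/cvgryPgt/(_ A). Qed.

Lemma cvg_inv_oo u : u m @[m --> \oo] --> +oo -> (u m)^-1 @[m --> \oo] --> (0 : R).
Proof.
by move=> uoo; apply/gtr0_cvgV0 => //; near=> m; near: m; exact: near_gt_oo.
Unshelve. all: by end_near. Qed.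

Lemma squeeze_cvg0 u v : (\forall m \near \oo, 0 <= u m <= v m) ->
  v m @[m --> \oo] --> (0 : R) -> u m @[m --> \oo] --> (0 : R).
Proof. by move=> uv v0; apply: squeeze_cvgr (cvg_cst 0) v0. Qed.

Lemma cvg_div_oo u v (l : R) : u m @[m --> \oo] --> l -> v m @[m --> \oo] --> +oo ->
  u m / v m @[m --> \oo] --> (0 : R).
Proof.
by move=> ul voo; rewrite -[X in _ --> X](mulr0 l); apply: cvgM => //; exact: cvg_inv_oo.
Qed.

Lemma tail_cvg0 u : u m @[m --> \oo] --> +oo -> tail (u m) @[m --> \oo] --> (0 : R).
Proof.
move=> uoo; apply: (@squeeze_cvg0 _ (fun m => normal_peak 1 * (u m)^-1)).
  near=> m; have um : 0 < u m by near: m; exact: near_gt_oo.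
  rewrite tail_ge0 /=; apply: le_trans (mills_upper um) _.
  by rewrite ler_wpM2r ?phi_le// invr_ge0 ltW.
rewrite -[X in _ --> X](mulr0 (normal_peak 1)); apply: cvgMr; exact: cvg_inv_oo.
Unshelve. all: by end_near. Qed.

End sequences.

(** * Mass of symmetric intervals under assumption (C) *)

Section density.
Context {R : realType} (nu : probability (measurableTypeR R) R) (sigma C : R).
Local Notation leb := (@lebesgue_measure R).
Hypotheses (sigma0 : 0 < sigma) (C_ge0 : 0 <= C) (hC : assumptionC nu sigma C).
Let T := sigma * Num.sqrt C.

Let T0 : 0 <= T. Proof. by rewrite mulr_ge0// ltW. Qed.

Lemma density_bounds : exists2 eps : R, 0 < eps & exists2 M : R, 0 <= M &
  let K := `[- T - eps, - T + eps]%classic `|` `[T - eps, T + eps]%classic in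
  (forall A : set R, measurable A -> A `<=` K -> (nu A <= M%:E * leb A)%E) /\
  (forall x y : R, x < y -> `]x, y[%classic `<=` K -> (0 < nu `]x, y[%classic)%E).
Proof.
case: hC => eps eps0 [rho]; rewrite -/T /=; set K := (_ `|` _) => -[mrho [M HM0] Hnu _].
have HM x : K x -> 0 < rho x <= M by exact: HM0.
have KK : K (- T) by left; rewrite /= in_itv /=; apply/andP; split; lra.
have M0 : 0 <= M by have /andP[h1 h2] := HM _ KK; exact: le_trans (ltW h1) h2.
exists eps => //; exists M => //; rewrite -/K; split.
  move=> A mA AK; rewrite Hnu//.
  apply: (@le_trans _ _ (\int[leb]_(x in A) M%:E)%E); last by rewrite integral_cst.
  apply: ge0_le_integral => //.
  - by move=> x /AK /HM /andP[h _]; rewrite lee_fin ltW.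
  - by apply/measurable_EFinP; apply: measurable_funS mrho => //; apply: measurableU; exact: measurable_itv.
  - by move=> x /AK /HM /andP[_ h]; rewrite lee_fin.
move=> x y xy AK; set A := `]x, y[%classic in AK *.
have mA : measurable A by exact: measurable_itv.
rewrite lt0e measure_ge0 andbT; apply/negP => /eqP; rewrite Hnu// => A0.
have mrhoA : measurable_fun A (EFin \o rho).
  by apply/measurable_EFinP; apply: measurable_funS mrho => //; apply: measurableU; exact: measurable_itv.
(* A vanishing integral of the positive density would make the nonempty interval [A]
   Lebesgue-null. *)
have : (\int[leb]_(z in A) `|(rho z)%:E| = 0)%E.
  rewrite -[RHS]A0; apply: eq_integral => z; rewrite inE => /AK /HM /andP[h _].
  by rewrite gee0_abs// lee_fin ltW.
move/(ae_eq_integral_abs leb mA mrhoA) => [N [mN N0 sub]].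
have AN : A `<=` N.
  move=> z Az; apply: sub => /= /(_ Az) [] /eqP; rewrite gt_eqF//.
  by have /andP[] := HM _ (AK _ Az).
have : (leb A <= leb N)%E by apply: le_measure => //; rewrite inE.
rewrite N0 /A lebesgue_measure_itv /= lte_fin xy -EFinB lee_fin leNgt subr_gt0 xy//.
Qed.

Lemma itv_sub_K (eps x y : R) :
  (- T - eps <= x /\ y <= - T + eps) \/ (T - eps <= x /\ y <= T + eps) ->
  `[x, y]%classic `<=` `[- T - eps, - T + eps]%classic `|` `[T - eps, T + eps]%classic.
Proof.
move=> h z /=; rewrite !in_itv /= => /andP[xz zy].
by case: h => -[h1 h2]; [left|right]; apply/andP; split; [exact: le_trans xz|exact: le_trans h2|exact: le_trans xz|exact: le_trans h2].
Qed.

Lemma no_atom : nu [set - T] = 0%E /\ nu [set T] = 0%E.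
Proof.
have [eps eps0 [M M0 /= [H _]]] := density_bounds.
split; apply/eqP; rewrite eq_le measure_ge0 andbT; apply: le_trans (H _ _ _) _ => //;
  try exact: measurable_set1; try by rewrite lebesgue_measure_set1 mule0.
- by move=> _ ->; left; rewrite /= in_itv /=; apply/andP; split; lra.
- by move=> _ ->; right; rewrite /= in_itv /=; apply/andP; split; lra.
Qed.

(** The strict inequality comes from a small interval to the right of [T], where the density is
    positive. *)
Lemma prob_sym_lt (T' : R) : T < T' ->
  fine (nu `]- T, T[%classic) < fine (nu `]- T', T'[%classic).
Proof.
move=> TT'.
have [eps eps0 [M M0 /= [_ H]]] := density_bounds.
pose y := Num.min T' (T + eps).
have Ty : T < y by rewrite lt_min TT' ltrDl.
have y1 : y <= T' by rewrite ge_min lexx.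
have y2 : y <= T + eps by rewrite ge_min lexx orbT.
have pos : (0 < nu `]T, y[%classic)%E.
  apply: H => //; apply: subset_trans (itv_sub_K (x := T) (y := y) _); last by right; split; lra.
  by move=> z /=; rewrite !in_itv /= => /andP[h1 h2]; apply/andP; split; exact: ltW.
have mI (a b : R) : measurable (`]a, b[%classic : set (measurableTypeR R)) by exact: measurable_itv.
have disj : `]- T, T[%classic `&` `]T, y[%classic = set0 :> set (measurableTypeR R).
  by rewrite -subset0 => z /=; rewrite !in_itv /= => -[/andP[_ h1] /andP[h2 _]]; lra.
apply: (@lt_le_trans _ _ (fine (nu (`]- T, T[%classic `|` `]T, y[%classic)))); last first.
  apply: fine_prob_le => //; first exact: measurableU.
  have T00 := T0.
  by move=> z /=; rewrite !in_itv /= => -[] /andP[h1 h2]; apply/andP; split; lra.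
rewrite measureU// fineD ?fin_num_measure// ltrDl fine_gt0// pos /=.
by rewrite (le_lt_trans (probability_le1 _ _)) ?ltry.
Qed.

Lemma prob_sym_gt0 : 0 < C -> 0 < fine (nu `]- T, T[%classic).
Proof.
move=> C0; have T_gt0 : 0 < T by rewrite mulr_gt0// sqrtr_gt0.
have [eps eps0 [M M0 /= [_ H]]] := density_bounds.
pose x := Num.max 0 (T - eps).
have xT : x < T by rewrite gt_max T_gt0 /= ltrBlDr ltrDl.
have x0 : 0 <= x by rewrite le_max lexx.
have x1 : T - eps <= x by rewrite le_max lexx orbT.
have mI (a b : R) : measurable (`]a, b[%classic : set (measurableTypeR R)) by exact: measurable_itv.
have pos : (0 < nu `]x, T[%classic)%E.
  apply: H => //; apply: subset_trans (itv_sub_K (x := x) (y := T) _); last by right; split; lra.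
  by move=> z /=; rewrite !in_itv /= => /andP[h1 h2]; apply/andP; split; exact: ltW.
apply: (@lt_le_trans _ _ (fine (nu `]x, T[%classic))).
  by rewrite fine_gt0// pos /= (le_lt_trans (probability_le1 _ _)) ?ltry.
apply: fine_prob_le => //.
by move=> z /=; rewrite !in_itv /= => /andP[h1 h2]; apply/andP; split; lra.
Qed.

Lemma prob_sym_near (e : R) : 0 < C -> 0 < e -> exists eta : R, [/\ 0 < eta < 1,
  nu [set - ((1 - eta) * T)] = 0%E, nu [set (1 - eta) * T] = 0%E &
  fine (nu `]- T, T[%classic) - e <= fine (nu `]- ((1 - eta) * T), (1 - eta) * T[%classic)].
Proof.
move=> C0 e0; have T_gt0 : 0 < T by rewrite mulr_gt0// sqrtr_gt0.
have [eps eps0 [M M0 /= [H _]]] := density_bounds.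
(* The bound T / 2 keeps [x] positive, T - eps keeps the removed strips where the density is at most
   [M], and the last bound makes each strip weigh at most e / 2; [M + 1] avoids division by zero. *)
pose x := Num.max (T / 2) (Num.max (T - eps) (T - e / (2 * (M + 1)))).
have M1 : 0 < 2 * (M + 1) by lra.
have em : 0 < e / (2 * (M + 1)) by rewrite divr_gt0.
have xT : x < T by rewrite !gt_max; apply/andP; split; [lra|apply/andP; split; lra].
have x0 : T / 2 <= x by rewrite le_max lexx.
have x1 : T - eps <= x by rewrite !le_max lexx !orbT.
have x2 : T - e / (2 * (M + 1)) <= x by rewrite !le_max lexx !orbT.
pose eta := (T - x) / T.
have etaE : (1 - eta) * T = x by rewrite /eta; field; rewrite gt_eqF.
exists eta; rewrite etaE; split.
- rewrite /eta divr_gt0 ?subr_gt0//= ltr_pdivrMr// mul1r; lra.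
- apply/eqP; rewrite eq_le measure_ge0 andbT; apply: le_trans (H _ _ _) _ => //.
  + by move=> _ ->; left; rewrite /= in_itv /=; apply/andP; split; lra.
  + by rewrite lebesgue_measure_set1 mule0.
- apply/eqP; rewrite eq_le measure_ge0 andbT; apply: le_trans (H _ _ _) _ => //.
  + by move=> _ ->; right; rewrite /= in_itv /=; apply/andP; split; lra.
  + by rewrite lebesgue_measure_set1 mule0.
have mI (a b : itv_bound R) : measurable ([set` Interval a b] : set (measurableTypeR R)) by exact: measurable_itv.
set A : set (measurableTypeR R) := `]- x, x[%classic.
set B1 : set (measurableTypeR R) := `[- T, - x]%classic.
set B2 : set (measurableTypeR R) := `[x, T]%classic.
have len (a b : R) : a <= b -> leb `[a, b]%classic = (b - a)%:E.
  move=> ab; rewrite lebesgue_measure_itv /= lte_fin lt_neqAle ab andbT -EFinB.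
  by case: eqVneq => [->|//]; rewrite subrr.
have b1 : (nu B1 <= (M * (T - x))%:E)%E.
  have s1 : `[- T, - x]%classic `<=` (`[- T - eps, - T + eps]%classic `|` `[T - eps, T + eps]%classic).
    by apply: (@itv_sub_K eps (- T) (- x)); left; split; lra.
  apply: le_trans (H _ (mI _ _) s1) _.
  by rewrite len ?lerN2 ?(ltW xT)// -EFinM lee_fin; lra.
have b2 : (nu B2 <= (M * (T - x))%:E)%E.
  have s1 : `[x, T]%classic `<=` (`[- T - eps, - T + eps]%classic `|` `[T - eps, T + eps]%classic).
    by apply: (@itv_sub_K eps x T); right; split; lra.
  apply: le_trans (H _ (mI _ _) s1) _.
  by rewrite len ?(ltW xT)// -EFinM lee_fin; lra.
have sub : `]- T, T[%classic `<=` A `|` (B1 `|` B2).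
  move=> z; rewrite /A /B1 /B2 /= !in_itv /= => /andP[h1 h2].
  have [zx|zx] := leP z (- x); first by right; left; rewrite (ltW h1).
  by have [zx'|zx'] := leP x z; [right; right; rewrite (ltW h2)|left].
have mA : measurable A by exact: mI.
have mB1 : measurable B1 by exact: mI.
have mB2 : measurable B2 by exact: mI.
have mBB : measurable (B1 `|` B2) by exact: measurableU.
have mABB : measurable (A `|` (B1 `|` B2)) by exact: measurableU.
have : (nu `](- T)%R, T[%classic <= nu A + (nu B1 + nu B2))%E.
  apply: (@le_trans _ _ (nu (A `|` (B1 `|` B2)))).
    by apply: le_measure; rewrite ?inE//; exact: mABB.
  apply: le_trans (measureU2 nu mA mBB) _.
  by apply: leeD => //; exact: (measureU2 nu mB1 mB2).
rewrite -[X in (X <= _)%E](@fineK _ (nu _)) ?fin_num_measure//.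
rewrite -[X in (_ <= X + _)%E](@fineK _ (nu _)) ?fin_num_measure//.
move=> h; have {h} : ((fine (nu `](- T)%R, T[%classic))%:E <= (fine (nu A))%:E + ((M * (T - x))%R%:E + (M * (T - x))%R%:E))%E.
  by apply: (le_trans h); apply: leeD => //; exact: leeD.
rewrite -!EFinD lee_fin => h.
have h3 : M * (T - x) <= e / 2.
  apply: (@le_trans _ _ ((M + 1) * (e / (2 * (M + 1))))).
    apply: ler_pM => //; first by rewrite subr_ge0 ltW.
      by rewrite lerDl.
    lra.
  by rewrite le_eqVlt; apply/orP; left; apply/eqP; field; rewrite gt_eqF//; lra.
lra.
Qed.

(** Each half of ]-x, x[ has mass x times a one-sided density up to a relative error, so the
    constant is rho(0-) + rho(0+). *)
Lemma density_at0 : C = 0 -> exists2 K : R, 0 < K &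
  forall e : R, 0 < e -> exists2 d : R, 0 < d &
    forall x : R, 0 < x < d -> `|fine (nu `]- x, x[%classic) / x - K| <= e.
Proof.
move=> C0; case: hC => eps eps0 [rho]; rewrite C0 sqrtr0 mulr0 oppr0 !add0r /= setUid.
set K := `[_, _]%classic => -[mrho [M HM0] Hnu /(_ erefl) [[l l0 rl] [r r0 rr]]].
have HM x : K x -> 0 < rho x <= M by move=> Kx; apply: HM0; left.
exists (l + r); first exact: addr_gt0.
move=> e e0; have e2 : 0 < e / 2 by rewrite divr_gt0.
have /cvgrPdist_le/(_ _ e2) [d1 /= d10 H1] := rl.
have /cvgrPdist_le/(_ _ e2) [d2 /= d20 H2] := rr.
exists (Num.min eps (Num.min d1 d2)); first by rewrite !lt_min eps0 d10.
move=> x /andP[x0]; rewrite !lt_min => /and3P[xeps xd1 xd2].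
have mI (a b : itv_bound R) : measurable ([set` Interval a b] : set (measurableTypeR R)) by exact: measurable_itv.
have subK (a b : R) : - eps <= a -> b <= eps -> `]a, b[%classic `<=` K.
  move=> h1 h2 z; rewrite /K /= !in_itv /= => /andP[h3 h4].
  by apply/andP; split; [exact: le_trans (ltW h3)|exact: le_trans (ltW h4) h2].
have bnd (a b v : R) : a < b -> - eps <= a -> b <= eps ->
    (forall z, a < z < b -> `|v - rho z| <= e / 2) ->
    `|fine (nu `]a, b[%classic) - v * (b - a)| <= e / 2 * (b - a).
  move=> ab ha hb hv; have sK := subK _ _ ha hb.
  have mr : measurable_fun `]a, b[%classic (EFin \o rho).
    by apply/measurable_EFinP; apply: measurable_funS mrho => //; exact: measurable_itv.
  have len : leb `]a, b[%classic = (b - a)%:E.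
    by rewrite lebesgue_measure_itv /= lte_fin ab -EFinB.
  have r0' z : `]a, b[%classic z -> (0 <= (rho z)%:E)%E.
    by move=> /sK /HM /andP[h _]; rewrite lee_fin ltW.
  have ba0 : 0 <= b - a by rewrite subr_ge0 ltW.
  have up : (nu `]a, b[%classic <= ((v + e / 2) * (b - a))%:E)%E.
    rewrite Hnu//; apply: (@le_trans _ _ (\int[leb]_(z in `]a, b[) (v + e / 2)%:E)%E); last first.
      rewrite integral_cst// EFinM le_eqVlt; apply/orP; left; apply/eqP.
      by congr (_ * _)%E; exact: len.
    apply: ge0_le_integral => //.
    move=> z; rewrite /= in_itv /= => /hv.
    by rewrite lee_fin ler_norml => /andP[h1 h2]; lra.
  have lo : (((v - e / 2) * (b - a))%:E <= nu `]a, b[%classic)%E.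
    have [ve|ve] := leP (v - e / 2) 0.
      by apply: le_trans (measure_ge0 nu _); rewrite lee_fin mulr_le0_ge0.
    rewrite Hnu//; apply: (@le_trans _ _ (\int[leb]_(z in `]a, b[) (v - e / 2)%:E)%E).
      rewrite integral_cst// EFinM le_eqVlt; apply/orP; left; apply/eqP.
      by congr (_ * _)%E; exact/esym/len.
    apply: ge0_le_integral => //; first by move=> z _; rewrite lee_fin ltW.
    move=> z; rewrite /= in_itv /= => /hv.
    by rewrite lee_fin ler_norml => /andP[h1 h2]; lra.
  have nf : nu `]a, b[%classic = (fine (nu `]a, b[%classic))%:E by rewrite fineK// fin_num_measure.
  move: up lo; rewrite nf !lee_fin => up lo.
  by rewrite ler_norml; apply/andP; split; lra.
have B1 := bnd (- x) 0 l _ _ _ _.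
have B2 := bnd 0 x r _ _ _ _.
have {}B1 : `|fine (nu `]- x, 0[%classic) - l * x| <= e / 2 * x.
  have := bnd (- x) 0 l; rewrite sub0r opprK; apply; rewrite ?oppr_lt0 ?lerN2 ?(ltW xeps) ?(ltW eps0)//.
  move=> z /andP[h1 h2]; apply: H1 => //.
  by rewrite /ball_ /= sub0r normrN ltr0_norm//; lra.
have {}B2 : `|fine (nu `]0, x[%classic) - r * x| <= e / 2 * x.
  have := bnd 0 x r; rewrite subr0; apply; rewrite ?oppr_le0 ?(ltW xeps) ?(ltW eps0)//.
  move=> z /andP[h1 h2]; apply: H2 => //.
  by rewrite /ball_ /= sub0r normrN gtr0_norm//; lra.
have nu0 : nu [set (0 : R)] = 0%E.
  rewrite Hnu//; last by move=> _ ->; rewrite /K /= in_itv /= oppr_le0 ltW.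
  by rewrite integral_set1.
have E : fine (nu `]- x, x[%classic) = fine (nu `]- x, 0[%classic) + fine (nu `]0, x[%classic).
  have -> : `]- x, x[%classic = `]- x, 0[%classic `|` (`]0, x[%classic `|` [set 0]).
    apply/seteqP; split => z /=; rewrite !in_itv /=.
      move=> /andP[h1 h2]; have [z0|z0|->] := ltgtP z 0; [left|right; left|by right; right]; apply/andP; split => //.
    by move=> [/andP[h1 h2]|[/andP[h1 h2]|->]]; apply/andP; split; lra.
  have m1 : measurable (`]0, x[%classic `|` [set (0 : R)] : set (measurableTypeR R)).
    by apply: measurableU.
  rewrite measureU//; last first.
    by rewrite -subset0 => z /=; rewrite !in_itv /= => -[/andP[_ h1] [/andP[h2 _]|h2]]; lra.
  rewrite measureU//; last first.
    by rewrite -subset0 => z /=; rewrite !in_itv /= => -[/andP[h2 _] h1]; lra.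
  rewrite [X in fine (_ + (_ + X))%E](_ : _ = 0%E)// adde0.
  by rewrite fineD// fin_num_measure.
have -> : fine (nu `]- x, x[%classic) / x - (l + r) =
   ((fine (nu `]- x, 0[%classic) - l * x) + (fine (nu `]0, x[%classic) - r * x)) / x.
  by rewrite E; field; rewrite gt_eqF.
rewrite normrM normfV (gtr0_norm x0) ler_pdivrMr//.
apply: le_trans (ler_normD _ _) _; lra.
Qed.

End density.

(** * Acceptance probability in units of c / sqrt n *)

Section scaled_accept.
Context {R : realType} (nu : probability (measurableTypeR R) R) (sigma C : R).
Hypotheses (sigma0 : 0 < sigma) (C_ge0 : 0 <= C) (hC : assumptionC nu sigma C).
Variable (n : nat -> nat).
Hypotheses (hn : forall m, (0 < n m)%N) (noo : (n m)%:R @[m --> \oo] --> (+oo : set_system R)).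
Let T := sigma * Num.sqrt C.
Local Notation sN m := (Num.sqrt (n m)%:R : R).
Local Notation k m := (sN m / sigma).

Lemma sN_gt0 m : 0 < sN m. Proof. by rewrite sqrtr_gt0 ltr0n. Qed.

Lemma scale_gt0 m : 0 < k m. Proof. by rewrite divr_gt0// sN_gt0. Qed.

Lemma sN_oo : sN m @[m --> \oo] --> +oo.
Proof.
apply/cvgryPgt => A.
near=> m.
apply: (@le_lt_trans _ _ `|A|); first exact: ler_norm.
rewrite -sqrtr_sqr ltr_sqrt ?ltr0n//.
by near: m; apply: near_gt_oo.
Unshelve. all: by end_near. Qed.

Lemma scale_oo : k m @[m --> \oo] --> +oo.
Proof.
apply/cvgryPgt => A; near=> m.
by rewrite ltr_pdivlMr//; near: m; apply: near_gt_oo; exact: sN_oo.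
Unshelve. all: by end_near. Qed.

Lemma threshold_ratio (c : nat -> R) (l : R) : c m @[m --> \oo] --> +oo ->
  c m ^+ 2 / (n m)%:R @[m --> \oo] --> l -> c m / sN m @[m --> \oo] --> Num.sqrt l.
Proof.
move=> coo cl; have := cvg_sqrt cl.
apply: cvg_trans; apply: near_eq_cvg; near=> m.
have c0 : 0 < c m by near: m; exact: near_gt_oo.
by rewrite sqrtrM ?sqr_ge0// sqrtr_sqr gtr0_norm// sqrtrV.
Unshelve. all: by end_near. Qed.

Lemma threshold_scale (c : nat -> R) (l : R) :
  c m / sN m @[m --> \oo] --> l -> c m / k m @[m --> \oo] --> sigma * l.
Proof.
move=> cl; have -> : (fun m => c m / k m) = (fun m => sigma * (c m / sN m)).
  apply/funext => m; have := sN_gt0 m; have := sigma0.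
  by move=> s0 n0; field; rewrite !gt_eqF.
by apply: cvgM => //; exact: cvg_cst.
Qed.

Lemma accept_cvg_sqrt (c : nat -> R) (l tau : R) : 0 <= l -> tau = sigma * Num.sqrt l ->
  c m @[m --> \oo] --> +oo -> c m ^+ 2 / (n m)%:R @[m --> \oo] --> l ->
  nu [set - tau] = 0%E -> nu [set tau] = 0%E ->
  accept nu (k m) (- c m) (c m) @[m --> \oo] --> fine (nu `]- tau, tau[%classic).
Proof.
move=> l0 -> coo cl nl nr; apply: accept_cvg => //.
- by rewrite mulr_ge0// ltW.
- exact: scale_gt0.
- exact: scale_oo.
- by apply: threshold_scale; exact: threshold_ratio.
Qed.

(** Here the acceptance probability itself tends to 0, so the noise corrections must be negligible
    against c / k. The bounds [accept_lower] and [accept_upper], divided by c / k, give K up to a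
    factor 1 - eta or 1 + eta. *)
Lemma accept_cvg0 : C = 0 -> exists2 K : R, 0 < K &
  forall c : nat -> R, c m @[m --> \oo] --> +oo -> c m / k m @[m --> \oo] --> (0 : R) ->
  accept nu (k m) (- c m) (c m) / (c m / k m) @[m --> \oo] --> K.
Proof.
move=> C0; have [K K0 HK] := density_at0 hC C0.
have [eps eps0 [M M0 /= [HM _]]] := density_bounds hC.
exists K => // c coo ct.
have Teq : sigma * Num.sqrt C = 0 by rewrite C0 sqrtr0 mulr0.
have HM' x y : - eps <= x -> x <= y -> y <= eps -> (nu `]x, y[%classic <= (M * (y - x))%:E)%E.
  move=> h1 h2 h3; have mI : measurable (`]x, y[%classic : set R) by exact: measurable_itv.
  have sub : `]x, y[%classic `<=` (`[- (sigma * Num.sqrt C) - eps, - (sigma * Num.sqrt C) + eps]%classic `|`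
      `[sigma * Num.sqrt C - eps, sigma * Num.sqrt C + eps]%classic).
    rewrite Teq oppr0 !add0r => z /=; rewrite !in_itv /= => /andP[a1 a2].
    by left; apply/andP; split; lra.
  apply: le_trans (HM _ mI sub) _.
  rewrite lebesgue_measure_itv /= lte_fin; case: ifPn => xy.
    by rewrite -EFinB -EFinM.
  by rewrite mule0 lee_fin mulr_ge0// subr_ge0.
have c_gt0 : \forall m \near \oo, 0 < c m by exact: near_gt_oo.
have dens (a : R) : 0 < a ->
    fine (nu `]- (a * (c m / k m)), a * (c m / k m)[%classic) / (a * (c m / k m)) @[m --> \oo] --> K.
  move=> a0; apply/cvgrPdist_le => e e0.
  have [d d0 Hd] := HK _ e0.
  have act : a * (c m / k m) @[m --> \oo] --> (0 : R).
    by rewrite -(mulr0 a); apply: cvgM => //; exact: cvg_cst.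
  near=> m; rewrite distrC; apply: Hd; apply/andP; split.
    by rewrite mulr_gt0// divr_gt0 ?scale_gt0//; near: m.
  by near: m; exact: (cvgr_lt _ act).
have tl (a : R) : 0 < a -> tail (a * c m) @[m --> \oo] --> (0 : R).
  move=> a0; apply: tail_cvg0; apply/cvgryPgt => A; near=> m.
  by rewrite mulrC -ltr_pdivrMr//; near: m; exact: near_gt_oo.
(* The tail at k eps / 2 is at most a constant over k, that is, a constant over c in units of c / k;
   hence c -> +oo is enough. *)
have tk : tail (k m * (eps / 2)) / (c m / k m) @[m --> \oo] --> (0 : R).
  apply: (@squeeze_cvg0 _ _ (fun m => (normal_peak 1 / (eps / 2)) / c m)); last first.
    exact: cvg_div_oo (cvg_cst _) coo.
  near=> m; have cm : 0 < c m by near: m.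
  have km := scale_gt0 m; have e2 : 0 < eps / 2 by rewrite divr_gt0.
  have ke : 0 < k m * (eps / 2) by rewrite mulr_gt0.
  have ck : 0 < c m / k m by rewrite divr_gt0.
  rewrite divr_ge0 ?tail_ge0 ?(ltW ck)//=.
  have h1 := mills_upper ke.
  have h2 : phi (k m * (eps / 2)) / (k m * (eps / 2)) <= normal_peak 1 / (k m * (eps / 2)).
    by rewrite ler_wpM2r ?phi_le// invr_ge0 ltW.
  rewrite (ler_pdivrMr _ _ ck); apply: le_trans h1 _; apply: le_trans h2 _.
  have := sN_gt0 m => s0.
  by rewrite le_eqVlt; apply/orP; left; apply/eqP; field; rewrite !gt_eqF.
apply: squeeze_eps => e e0.
  (* The relative error [eta] costs eta K in the limit, which the choice e / K keeps below [e]. *)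
  pose eta := Num.min (1 / 2) (e / K).
  have eK : 0 < e / K by rewrite divr_gt0.
  have eta0 : 0 < eta < 1 by rewrite lt_min eK gt_min /=; apply/andP; split; [apply/andP; split|apply/orP; left]; lra.
  have etaK : eta * K <= e by rewrite -ler_pdivlMr// ge_min lexx orbT.
  have [ep ep1] := andP eta0.
  exists (fun m => (1 + eta) * (fine (nu `]- ((1 + eta) * (c m / k m)), (1 + eta) * (c m / k m)[%classic) / ((1 + eta) * (c m / k m)))
     + 4 * M * tail (eta * c m) + 2 * (tail (k m * (eps / 2)) / (c m / k m))).
  exists ((1 + eta) * K + 4 * M * 0 + 2 * 0); split; last by lra.
    near=> m.
    have cm : 0 < c m by near: m.
    have km := scale_gt0 m.
    have ck : 0 < c m / k m by rewrite divr_gt0.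
    have cke : c m / k m <= eps / 2.
      by near: m; apply: (cvgr_le _ ct); rewrite divr_gt0.
    have := accept_upper (nu := nu) km cm eta0 eps0 M0 HM' cke.
    rewrite -(ler_pM2r (_ : 0 < (c m / k m)^-1)) ?invr_gt0// => h.
    apply: le_trans h _; rewrite le_eqVlt; apply/orP; left; apply/eqP.
    set F := fine _; set t := c m / k m in ck *.
    by field; apply/andP; split; rewrite gt_eqF//; lra.
  apply: cvgD; first apply: cvgD.
  - by apply: cvgM; [exact: cvg_cst|apply: dens; lra].
  - by apply: cvgM; [exact: cvg_cst|exact: tl].
  - by apply: cvgM; [exact: cvg_cst|exact: tk].
pose eta := Num.min (1 / 2) (e / K).
have eK : 0 < e / K by rewrite divr_gt0.
have eta0 : 0 < eta < 1 by rewrite lt_min eK gt_min /=; apply/andP; split; [apply/andP; split|apply/orP; left]; lra.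
have etaK : eta * K <= e by rewrite -ler_pdivlMr// ge_min lexx orbT.
have [ep ep1] := andP eta0.
exists (fun m => (1 - 2 * tail (eta * c m)) * ((1 - eta) * (fine (nu `]- ((1 - eta) * (c m / k m)), (1 - eta) * (c m / k m)[%classic) / ((1 - eta) * (c m / k m))))).
exists ((1 - 2 * 0) * ((1 - eta) * K)); split; last by lra.
  near=> m.
  have cm : 0 < c m by near: m.
  have km := scale_gt0 m.
  have ck : 0 < c m / k m by rewrite divr_gt0.
  have := accept_lower nu km cm eta0.
  rewrite -(ler_pM2r (_ : 0 < (c m / k m)^-1)) ?invr_gt0// => h.
  apply: le_trans h; rewrite le_eqVlt; apply/orP; left; apply/eqP.
  set F := fine _; set t := c m / k m in ck *.
  by field; apply/andP; split; rewrite gt_eqF//; lra.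
apply: cvgM.
  by apply: cvgB; [exact: cvg_cst|apply: cvgM; [exact: cvg_cst|exact: tl]].
by apply: cvgM; [exact: cvg_cst|apply: dens; lra].
Unshelve. all: by end_near. Qed.

(* [kap] comes from the density of [nu] at 0 if [C = 0] and from the mass of
   ]-T, T[ otherwise; the last clause bounds the loss when the interval shrinks. *)
Lemma accept_scaled : exists kap : R, [/\ 0 < kap,
  kap * Num.sqrt C = fine (nu `]- T, T[%classic),
  forall c : nat -> R, c m @[m --> \oo] --> +oo ->
    c m ^+ 2 / (n m)%:R @[m --> \oo] --> C ->
    accept nu (k m) (- c m) (c m) / (c m / sN m) @[m --> \oo] --> kap &
  forall e : R, 0 < e -> exists2 eta : R, 0 < eta < 1 & exists2 Lw : R, kap - e <= Lw &
    forall c : nat -> R, c m @[m --> \oo] --> +oo ->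
      c m ^+ 2 / (n m)%:R @[m --> \oo] --> C ->
      accept nu (k m) (- ((1 - eta) * c m)) ((1 - eta) * c m) / (c m / sN m) @[m --> \oo] --> Lw].
Proof.
have mulc_oo (c : nat -> R) (a : R) : 0 < a -> c m @[m --> \oo] --> +oo -> a * c m @[m --> \oo] --> +oo.
  move=> a0 coo; apply/cvgryPgt => A; near=> m.
  by rewrite mulrC -ltr_pdivrMr//; near: m; exact: near_gt_oo.
have [C0|Cneq0] := eqVneq C 0.
  have [K K0 HK] := accept_cvg0 C0.
  have main (c : nat -> R) : c m @[m --> \oo] --> +oo ->
      c m ^+ 2 / (n m)%:R @[m --> \oo] --> C ->
      accept nu (k m) (- c m) (c m) / (c m / sN m) @[m --> \oo] --> sigma * K.
    move=> coo cl.
    have c0 : c m / k m @[m --> \oo] --> (0 : R).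
      rewrite -(mulr0 sigma) -(sqrtr0 R) -C0; apply: threshold_scale; exact: threshold_ratio.
    have -> : (fun m => accept nu (k m) (- c m) (c m) / (c m / sN m)) =
      (fun m => sigma * (accept nu (k m) (- c m) (c m) / (c m / k m))).
      apply/funext => m; have [->|cn0] := eqVneq (c m) 0; first by rewrite !mul0r !invr0 !mulr0.
      have := sN_gt0 m => s0; field.
      by rewrite cn0 !gt_eqF.
    by apply: cvgM; [exact: cvg_cst|exact: HK].
  exists (sigma * K); split => //.
  - exact: mulr_gt0.
  - rewrite C0 sqrtr0 mulr0 /T C0 sqrtr0 mulr0 oppr0 set_itv_ge ?measure0//.
    by rewrite bnd_simp ltxx.
  move=> e e0; pose eta := Num.min (1 / 2) (e / (sigma * K)).
  have sK : 0 < sigma * K by rewrite mulr_gt0.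
  have eK : 0 < e / (sigma * K) by rewrite divr_gt0.
  have eta0 : 0 < eta < 1 by rewrite lt_min eK gt_min /=; apply/andP; split; [apply/andP; split|apply/orP; left]; lra.
  have etaK : eta * (sigma * K) <= e by rewrite -ler_pdivlMr// ge_min lexx orbT.
  have [ep ep1] := andP eta0.
  exists eta => //; exists ((1 - eta) * (sigma * K)); first lra.
  move=> c coo cl.
  have e1 : 0 < 1 - eta by lra.
  have cl' : ((1 - eta) * c m) ^+ 2 / (n m)%:R @[m --> \oo] --> C.
    have -> : (fun m => ((1 - eta) * c m) ^+ 2 / (n m)%:R) = (fun m => (1 - eta) ^+ 2 * (c m ^+ 2 / (n m)%:R)).
      by apply/funext => m; rewrite exprMn -mulrA.
    by rewrite C0 -(mulr0 ((1 - eta) ^+ 2)) -C0; apply: cvgM => //; exact: cvg_cst.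
  have := main _ (mulc_oo _ _ e1 coo) cl' => h.
  have -> : (fun m => accept nu (k m) (- ((1 - eta) * c m)) ((1 - eta) * c m) / (c m / sN m)) =
     (fun m => (1 - eta) * (accept nu (k m) (- ((1 - eta) * c m)) ((1 - eta) * c m) / ((1 - eta) * c m / sN m))).
    apply/funext => m; have [->|cn0] := eqVneq (c m) 0; first by rewrite !(mul0r, mulr0) !invr0 !mulr0.
    have := sN_gt0 m => s0; field.
    by rewrite cn0 !gt_eqF.
  by apply: cvgM => //; exact: cvg_cst.
have C0 : 0 < C by rewrite lt_neqAle eq_sym Cneq0.
have sC : 0 < Num.sqrt C by rewrite sqrtr_gt0.
have [nl nr] := no_atom hC.
exists (fine (nu `]- T, T[%classic) / Num.sqrt C); split.
- by rewrite divr_gt0//; exact: prob_sym_gt0.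
- by rewrite divfK// gt_eqF.
- move=> c coo cl.
  apply: cvgM; last by apply: cvgV; [rewrite gt_eqF|exact: threshold_ratio].
  exact: (accept_cvg_sqrt C_ge0 erefl).
move=> e e0; have es : 0 < e * Num.sqrt C by rewrite mulr_gt0.
(* The margin e sqrt C becomes [e] after division by c / sqrt n, which tends to sqrt C. The
   atom-free radius (1 - eta) T makes the shrunk acceptance probabilities converge. *)
have [eta [eta0 al ar hnear]] := prob_sym_near sigma0 hC C0 es.
have [ep ep1] := andP eta0.
exists eta => //.
exists (fine (nu `]- ((1 - eta) * T), (1 - eta) * T[%classic) / Num.sqrt C).
  by rewrite ler_pdivlMr// mulrBl divfK ?gt_eqF.
move=> c coo cl.
apply: cvgM; last by apply: cvgV; [rewrite gt_eqF|exact: threshold_ratio].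
have e1 : 0 < 1 - eta by lra.
apply: (@accept_cvg_sqrt _ ((1 - eta) ^+ 2 * C)) => //.
- by rewrite mulr_ge0// sqr_ge0.
- by rewrite sqrtrM ?sqr_ge0// sqrtr_sqr gtr0_norm// /T mulrCA.
- exact: mulc_oo.
- have -> : (fun m => ((1 - eta) * c m) ^+ 2 / (n m)%:R) = (fun m => (1 - eta) ^+ 2 * (c m ^+ 2 / (n m)%:R)).
    by apply/funext => m; rewrite exprMn -mulrA.
  by apply: cvgM => //; exact: cvg_cst.
Unshelve. all: by end_near. Qed.

End scaled_accept.

(** * The risk of the oracle *)

Section bayes_risk.
Context {R : realType} (nu : probability (measurableTypeR R) R) (sigma C kap : R).
Hypotheses (sigma0 : 0 < sigma).
Variable (n : nat -> nat).
Hypotheses (hn : forall m, (0 < n m)%N).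
Local Notation sN m := (Num.sqrt (n m)%:R : R).
Local Notation k m := (sN m / sigma).
Hypothesis acc1 : forall c : nat -> R, c m @[m --> \oo] --> +oo ->
    c m ^+ 2 / (n m)%:R @[m --> \oo] --> C ->
    accept nu (k m) (- c m) (c m) / (c m / sN m) @[m --> \oo] --> kap.
Hypothesis acc2 : forall e : R, 0 < e -> exists2 eta : R, 0 < eta < 1 & exists2 Lw : R, kap - e <= Lw &
    forall c : nat -> R, c m @[m --> \oo] --> +oo ->
      c m ^+ 2 / (n m)%:R @[m --> \oo] --> C ->
      accept nu (k m) (- ((1 - eta) * c m)) ((1 - eta) * c m) / (c m / sN m) @[m --> \oo] --> Lw.
Variables (D rB : nat -> R).
Hypothesis D0 : forall m, 0 < D m.
Let L m := 2 * ln (D m * sN m).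
Hypothesis Loo : L m @[m --> \oo] --> +oo.
Hypothesis LN : L m / (n m)%:R @[m --> \oo] --> C.
(** The oracle is represented by its optimality against symmetric intervals and by the form of its
    risk, with unknown endpoints of opposite signs. *)
Hypothesis B1 : \forall m \near \oo, forall c : R, 0 < c ->
  rB m <= D m * (2 * tail c) + accept nu (k m) (- c) c.
Hypothesis B0 : \forall m \near \oo, exists l r : R,
  l < 0 < r /\ rB m = D m * (tail (- l) + tail r) + accept nu (k m) l r.

Let c m := Num.sqrt (L m).
Let P0 : R := (Num.sqrt (pi *+ 2))^-1.

Let sN0 m : 0 < sN m. Proof. exact: sN_gt0. Qed.

Lemma sqrt_oo (u : nat -> R) : u m @[m --> \oo] --> +oo -> Num.sqrt (u m) @[m --> \oo] --> +oo.
Proof.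
move=> uoo; apply/cvgryPgt => A; near=> m.
apply: (@le_lt_trans _ _ `|A|); first exact: ler_norm.
have u0 : 0 < u m by near: m; exact: near_gt_oo.
by rewrite -sqrtr_sqr ltr_sqrt//; near: m; apply: near_gt_oo.
Unshelve. all: by end_near. Qed.

Let coo : c m @[m --> \oo] --> +oo. Proof. exact: sqrt_oo. Qed.

Let cN : c m ^+ 2 / (n m)%:R @[m --> \oo] --> C.
Proof.
apply: cvg_trans LN; apply: near_eq_cvg; near=> m.
have L0 : 0 < L m by near: m; exact: near_gt_oo.
by rewrite /c sqr_sqrtr// ltW.
Unshelve. all: by end_near. Qed.

Let DE m : D m = expR (L m / 2) / sN m.
Proof.
rewrite /L [2 * _]mulrC mulfK// lnK ?mulfK ?gt_eqF//.
by rewrite posrE mulr_gt0.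
Qed.

Let P0_gt0 : 0 < P0.
Proof. by rewrite invr_gt0 sqrtr_gt0 mulrn_wgt0// pi_gt0. Qed.

Lemma bayes_risk_asymp : rB m / (Num.sqrt (L m) / sN m) @[m --> \oo] --> kap.
Proof.
have upper : \forall m \near \oo, rB m / (c m / sN m) <=
    2 * P0 / L m + accept nu (k m) (- c m) (c m) / (c m / sN m).
  near=> m.
  have L0 : 0 < L m by near: m; exact: near_gt_oo.
  have c0 : 0 < c m by rewrite sqrtr_gt0.
  have s0 : 0 < c m / sN m by rewrite divr_gt0.
  have h : rB m <= D m * (2 * tail (c m)) + accept nu (k m) (- c m) (c m).
    have B1m : forall c : R, 0 < c ->
      rB m <= D m * (2 * tail c) + accept nu (k m) (- c) c by near: m.
    exact: B1m.
  (* With c^2 = L the factor exp(- c^2 / 2) turns D into 1 / sqrt n. Mills' bound then gives 2 P0 /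
     (c sqrt n), which is smaller than c / sqrt n by the factor 2 P0 / L. *)
  have h2 : D m * (2 * tail (c m)) <= 2 * P0 / L m * (c m / sN m).
    have := mills_upper c0; rewrite /phi -/P0 => mu.
    have D0' := D0 m.
    apply: (@le_trans _ _ (D m * (2 * (P0 * expR (- (c m ^+ 2 / 2)) / c m)))).
      by rewrite !ler_wpM2l// ltW.
    rewrite le_eqVlt; apply/orP; left; apply/eqP.
    have cL : L m = c m ^+ 2 by rewrite /c sqr_sqrtr// ltW.
    rewrite DE -{1}cL expRN cL; have := expR_gt0 (c m ^+ 2 / 2).
    set E := expR _ => E0; have n0 := sN0 m.
    by field; rewrite !gt_eqF.
  rewrite ler_pdivrMr// mulrDl divfK ?gt_eqF//.
  by apply: le_trans h _; rewrite lerD2r.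
have small : 2 * P0 / L m @[m --> \oo] --> (0 : R) by apply: cvg_div_oo Loo; exact: cvg_cst.
have acccvg := acc1 coo cN.
have uppercvg : 2 * P0 / L m + accept nu (k m) (- c m) (c m) / (c m / sN m) @[m --> \oo] --> kap.
  by rewrite -(add0r kap); exact: cvgD.
apply: squeeze_eps => e e0.
  exists (fun m => 2 * P0 / L m + accept nu (k m) (- c m) (c m) / (c m / sN m)), kap.
  by split => //; lra.
have [eta eta01 [Lw Lwk HL]] := acc2 e0.
have [ep ep1] := andP eta01.
exists (fun m => accept nu (k m) (- ((1 - eta) * c m)) ((1 - eta) * c m) / (c m / sN m)), Lw.
split => //; last exact: HL.
have bdd : \forall m \near \oo, rB m / (c m / sN m) <= kap + 1.
  near=> m; have h1 : rB m / (c m / sN m) <=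
    2 * P0 / L m + accept nu (k m) (- c m) (c m) / (c m / sN m) by near: m.
  by apply: le_trans h1 _; near: m; apply: (cvgr_le _ uppercvg); lra.
(* At u = (1 - eta) c one has u^2 / 2 = L / 2 - a L, so D phi(u) equals P0 exp(a L) / sqrt n:
   shrinking the endpoint costs an exponential factor. The 8 used below is 2 from Mills' lower bound
   times 4 from exp(a L) >= (a L)^2 / 4. *)
pose a := (1 - (1 - eta) ^+ 2) / 2.
have a0 : 0 < a by rewrite divr_gt0// subr_gt0 expr_lt1//; lra.
have Pa : 0 < P0 * a ^+ 2 / 8 by rewrite divr_gt0// mulr_gt0// exprn_gt0.
have big : \forall m \near \oo, kap + 1 < P0 * a ^+ 2 / 8 * L m.
  near=> m; rewrite mulrC -ltr_pdivrMr//; near: m; exact: near_gt_oo.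
near=> m.
have L0 : 0 < L m by near: m; exact: near_gt_oo.
have c0 : 0 < c m by rewrite sqrtr_gt0.
have s0 : 0 < c m / sN m by rewrite divr_gt0.
rewrite ler_pM2r ?invr_gt0//.
have [l [r [/andP[l0 r0] rE]]] : exists l r : R,
  l < 0 < r /\ rB m = D m * (tail (- l) + tail r) + accept nu (k m) l r by near: m.
set u := (1 - eta) * c m.
have u1 : 1 <= u.
  rewrite /u mulrC -ler_pdivrMr ?subr_gt0//; apply: ltW; near: m; exact: near_gt_oo.
have u0 : 0 < u by lra.
have Dm := D0 m.
(* Endpoints closer to 0 than [u] would give a type I risk of order at least
   [L * (c / sqrt n)], against [bdd]. *)
have key : ~ (D m * tail u <= rB m).
  move=> h.
  have lo : P0 * a ^+ 2 / 8 * L m * (c m / sN m) <= D m * tail u.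
    have ml := mills_lower u0.
    have u2 : u ^- 2 <= 1 by rewrite invf_le1 ?exprn_gt0// exprn_ege1.
    have t1 : phi u / u <= 2 * tail u.
      by apply: le_trans ml _; rewrite ler_wpM2r ?tail_ge0//; lra.
    have cL : L m = c m ^+ 2 by rewrite /c sqr_sqrtr// ltW.
    have phiu : phi u = P0 * expR (a * L m) * expR (- (L m / 2)).
      rewrite /phi -/P0 -mulrA -expRD; congr (_ * expR _).
      by rewrite /a /u cL; field.
    (* Square of x / 2 <= exp(x / 2). A quadratic bound suffices, since it still leaves a spare
       factor [L] over c / sqrt n. *)
    have ex : (a * L m) ^+ 2 / 4 <= expR (a * L m).
      have aL : 0 <= a * L m by rewrite mulr_ge0// ltW.
      have h1 : a * L m / 2 <= expR (a * L m / 2).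
        by apply: le_trans (expR_ge1Dx _); lra.
      have -> : a * L m = a * L m / 2 + a * L m / 2 by lra.
      rewrite expRD -expr2.
      have -> : (a * L m / 2 + a * L m / 2) ^+ 2 / 4 = (a * L m / 2) ^+ 2 by field.
      by rewrite lerXn2r// nnegrE ?expR_ge0// divr_ge0.
    have uc : u <= c m by rewrite /u -[leRHS]mul1r (ler_wpM2r (ltW c0))//; lra.
    have n0 := sN0 m.
    apply: (@le_trans _ _ (D m * (phi u / u / 2))); last by rewrite (ler_wpM2l (ltW Dm))//; lra.
    have DphiE : D m * phi u = P0 * expR (a * L m) / sN m.
      rewrite phiu DE expRN; have := expR_gt0 (L m / 2).
      set E := expR (L m / 2) => E0; set E' := expR _.
      by field; rewrite !gt_eqF.
    have -> : D m * (phi u / u / 2) = P0 * expR (a * L m) / sN m / (2 * u).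
      by rewrite -DphiE; field; rewrite gt_eqF.
    have tu : 0 < 2 * u by lra.
    rewrite (ler_pdivlMr _ _ tu).
    have -> : P0 * a ^+ 2 / 8 * L m * (c m / sN m) * (2 * u) =
       (P0 / sN m) * (a ^+ 2 * L m / 4 * (c m * u)) by field; rewrite gt_eqF.
    have -> : P0 * expR (a * L m) / sN m = (P0 / sN m) * expR (a * L m) by field; rewrite gt_eqF.
    apply: ler_wpM2l; first by rewrite divr_ge0 ?(ltW P0_gt0) ?(ltW n0).
    apply: le_trans ex.
    have -> : (a * L m) ^+ 2 / 4 = a ^+ 2 * L m / 4 * (c m * c m) by rewrite cL; field.
    apply: ler_wpM2l; last by rewrite (ler_wpM2l (ltW c0)).
    by rewrite divr_ge0// mulr_ge0 ?sqr_ge0// ltW.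
  have h1 : rB m / (c m / sN m) <= kap + 1 by near: m.
  have h2 : kap + 1 < P0 * a ^+ 2 / 8 * L m by near: m.
  have h3 : P0 * a ^+ 2 / 8 * L m <= rB m / (c m / sN m).
    by rewrite ler_pdivlMr//; exact: le_trans h.
  lra.
have acc0 := accept_ge0 nu (k m) l r.
have ru : u <= r.
  rewrite leNgt; apply/negP => ru; apply: key; rewrite rE.
  have t1 := tail_nincr (ltW ru); have t2 := tail_ge0 (- l).
  have t3 : D m * tail u <= D m * (tail (- l) + tail r) by rewrite (ler_wpM2l (ltW Dm))//; lra.
  lra.
have lu : l <= - u.
  rewrite leNgt; apply/negP => lu; apply: key; rewrite rE.
  have lu' : - l <= u by rewrite lerNl ltW.
  have t1 := tail_nincr lu'; have t2 := tail_ge0 r.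
  have t3 : D m * tail u <= D m * (tail (- l) + tail r) by rewrite (ler_wpM2l (ltW Dm))//; lra.
  lra.
rewrite rE; apply: le_trans (accept_le nu (k m) lu ru) _.
by rewrite lerDr mulr_ge0 ?(ltW Dm)// addr_ge0 ?tail_ge0.
Unshelve. all: by end_near. Qed.

End bayes_risk.

(** * The threshold of the BFDR rule *)

Section power.
Context {R : realType} (nu : probability (measurableTypeR R) R).
Local Notation N01 := (normal_prob (0 : R) 1).

(** An effect at least [tau] with noise beyond c - k tau is rejected, and symmetrically on the left.
    Bounding each side by the whole power produces the factor 2. *)
Lemma power_lower (k c tau : R) : 0 < k -> 0 < c -> 0 <= tau ->
  (1 - fine (nu `]- tau, tau[%classic)) * tail (c - k * tau) <= 2 * (1 - accept nu k (- c) c).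
Proof.
move=> k0 c0 tau0.
have mI (a b : itv_bound R) : measurable ([set` Interval a b] : set (measurableTypeR R)) by exact: measurable_itv.
pose A := accept_set k (- c) c.
have mA : measurable A by exact: measurable_accept_set.
have pw (B1 B2 : set (measurableTypeR R)) : measurable B1 -> measurable B2 ->
    N01 B2 = (tail (c - k * tau))%:E -> B1 `*` B2 `<=` ~` A ->
    fine (nu B1) * tail (c - k * tau) <= 1 - accept nu k (- c) c.
  move=> m1 m2 E sub.
  have -> : 1 - accept nu k (- c) c = fine (effect_noise nu (~` A)).
    by rewrite probability_setC// fineB ?fin_num_measure.
  apply: (@le_trans _ _ (fine (effect_noise nu (B1 `*` B2)))).
    by rewrite effect_noise_rect// E fineM ?fin_num_measure.
  by apply: fine_prob_le => //; [exact: measurableX|exact: measurableC].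
have p1 := pw `[tau, +oo[%classic `]c - k * tau, +oo[%classic (mI _ _) (mI _ _).
have p2 := pw `]-oo, - tau]%classic `]-oo, - (c - k * tau)[%classic (mI _ _) (mI _ _).
have {}p1 : fine (nu `[tau, +oo[%classic) * tail (c - k * tau) <= 1 - accept nu k (- c) c.
  apply: p1; first by rewrite tailE.
  move=> [x z] [] /=; rewrite !in_itv /= !andbT => hx hz; rewrite /A /accept_set /=.
  have : k * tau <= k * x by rewrite ler_pM2l.
  by move=> h; apply/negP; rewrite negb_and -!leNgt; apply/orP; right; lra.
have {}p2 : fine (nu `]-oo, - tau]%classic) * tail (c - k * tau) <= 1 - accept nu k (- c) c.
  apply: p2; first by rewrite -tailN opprK.
  move=> [x z] [] /=; rewrite !in_itv /= => hx hz; rewrite /A /accept_set /=.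
  have : k * x <= k * (- tau) by rewrite ler_pM2l.
  rewrite mulrN => h.
  by apply/negP; rewrite negb_and -!leNgt; apply/orP; left; lra.
have cov : 1 - fine (nu `]- tau, tau[%classic) <= fine (nu `[tau, +oo[%classic) + fine (nu `]-oo, - tau]%classic).
  have -> : 1 - fine (nu `]- tau, tau[%classic) = fine (nu (~` `]- tau, tau[%classic)).
    by rewrite (@probability_setC _ _ _ nu)// fineB ?fin_num_measure.
  rewrite -fineD ?fin_num_measure//.
  apply: fine_le; rewrite ?fin_num_measure ?fin_numD ?fin_num_measure//.
    exact: measurableC.
  apply: le_trans (measureU2 nu (mI _ _) (mI _ _)).
  apply: le_measure; rewrite ?inE; [exact: measurableC|exact: measurableU|].
  move=> z /=; rewrite !in_itv /= andbT => /negP; rewrite negb_and -!leNgt => /orP[h|h]; [by right|by left].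
have := ler_wpM2r (tail_ge0 (c - k * tau)) cov.
by rewrite mulrDl; lra.
Qed.

Lemma ln_le_id (x : R) : 0 < x -> ln x <= x.
Proof.
move=> x0; have x1 : -1 < x - 1 by lra.
have E : 1 + (x - 1) = x by lra.
by have := le_ln1Dx x1; rewrite E; lra.
Qed.

(** Continuity from above: the larger intervals shrink to the closed interval of radius [tau0],
    whose endpoints carry no mass. *)
Lemma exists_radius_lt1 (tau0 : R) : 0 <= tau0 -> (nu `](- tau0)%R, tau0[%classic < 1)%E ->
  nu [set - tau0] = 0%E -> nu [set tau0] = 0%E ->
  exists2 tau : R, tau0 < tau & fine (nu `]- tau, tau[%classic) < 1.
Proof.
move=> t0 lt1 nl nr.
pose F (j : nat) : set (measurableTypeR R) := `]- (tau0 + j.+1%:R^-1), tau0 + j.+1%:R^-1[%classic.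
have mF j : measurable (F j) by exact: measurable_itv.
have capE : \bigcap_j F j = `]- tau0, tau0[%classic `|` ([set - tau0] `|` [set tau0]).
  apply/seteqP; split => z.
    move=> H; have zt : `|z| <= tau0.
      apply/ler_addgt0Pr => e e0.
      have [j _ Hj] := near_infty_natSinv_lt (PosNum e0).
      have := H j I; rewrite /F /= in_itv /= -ltr_norml => hz.
      by apply: le_trans (ltW hz) _; rewrite lerD2l; apply: ltW; apply: (Hj j) => /=.
    move: zt; rewrite le_eqVlt => /orP[/eqP /norm_eq_or [] ->|]; [by right; left|by right; right|].
    by rewrite ltr_norml => h; left; rewrite /= in_itv.
  move=> H j _; rewrite /F /= in_itv /= -ltr_norml.
  have j0 : 0 < j.+1%:R^-1 :> R by rewrite invr_gt0.
  have zt : `|z| <= tau0.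
    case: H => [|[] ->]; [by rewrite /= in_itv /= -ltr_norml => /ltW| |]; rewrite ?normrN ger0_norm//.
  by apply: le_lt_trans zt _; rewrite ltrDl.
have mcap : measurable (\bigcap_j F j) by apply: bigcap_measurable => //; exists 0%N.
have nuF : (nu (F 0%N) < +oo)%E by rewrite (le_lt_trans (probability_le1 _ _)) ?ltry.
have ni : nonincreasing_seq F.
  move=> i j ij; apply/subsetPset => z; rewrite /F /= !in_itv /= -!ltr_norml => h.
  apply: lt_le_trans h _; rewrite lerD2l lef_pV2 ?posrE ?ltr0n// ler_nat ltnS//.
have cv := nonincreasing_cvg_mu nuF mF mcap ni.
have lt1' : (nu (\bigcap_j F j) < 1)%E.
  rewrite capE; apply: le_lt_trans (measureU2 nu _ _) _; [exact: measurable_itv|by apply: measurableU; exact: measurable_set1|].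
  have z0 : (nu ([set (- tau0)%R] `|` [set tau0 : R]) <= 0)%E.
    apply: le_trans (measureU2 nu _ _) _; try exact: measurable_set1.
    have -> : (nu [set (- tau0)%R] + nu [set tau0 : R] = 0)%E by rewrite -[RHS](adde0 0%E); congr (_ + _)%E.
    by [].
  by apply: le_lt_trans lt1; rewrite -[leRHS]adde0; exact: leeD.
have fcv : fine (nu (F j)) @[j --> \oo] --> fine (nu (\bigcap_j F j)).
  by apply: fine_cvg; rewrite fineK// fin_num_measure.
have fl1 : fine (nu (\bigcap_j F j)) < 1 by rewrite -lte_fin fineK// fin_num_measure.
have [j _ Hj] := cvgr_lt _ fcv _ fl1.
exists (tau0 + j.+1%:R^-1); first by rewrite ltrDl invr_gt0.
exact: (Hj j (leqnn j)).
Qed.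

End power.

(** * Expansion of the BFDR threshold *)

Section threshold.
Context {R : realType} (nu : probability (measurableTypeR R) R) (sigma : R).
Hypotheses (sigma0 : 0 < sigma).
Variable (n : nat -> nat).
Hypotheses (hn : forall m, (0 < n m)%N) (noo : (n m)%:R @[m --> \oo] --> (+oo : set_system R)).
Local Notation sN m := (Num.sqrt (n m)%:R : R).
Local Notation k m := (sN m / sigma).
Variables (al F cB : nat -> R) (aloo C0 T0 : R).
Hypotheses (hal : forall m, 0 < al m < 1) (hF : forall m, 0 < F m) (hcB : forall m, 0 < cB m).
Hypothesis haloo : aloo < 1.
Hypothesis alcvg : al m @[m --> \oo] --> aloo.
Hypothesis Faloo : F m / al m @[m --> \oo] --> +oo.
Let ell m := ln (F m / al m).
Hypothesis ellN : ell m / (n m)%:R @[m --> \oo] --> C0.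
Hypothesis hT0 : T0 = sigma * Num.sqrt (2 * C0).
Hypothesis nuT0 : (nu `](- T0)%R, T0[%classic < 1)%E.
Hypotheses (nl : nu [set - T0] = 0%E) (nr : nu [set T0] = 0%E).
Let t2 m := accept nu (k m) (- cB m) (cB m).
(* [BFDR = al] with type I error [2 * tail (cB m)], cleared of denominators. *)
Hypothesis bfdrE : forall m, F m * (2 * tail (cB m)) * (1 - al m) = al m * (1 - t2 m).
Let C1 := 1 - fine (nu `]- T0, T0[%classic).
Let P0 : R := (Num.sqrt (pi *+ 2))^-1.

Let al0 m : 0 < al m. Proof. by have /andP[] := hal m. Qed.
Let al1 m : 0 < 1 - al m. Proof. by have /andP[_ h] := hal m; rewrite subr_gt0. Qed.
Let N0 m : 0 < (n m)%:R :> R. Proof. by rewrite ltr0n. Qed.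
Let sN0 m : 0 < sN m. Proof. exact: sN_gt0. Qed.
Let Fal0 m : 0 < F m / al m. Proof. by rewrite divr_gt0. Qed.

Lemma P0_gt0 : 0 < P0.
Proof. by rewrite invr_gt0 sqrtr_gt0 mulrn_wgt0// pi_gt0. Qed.

Lemma ell_oo : ell m @[m --> \oo] --> +oo.
Proof.
apply/cvgryPgt => A; near=> m.
rewrite -ltr_expR /ell lnK ?posrE//; near: m; exact: near_gt_oo.
Unshelve. all: by end_near. Qed.

Lemma C0_ge0 : 0 <= C0.
Proof.
apply: (cvgr_to_ge ellN); near=> m.
by rewrite divr_ge0 ?ltW//; near: m; exact: near_gt_oo ell_oo.
Unshelve. all: by end_near. Qed.

Lemma tail_bfdr m : 2 * tail (cB m) = (1 - t2 m) / (1 - al m) / (F m / al m).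
Proof.
have := bfdrE m; have := al0 m; have := al1 m; have := hF m => F0 a1 a0 h.
have -> : 2 * tail (cB m) = F m * (2 * tail (cB m)) * (1 - al m) / (F m * (1 - al m)).
  by field; rewrite !gt_eqF.
by rewrite h; field; rewrite !gt_eqF.
Qed.

Lemma type2_lt1 m : 0 < 1 - t2 m.
Proof.
have := tail_gt0 (cB m) => t0.
have : 0 < al m * (1 - t2 m) by rewrite -bfdrE mulr_gt0// mulr_gt0// mulr_gt0.
by rewrite pmulr_rgt0.
Qed.

(** The power is at most 1 and 1 - alpha stays away from 0, so the BFDR equation forces the type I
    error to vanish. *)
Lemma threshold_oo : cB m @[m --> \oo] --> +oo.
Proof.
have tc : tail (cB m) @[m --> \oo] --> (0 : R).
  apply: (@squeeze_cvg0 _ _ (fun m => (1 - al m)^-1 / (F m / al m))).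
    near=> m; rewrite tail_ge0 /=.
    have h := tail_bfdr m; have t0 := tail_ge0 (cB m).
    apply: (@le_trans _ _ (2 * tail (cB m))); first lra.
    rewrite h ler_wpM2r ?invr_ge0 ?(ltW (Fal0 m))// ler_piMl ?invr_ge0 ?(ltW (al1 m))//.
    by have := accept_ge0 nu (k m) (- cB m) (cB m); rewrite -/(t2 m); lra.
  apply: (@cvg_div_oo _ _ _ (1 - aloo)^-1 _ Faloo); apply: cvgV; first by rewrite subr_eq0 gt_eqF.
  by apply: cvgB => //; exact: cvg_cst.
apply/cvgryPgt => A; near=> m.
rewrite ltNge; apply/negP => /tail_nincr.
by apply/negP; rewrite -ltNge; near: m; apply: (cvgr_lt _ tc); exact: tail_gt0.
Unshelve. all: by end_near. Qed.

(** Correction factor in Mills' asymptotics, tail c = th * phi c / c; it tends to 1. *)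
Let th m := tail (cB m) * cB m / phi (cB m).

Let th_bounds m : (1 + cB m ^- 2)^-1 <= th m <= 1.
Proof.
have c0 := hcB m; have p0 := phi_gt0 (cB m).
have u := mills_upper c0; have l := mills_lower c0.
have d0 : 0 < 1 + cB m ^- 2 by rewrite addr_gt0// invr_gt0 exprn_gt0.
rewrite /th; apply/andP; split; last by rewrite ler_pdivrMr// mul1r -ler_pdivlMr.
rewrite ler_pdivlMr// ler_pdivrMl//.
by move: l; rewrite ler_pdivrMr// mulrA.
Qed.

Let th_cvg : th m @[m --> \oo] --> (1 : R).
Proof.
have sq : \forall m \near \oo, (1 + cB m ^- 2)^-1 <= th m <= 1.
  by apply: nearW => m; exact: th_bounds.
apply: (squeeze_cvgr sq _ (cvg_cst (1 : R))).
rewrite -[X in _ --> X]invr1; apply: cvgV; first exact: oner_neq0.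
rewrite -[X in _ --> X]addr0; apply: cvgD; first exact: cvg_cst.
apply: (@squeeze_cvg0 _ _ (fun m => (cB m)^-1)); last exact: cvg_inv_oo threshold_oo.
near=> m; have c1 : 1 < cB m by near: m; exact: near_gt_oo threshold_oo.
have c0 := hcB m.
rewrite invr_ge0 exprn_ge0 ?(ltW c0)//= lef_pV2 ?posrE ?exprn_gt0//.
by rewrite ler_eXnr// ltW.
Unshelve. all: by end_near. Qed.

Let W m := ln 2 + ln P0 + ln (th m) + ln (1 - al m).

Let W_cvg : W m @[m --> \oo] --> ln 2 + ln P0 + ln 1 + ln (1 - aloo).
Proof.
apply: cvgD; first by apply: cvgD; [exact: cvg_cst|apply: cvg_ln th_cvg].
apply: cvg_ln; first by rewrite subr_gt0.
by apply: cvgB => //; exact: cvg_cst.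
Qed.

(** Logarithm of the BFDR equation. [W] gathers the terms whose limit follows from c_B -> +oo; the
    power 1 - t2 stays apart, because its limit requires that of c_B^2 / n. *)
Lemma log_bfdr m : cB m ^+ 2 / 2 + ln (cB m) - ell m = W m - ln (1 - t2 m).
Proof.
have c0 := hcB m; have p0 := phi_gt0 (cB m); have t0 := tail_gt0 (cB m).
have th0 : 0 < th m by rewrite divr_gt0// mulr_gt0.
have a1 := al1 m; have t1 := type2_lt1 m; have f0 := Fal0 m; have P00 := P0_gt0.
have e1 : ln (2 * tail (cB m)) = ln (1 - t2 m) - ln (1 - al m) - ell m.
  have d0 : 0 < (1 - t2 m) / (1 - al m) by rewrite divr_gt0.
  rewrite tail_bfdr (@ln_div _ ((1 - t2 m) / (1 - al m)) (F m / al m)) ?posrE//.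
  by rewrite (@ln_div _ (1 - t2 m) (1 - al m)) ?posrE.
have e2 : tail (cB m) = th m * P0 * expR (- (cB m ^+ 2 / 2)) / cB m.
  rewrite /th; have -> : phi (cB m) = P0 * expR (- (cB m ^+ 2 / 2)) by [].
  have := expR_gt0 (- (cB m ^+ 2 / 2)); set E := expR _ => E0.
  by field; rewrite !gt_eqF.
have e3 : ln (2 * tail (cB m)) = ln 2 + (ln (th m) + ln P0 - cB m ^+ 2 / 2 - ln (cB m)).
  have tp := mulr_gt0 th0 P00; have tp' := mulr_gt0 tp (expR_gt0 (- (cB m ^+ 2 / 2))).
  rewrite lnM ?posrE// [in LHS]e2 (@ln_div _ (th m * P0 * _))//.
  by rewrite (@lnM _ (th m * P0) (expR _)) ?posrE ?expR_gt0// (@lnM _ (th m) P0)// expRK.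
by rewrite /W; lra.
Qed.

(** If c_B exceeded v = k tau', then by [tail_shift] the power would be at least of order exp(v^2 /
    2) tail(c_B), while the BFDR equation allows only the order (F / alpha) tail(c_B). The common
    factor tail(c_B) cancels and leaves v^2 / (2 n) <= ell / n + o(1), which is impossible for a
    radius above [T0]. *)
Lemma threshold_upper e : 0 < e -> \forall m \near \oo, cB m ^+ 2 / (n m)%:R <= 2 * C0 + e.
Proof.
move=> e0; have C00 := C0_ge0.
have s20 : 0 <= T0 by rewrite hT0 mulr_ge0// ltW.
have [tau ttau nutau] := exists_radius_lt1 s20 nuT0 nl nr.
(* Being at most [tau] leaves positive mass outside the interval, being at most sigma sqrt(2 C0 + e)
   yields the claimed bound, and being above [T0] creates the contradictory gap. *)
pose tau' := Num.min tau (sigma * Num.sqrt (2 * C0 + e)).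
have sq : Num.sqrt (2 * C0) < Num.sqrt (2 * C0 + e) by rewrite ltr_sqrt; lra.
have tt' : T0 < tau' by rewrite lt_min ttau hT0 ltr_pM2l.
have tau'0 : 0 < tau' by exact: le_lt_trans tt'.
have q0 : 0 < 1 - fine (nu `]- tau', tau'[%classic).
  rewrite subr_gt0; apply: le_lt_trans nutau; apply: fine_prob_le; try exact: measurable_itv.
  have tt : tau' <= tau by rewrite ge_min lexx.
  by move=> z /=; rewrite !in_itv /= => /andP[h1 h2]; apply/andP; split; lra.
set q := 1 - _ in q0.
have gap : C0 < (tau' / sigma) ^+ 2 / 2.
  have h1 : Num.sqrt (2 * C0) < tau' / sigma by rewrite ltr_pdivlMr// mulrC -hT0.
  have : Num.sqrt (2 * C0) ^+ 2 < (tau' / sigma) ^+ 2.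
    by rewrite ltrXn2r ?nnegrE// divr_ge0// ltW.
  by rewrite sqr_sqrtr; lra.
have lim : (ln 4 - ln q) / (n m)%:R + ell m / (n m)%:R @[m --> \oo] --> 0 + C0.
  by apply: cvgD => //; exact: cvg_div_oo (cvg_cst _) noo.
rewrite add0r in lim.
near=> m.
have n0 := N0 m; have s0 := sN0 m; have c0 := hcB m; have a0 := al0 m.
have k0 : 0 < k m by rewrite divr_gt0.
have cv : cB m <= k m * tau'.
  rewrite leNgt; apply/negP => vc.
  set v := k m * tau' in vc; have v0 : 0 < v by rewrite mulr_gt0.
  have h1 := power_lower nu k0 c0 (ltW tau'0).
  have h2 := tail_shift (cB m) (ltW v0).
  have h3 : q * (expR (v ^+ 2 / 2) * tail (cB m)) <= 2 * (1 - t2 m).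
    apply: le_trans h1; rewrite -/q -/v ler_wpM2l ?(ltW q0)//.
    apply: le_trans h2; rewrite ler_wpM2r ?tail_ge0// ler_expR.
    have : v * v <= cB m * v by rewrite ler_wpM2r ?ltW.
    by rewrite -expr2; lra.
  have h4 : 2 * (1 - t2 m) <= 4 * (F m / al m) * tail (cB m).
    have -> : 2 * (1 - t2 m) = 4 * (F m / al m) * tail (cB m) * (1 - al m).
      have := bfdrE m => E; have -> : 1 - t2 m = al m * (1 - t2 m) / al m by field; rewrite gt_eqF.
      by rewrite -E; field; rewrite gt_eqF.
    have h0 : 0 <= 4 * (F m / al m) * tail (cB m).
      by rewrite mulr_ge0 ?tail_ge0// mulr_ge0// ltW.
    by rewrite ler_piMr//; lra.
  have h5 : q * expR (v ^+ 2 / 2) <= 4 * (F m / al m).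
    rewrite -(ler_pM2r (tail_gt0 (cB m))); apply: le_trans h4.
    by rewrite -mulrA.
  have h6 : ln q + v ^+ 2 / 2 <= ln 4 + ell m.
    have E : expR (v ^+ 2 / 2) > 0 by exact: expR_gt0.
    have := Fal0 m => fa.
    rewrite -[X in _ + X <= _](expRK (v ^+ 2 / 2)) -!lnM ?posrE//.
    have p1 : 0 < q * expR (v ^+ 2 / 2) by exact: mulr_gt0.
    have p2 : 0 < 4 * (F m / al m) by exact: mulr_gt0.
    by rewrite ler_ln ?posrE.
  have h7 : (tau' / sigma) ^+ 2 / 2 <= (ln 4 - ln q) / (n m)%:R + ell m / (n m)%:R.
    rewrite -mulrDl ler_pdivlMr//.
    have -> : (tau' / sigma) ^+ 2 / 2 * (n m)%:R = v ^+ 2 / 2.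
      rewrite -[X in _ * X](@sqr_sqrtr _ (n m)%:R) ?ler0n// /v; field; rewrite gt_eqF//.
    lra.
  move: h7; apply/negP; rewrite -ltNge; near: m; exact: (cvgr_lt _ lim).
rewrite ler_pdivrMr//.
have tb : tau' <= sigma * Num.sqrt (2 * C0 + e) by rewrite ge_min lexx orbT.
have ck : cB m <= sN m * Num.sqrt (2 * C0 + e).
  apply: le_trans cv _.
  have -> : sN m * Num.sqrt (2 * C0 + e) = k m * (sigma * Num.sqrt (2 * C0 + e)) by field; rewrite gt_eqF.
  by rewrite ler_wpM2l// ltW.
have : cB m ^+ 2 <= (sN m * Num.sqrt (2 * C0 + e)) ^+ 2.
  by rewrite lerXn2r ?nnegrE ?(ltW c0)// mulr_ge0// ltW.
by rewrite exprMn !sqr_sqrtr ?ler0n// ?[_ * (_ + _)]mulrC//; lra.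
Unshelve. all: by end_near. Qed.

Lemma threshold_sqr : cB m ^+ 2 / (n m)%:R @[m --> \oo] --> 2 * C0.
Proof.
have C00 := C0_ge0.
apply: squeeze_eps => e e0.
  exists (fun=> 2 * C0 + e), (2 * C0 + e); split => //; last exact: cvg_cst.
  exact: threshold_upper.
pose B := Num.sqrt (2 * C0 + 1).
exists (fun m => 2 * (ell m / (n m)%:R) - 2 * (B / sN m) + 2 * (W m / (n m)%:R)).
exists (2 * C0 - 2 * 0 + 2 * 0); split; last by lra.
  near=> m.
  have n0 := N0 m; have s0 := sN0 m; have c0 := hcB m.
  have up : cB m ^+ 2 / (n m)%:R <= 2 * C0 + 1 by near: m; exact: threshold_upper.
  have h := log_bfdr m.
  have l1 : ln (1 - t2 m) <= 0.
    apply: ln_le0; have := accept_ge0 nu (k m) (- cB m) (cB m).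
    by rewrite -/(t2 m); lra.
  have l2 : ln (cB m) <= cB m.
    exact: ln_le_id.
  have cb : cB m <= B * sN m.
    have h2 : cB m ^+ 2 <= (B * sN m) ^+ 2.
      by rewrite exprMn !sqr_sqrtr ?ler0n -?ler_pdivrMr//; lra.
    have bs : 0 <= B * sN m by rewrite mulr_ge0 ?sqrtr_ge0.
    by move: h2; rewrite ler_sqr ?nnegrE ?(ltW c0).
  have -> : 2 * (ell m / (n m)%:R) - 2 * (B / sN m) + 2 * (W m / (n m)%:R) =
     (2 * ell m - 2 * (B * sN m) + 2 * W m) / (n m)%:R.
    have -> : (n m)%:R = sN m ^+ 2 by rewrite sqr_sqrtr ?ler0n.
    rewrite sqrtr_sqr gtr0_norm//; by field; rewrite gt_eqF.
  by rewrite ler_pM2r ?invr_gt0//; lra.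
apply: cvgD; first apply: cvgB.
- by apply: cvgM => //; exact: cvg_cst.
- by apply: cvgM; [exact: cvg_cst|exact: (cvg_div_oo (cvg_cst B) (sN_oo hn noo))].
- by apply: cvgM; [exact: cvg_cst|exact: cvg_div_oo W_cvg noo].
Unshelve. all: by end_near. Qed.

Lemma type2_cvg : t2 m @[m --> \oo] --> fine (nu `]- T0, T0[%classic).
Proof.
apply: (@accept_cvg_sqrt _ nu sigma sigma0 n hn noo cB (2 * C0)) => //.
- by rewrite mulr_ge0// C0_ge0.
- exact: threshold_oo.
- exact: threshold_sqr.
Qed.

Lemma C1_gt0 : 0 < C1.
Proof.
by rewrite subr_gt0 -lte_fin fineK// fin_num_measure//; exact: measurable_itv.
Qed.

Let w m := cB m ^+ 2 / 2 + ln (cB m) - ell m.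

Let w_cvg : w m @[m --> \oo] --> ln 2 + ln P0 + ln 1 + ln (1 - aloo) - ln C1.
Proof.
have -> : w = (fun m => W m - ln (1 - t2 m)) by apply/funext => m; exact: log_bfdr.
apply: cvgB; [exact: W_cvg|apply: cvg_ln; first exact: C1_gt0].
by apply: cvgB; [exact: cvg_cst|exact: type2_cvg].
Qed.

(** Since [w] converges, c_B^2 / 2 and [ell] differ only by ln c_B and a bounded term, both
    negligible against c_B^2. *)
Lemma threshold_ell : cB m ^+ 2 / (2 * ell m) @[m --> \oo] --> (1 : R).
Proof.
have h : 1 + 2 * (ln (cB m) / cB m ^+ 2) - 2 * (w m / cB m ^+ 2) @[m --> \oo] --> 1 + 2 * (0:R) - 2 * 0.
  have c2oo : cB m ^+ 2 @[m --> \oo] --> +oo.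
    apply/cvgryPgt => A; near=> m.
    have c1 : 1 < cB m by near: m; exact: near_gt_oo threshold_oo.
    have cA : A < cB m by near: m; exact: near_gt_oo threshold_oo.
    apply: lt_le_trans cA _; rewrite ler_eXnr// ltW//.
  apply: cvgB; first apply: cvgD; first exact: cvg_cst.
    apply: cvgM; first exact: cvg_cst.
    apply: (@squeeze_cvg0 _ _ (fun m => (cB m)^-1)); last exact: cvg_inv_oo threshold_oo.
    near=> m; have c1 : 1 < cB m by near: m; exact: near_gt_oo threshold_oo.
    have c0 := hcB m.
    have l2 : ln (cB m) <= cB m.
      exact: ln_le_id.
    rewrite divr_ge0 ?sqr_ge0 ?ln_ge0 ?(ltW c1)//=.
    rewrite ler_pdivrMr ?exprn_gt0// expr2 mulrA mulVf ?gt_eqF// mul1r//.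
  by apply: cvgM; [exact: cvg_cst|exact: cvg_div_oo w_cvg c2oo].
have {}h : (1 + 2 * (ln (cB m) / cB m ^+ 2) - 2 * (w m / cB m ^+ 2))^-1 @[m --> \oo] --> (1 : R).
  have E : 1 + 2 * (0 : R) - 2 * 0 = 1 by lra.
  rewrite E in h; rewrite -[X in _ --> X]invr1; apply: cvgV => //; exact: oner_neq0.
apply: cvg_trans h; apply: near_eq_cvg; near=> m.
have l0 : 0 < ell m by near: m; exact: near_gt_oo ell_oo.
have c0 := hcB m.
have -> : 1 + 2 * (ln (cB m) / cB m ^+ 2) - 2 * (w m / cB m ^+ 2) = 2 * ell m / cB m ^+ 2.
  by rewrite /w; field; rewrite gt_eqF.
by rewrite invf_div.
Unshelve. all: by end_near. Qed.

Lemma threshold_expansion :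
  cB m ^+ 2 - (2 * ell m - ln (2 * ell m) + 2 * ln (Num.sqrt 2 * (1 - aloo) / (Num.sqrt pi * C1)))
    @[m --> \oo] --> (0 : R).
Proof.
set K := ln (_ / _).
have KE : K = ln 2 + ln P0 + ln 1 + ln (1 - aloo) - ln C1.
  have s2 : 0 < Num.sqrt 2 :> R by rewrite sqrtr_gt0.
  have sp : 0 < Num.sqrt pi :> R by rewrite sqrtr_gt0 pi_gt0.
  have a1 : 0 < 1 - aloo by rewrite subr_gt0.
  have c1 := C1_gt0.
  have P0E : P0 = (Num.sqrt pi * Num.sqrt 2)^-1.
    by rewrite /P0 -sqrtrM ?pi_ge0// mulr_natr.
  have p0 := P0_gt0; have q2 : 0 < 2 :> R by [].
  have pa := mulr_gt0 p0 a1; have pb := mulr_gt0 q2 pa.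
  have -> : K = ln (2 * (P0 * (1 - aloo)) / C1).
    congr ln; rewrite P0E -[in RHS](@sqr_sqrtr _ 2)//.
    by rewrite sqrtr_sqr (gtr0_norm s2); field; rewrite !gt_eqF.
  rewrite (@ln_div _ (2 * (P0 * (1 - aloo))) C1)// (@lnM _ 2 (P0 * _))// (@lnM _ P0)//.
  by rewrite ln1; ring.
(* 2 w is c^2 + ln(c^2) - 2 ell; subtracting ln(c^2 / (2 ell)), which tends to 0, replaces ln(c^2)
   by ln(2 ell) as the expansion requires. *)
have h : 2 * w m - ln (cB m ^+ 2 / (2 * ell m)) - 2 * K @[m --> \oo] --> (0 : R).
  have -> : 0 = 2 * (ln 2 + ln P0 + ln 1 + ln (1 - aloo) - ln C1) - ln 1 - 2 * K :> R.
    by rewrite KE ln1; lra.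
  apply: cvgB; last exact: cvg_cst.
  apply: cvgB; first by apply: cvgM; [exact: cvg_cst|exact: w_cvg].
  by apply: cvg_ln => //; exact: threshold_ell.
apply: cvg_trans h; apply: near_eq_cvg; near=> m.
have l0 : 0 < ell m by near: m; exact: near_gt_oo ell_oo.
have c0 := hcB m.
rewrite ln_div ?posrE ?exprn_gt0 ?mulr_gt0// lnXn// /w -mulr_natl.
lra.
Unshelve. all: by end_near. Qed.

End threshold.

(** * Logarithms and exponentials along divergent sequences *)

Section sequences.
Context {R : realType}.
Implicit Types u v : nat -> R.

Lemma ln_oo u : u m @[m --> \oo] --> +oo -> ln (u m) @[m --> \oo] --> +oo.
Proof.
move=> uoo; apply/cvgryPgt => A; near=> m.
have u0 : 0 < u m by near: m; exact: near_gt_oo.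
by rewrite -ltr_expR lnK ?posrE//; near: m; exact: near_gt_oo.
Unshelve. all: by end_near. Qed.

(** ln u = 2 ln(sqrt u) <= 2 sqrt u. *)
Lemma ln_div_id_cvg0 u : u m @[m --> \oo] --> +oo -> ln (u m) / u m @[m --> \oo] --> (0 : R).
Proof.
move=> uoo; apply: (@squeeze_cvg0 _ _ (fun m => 2 * (Num.sqrt (u m))^-1)); last first.
  rewrite -[X in _ --> X](mulr0 2); apply: cvgM; first exact: cvg_cst.
  by apply: cvg_inv_oo; exact: sqrt_oo.
near=> m.
have u1 : 1 < u m by near: m; exact: near_gt_oo.
have u0 : 0 < u m by lra.
have s0 : 0 < Num.sqrt (u m) by rewrite sqrtr_gt0.
rewrite divr_ge0 ?ln_ge0 ?(ltW u1) ?(ltW u0)//= ler_pdivrMr//.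
have E : u m = Num.sqrt (u m) ^+ 2 by rewrite sqr_sqrtr// (ltW u0).
have -> : 2 / Num.sqrt (u m) * u m = 2 * Num.sqrt (u m).
  by rewrite {2}E; field; rewrite gt_eqF.
rewrite [X in ln X]E lnXn//.
by have := ln_le_id s0; lra.
Unshelve. all: by end_near. Qed.

Lemma expR_Noo u : u m @[m --> \oo] --> -oo -> expR (u m) @[m --> \oo] --> (0 : R).
Proof.
move=> uoo; have -> : (fun m => expR (u m)) = (fun m => (expR (- u m))^-1).
  by apply/funext => m; rewrite expRN invrK.
apply: cvg_inv_oo; apply/cvgryPgt => A; near=> m.
apply: (@lt_le_trans _ _ (1 + (- u m))); last exact: expR_ge1Dx.
have : u m < - A by near: m; move/cvgrNyPlt : uoo; exact.
by lra.
Unshelve. all: by end_near. Qed.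

Lemma ln_Noo u : (\forall m \near \oo, 0 < u m) -> u m @[m --> \oo] --> (0 : R) ->
  ln (u m) @[m --> \oo] --> -oo.
Proof.
move=> up u0; apply/cvgrNyPlt => A; near=> m.
have um : 0 < u m by near: m.
rewrite -ltr_expR lnK ?posrE//; near: m; apply: (cvgr_lt _ u0).
exact: expR_gt0.
Unshelve. all: by end_near. Qed.

Lemma cvgD_Noo u v (l : R) : u m @[m --> \oo] --> -oo -> v m @[m --> \oo] --> l ->
  u m + v m @[m --> \oo] --> -oo.
Proof.
move=> uoo vl; apply/cvgrNyPlt => A; near=> m.
have h1 : u m < A - (l + 1) by near: m; move/cvgrNyPlt : uoo; exact.
have h2 : v m < l + 1 by near: m; apply: (cvgr_lt _ vl); rewrite ltrDl.
by lra.
Unshelve. all: by end_near. Qed.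

End sequences.

(** * Comparison of the risks *)

Section risk_comparison.
Context {R : realType}.
(* [y = delta * alpha / s] and [b = (1 - t2) / (1 - alpha)] in the application,
   where [E] below is the risk of the BFDR rule in units of the oracle rate [s]. *)
Variables (N L ell c t2 b y : nat -> R) (C C0 kap boo nuT0 : R).
Hypotheses (N0 : forall m, 0 < N m) (Noo : N m @[m --> \oo] --> +oo).
Hypotheses (kap0 : 0 < kap) (boo0 : 0 < boo).
Hypotheses (Loo : L m @[m --> \oo] --> +oo) (LN : L m / N m @[m --> \oo] --> C).
Hypotheses (elloo : ell m @[m --> \oo] --> +oo) (ellN : ell m / N m @[m --> \oo] --> C0).
Hypotheses (c0 : forall m, 0 < c m)
  (cell : c m ^+ 2 / (2 * ell m) @[m --> \oo] --> (1 : R)).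
Hypotheses (b0 : forall m, 0 < b m) (bcvg : b m @[m --> \oo] --> boo).
Hypotheses (t20 : forall m, 0 <= t2 m) (t2cvg : t2 m @[m --> \oo] --> nuT0).
(** Conditional on [C = 2 * C0], because [kap] describes the type II error only of thresholds with
    c^2 / N -> C. Both directions of the criterion first establish this equality. *)
Hypothesis acc : C = 2 * C0 -> t2 m / (c m / Num.sqrt (N m)) @[m --> \oo] --> kap.
Hypothesis nuT : nuT0 <= kap * Num.sqrt C -> 2 * C0 <= C.
(** The contributions of sqrt N to D = exp(L / 2) / sqrt N and to [s] cancel, which ties [y] to [L]
    and [ell] alone. *)
Hypotheses (y0 : \forall m \near \oo, 0 < y m)
  (lny : \forall m \near \oo, ln (y m) = L m / 2 - ell m - ln (L m) / 2).
Let s m := Num.sqrt (L m) / Num.sqrt (N m).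
Let E m := y m * b m + t2 m / s m.

Let sN0 m : 0 < Num.sqrt (N m). Proof. by rewrite sqrtr_gt0. Qed.

Let s_gt0 : \forall m \near \oo, 0 < s m.
Proof.
near=> m; rewrite /s divr_gt0// sqrtr_gt0; near: m; exact: near_gt_oo.
Unshelve. all: by end_near. Qed.

Let scvg : s m @[m --> \oo] --> Num.sqrt C.
Proof.
apply: cvg_trans (cvg_sqrt LN); apply: near_eq_cvg; near=> m.
have L0 : 0 < L m by near: m; exact: near_gt_oo.
by rewrite /s sqrtrM ?(ltW L0)// sqrtrV// (ltW (N0 m)).
Unshelve. all: by end_near. Qed.

Let lnLN : ln (L m) / N m @[m --> \oo] --> (0 : R).
Proof.
have : (ln (L m) / L m) * (L m / N m) @[m --> \oo] --> 0 * C.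
  by apply: cvgM => //; exact: ln_div_id_cvg0.
rewrite mul0r; apply: cvg_trans; apply: near_eq_cvg; near=> m.
have L0 : 0 < L m by near: m; exact: near_gt_oo.
by field; rewrite !gt_eqF.
Unshelve. all: by end_near. Qed.

Let t2_scaled : C = 2 * C0 -> 2 * ell m / L m @[m --> \oo] --> (1 : R) ->
  t2 m / s m @[m --> \oo] --> kap.
Proof.
move=> CE h.
have : t2 m / (c m / Num.sqrt (N m)) * Num.sqrt (c m ^+ 2 / (2 * ell m) * (2 * ell m / L m))
    @[m --> \oo] --> kap * Num.sqrt (1 * 1).
  by apply: cvgM; [exact: acc|apply: cvg_sqrt; exact: cvgM].
rewrite mulr1 sqrtr1 mulr1; apply: cvg_trans; apply: near_eq_cvg; near=> m.
have L0 : 0 < L m by near: m; exact: near_gt_oo.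
have e0 : 0 < ell m by near: m; exact: near_gt_oo.
have cm := c0 m; have sm := sN0 m.
have -> : c m ^+ 2 / (2 * ell m) * (2 * ell m / L m) = c m ^+ 2 / L m.
  by field; rewrite !gt_eqF.
have l0 : 0 < Num.sqrt (L m) by rewrite sqrtr_gt0.
rewrite sqrtrM ?sqr_ge0// sqrtrV ?(ltW L0)// sqrtr_sqr gtr0_norm// /s.
by field; rewrite !gt_eqF.
Unshelve. all: by end_near. Qed.

Let y_bounded : E m @[m --> \oo] --> kap ->
  \forall m \near \oo, y m <= 2 * (kap + 1) / boo.
Proof.
move=> EK; near=> m.
have bm : boo / 2 < b m by near: m; apply: (cvgr_gt _ bcvg); rewrite ltr_pdivrMr// ltr_pMr// ltr1n.
have Em : E m < kap + 1 by near: m; apply: (cvgr_lt _ EK); rewrite ltrDl.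
have sm : 0 < s m by near: m.
have t2s : 0 <= t2 m / s m by rewrite divr_ge0// ltW.
have ym : 0 < y m by near: m.
have yb : y m * (boo / 2) <= y m * b m by rewrite ler_pM2l// ltW.
rewrite ler_pdivlMr//; move: Em; rewrite /E; lra.
Unshelve. all: by end_near. Qed.

(** Logarithm of [y_bounded]: as [b] has a positive limit, a bounded [E] bounds [y], and [lny] turns
    this into a bound on [L]. *)
Let L_upper : E m @[m --> \oo] --> kap ->
  \forall m \near \oo, L m <= 2 * ell m + ln (L m) + 2 * ln (2 * (kap + 1) / boo).
Proof.
move=> EK; near=> m.
have h : ln (y m) = L m / 2 - ell m - ln (L m) / 2 by near: m.
have M0 : 0 < 2 * (kap + 1) / boo by rewrite divr_gt0// mulr_gt0// addr_gt0.
have ym : 0 < y m by near: m.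
have : ln (y m) <= ln (2 * (kap + 1) / boo).
  by rewrite ler_ln ?posrE//; near: m; exact: y_bounded.
by rewrite h; lra.
Unshelve. all: by end_near. Qed.

Lemma optimal_exponent : E m @[m --> \oo] --> kap -> C = 2 * C0.
Proof.
move=> EK; apply/eqP; rewrite eq_le; apply/andP; split; last first.
  (* In the limit t2 <= E s reads nuT0 <= kap sqrt C, the premise of [nuT]. *)
  have tE : t2 m / s m * s m @[m --> \oo] --> nuT0.
    apply: cvg_trans t2cvg; apply: near_eq_cvg; near=> m.
    by have sm : 0 < s m; [near: m|rewrite divfK ?gt_eqF].
  apply: nuT; apply: ler_cvg_to tE (cvgM EK scvg) _; near=> m.
  have sm : 0 < s m by near: m.
  have ym : 0 < y m by near: m.
  by rewrite ler_pM2r// /E lerDr mulr_ge0// ltW.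
have lim : 2 * (ell m / N m) + ln (L m) / N m + 2 * ln (2 * (kap + 1) / boo) / N m
    @[m --> \oo] --> 2 * C0 + 0 + 0.
  apply: cvgD; last exact: cvg_div_oo (cvg_cst _) Noo.
  by apply: cvgD => //; apply: cvgM => //; exact: cvg_cst.
rewrite !addr0 in lim; apply: ler_cvg_to LN lim _; near=> m.
have n0 := N0 m.
have -> : 2 * (ell m / N m) + ln (L m) / N m + 2 * ln (2 * (kap + 1) / boo) / N m =
  (2 * ell m + ln (L m) + 2 * ln (2 * (kap + 1) / boo)) / N m by field; rewrite gt_eqF.
by rewrite ler_pM2r ?invr_gt0//; near: m; exact: L_upper.
Unshelve. all: by end_near. Qed.

(** The lower bound is [L_upper] divided by [L]. For the upper bound, t2 / s <= E and t2 ~ kap c /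
    sqrt N show that c / sqrt L is at most a quantity tending to 1, and c^2 ~ 2 ell. *)
Let ratio_cvg : E m @[m --> \oo] --> kap -> 2 * ell m / L m @[m --> \oo] --> (1 : R).
Proof.
move=> EK; have CE := optimal_exponent EK.
set K := 2 * ln (2 * (kap + 1) / boo).
have lo : 1 - ln (L m) / L m - K / L m @[m --> \oo] --> (1 : R).
  rewrite -[X in _ --> X]subr0 -[X in _ --> X - _]subr0.
  apply: cvgB; last exact: cvg_div_oo (cvg_cst _) Loo.
  by apply: cvgB; [exact: cvg_cst|exact: ln_div_id_cvg0].
have up : (E m / (t2 m / (c m / Num.sqrt (N m)))) ^+ 2 / (c m ^+ 2 / (2 * ell m)) @[m --> \oo] --> (1 : R).
  have E1 : (kap / kap) ^+ 2 / 1 = 1 :> R by rewrite divff ?gt_eqF// expr1n divr1.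
  rewrite -[X in _ --> X]E1.
  apply: cvgM; last by apply: cvgV => //; exact: oner_neq0.
  have h : E m / (t2 m / (c m / Num.sqrt (N m))) @[m --> \oo] --> kap / kap.
    by apply: cvgM => //; apply: cvgV; [rewrite gt_eqF|exact: acc].
  by rewrite expr2; apply: cvgM.
apply: squeeze_cvgr lo up; near=> m.
have L0 : 0 < L m by near: m; exact: near_gt_oo.
have e0 : 0 < ell m by near: m; exact: near_gt_oo.
have sm : 0 < s m by near: m.
have cm := c0 m; have sn := sN0 m.
have A0 : 0 < t2 m / (c m / Num.sqrt (N m)) by near: m; apply: (cvgr_gt _ (acc CE)).
have t0 : 0 < t2 m by move: A0; rewrite pmulr_lgt0// invr_gt0 divr_gt0.
apply/andP; split.
  have -> : 1 - ln (L m) / L m - K / L m = (L m - ln (L m) - K) / L m by field; rewrite gt_eqF.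
  rewrite ler_pM2r ?invr_gt0//.
  have : L m <= 2 * ell m + ln (L m) + K by near: m; exact: L_upper.
  by lra.
have l0 : 0 < Num.sqrt (L m) by rewrite sqrtr_gt0.
have ym : 0 < y m by near: m.
have tE : t2 m / s m <= E m by rewrite /E lerDr mulr_ge0// ltW.
have q1 : c m / Num.sqrt (L m) <= E m / (t2 m / (c m / Num.sqrt (N m))).
  rewrite ler_pdivlMr//; apply: le_trans tE.
  by rewrite le_eqVlt; apply/orP; left; apply/eqP; rewrite /s; field; rewrite !gt_eqF.
have q0 : 0 <= c m / Num.sqrt (L m) by rewrite divr_ge0// ltW.
have q2 : (c m / Num.sqrt (L m)) ^+ 2 <= (E m / (t2 m / (c m / Num.sqrt (N m)))) ^+ 2.
  by rewrite ler_sqr ?nnegrE// (le_trans q0).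
have d0 : 0 < c m ^+ 2 / (2 * ell m) by rewrite divr_gt0 ?exprn_gt0 ?mulr_gt0.
rewrite ler_pdivlMr//; apply: le_trans q2.
rewrite expr_div_n sqr_sqrtr ?(ltW L0)//.
by rewrite le_eqVlt; apply/orP; left; apply/eqP; field; rewrite !gt_eqF.
Unshelve. all: by end_near. Qed.

Let half_ratio : L m / 2 / ell m @[m --> \oo] --> (1 : R) <-> 2 * ell m / L m @[m --> \oo] --> (1 : R).
Proof.
have one := oner_neq0 R.
split => h.
  have {}h : (L m / 2 / ell m)^-1 @[m --> \oo] --> (1 : R) by rewrite -[X in _ --> X]invr1; exact: cvgV.
  apply: cvg_trans h; apply: near_eq_cvg; near=> m.
  have L0 : 0 < L m by near: m; exact: near_gt_oo.
  have e0 : 0 < ell m by near: m; exact: near_gt_oo.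
  by rewrite /=; field; rewrite !gt_eqF.
have {}h : (2 * ell m / L m)^-1 @[m --> \oo] --> (1 : R) by rewrite -[X in _ --> X]invr1; exact: cvgV.
apply: cvg_trans h; apply: near_eq_cvg; near=> m.
have L0 : 0 < L m by near: m; exact: near_gt_oo.
have e0 : 0 < ell m by near: m; exact: near_gt_oo.
by rewrite /=; field; rewrite !gt_eqF.
Unshelve. all: by end_near. Qed.

Lemma risk_ratio_criterion : E m @[m --> \oo] --> kap <->
  (L m / 2 / ell m @[m --> \oo] --> (1 : R)) /\
  (L m - 2 * ell m - ln (ell m) @[m --> \oo] --> -oo).
Proof.
(* The second condition is the divergence of 2 ln y in disguise: the remainder ln(L / ell) tends to
   ln 2 under the first condition. *)
have zE : \forall m \near \oo, L m - 2 * ell m - ln (ell m) = 2 * ln (y m) + ln (L m / ell m).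
  near=> m.
  have L0 : 0 < L m by near: m; exact: near_gt_oo.
  have e0 : 0 < ell m by near: m; exact: near_gt_oo.
  have h : ln (y m) = L m / 2 - ell m - ln (L m) / 2 by near: m.
  by rewrite ln_div ?posrE// h; lra.
have lnr : 2 * ell m / L m @[m --> \oo] --> (1 : R) -> ln (L m / ell m) @[m --> \oo] --> ln 2.
  move=> /half_ratio h; apply: cvg_ln => //.
  have {}h : 2 * (L m / 2 / ell m) @[m --> \oo] --> 2 * (1 : R) by apply: cvgM => //; exact: cvg_cst.
  rewrite mulr1 in h; apply: cvg_trans h; apply: near_eq_cvg; near=> m.
  have e0 : 0 < ell m by near: m; exact: near_gt_oo.
  by rewrite /=; field; rewrite gt_eqF.
split => [EK|[/half_ratio r1 z1]].
  have r1 := ratio_cvg EK; split; first exact/half_ratio.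
  have CE := optimal_exponent EK.
  (* The type II part t2 / s alone already tends to [kap], so the type I part y b must vanish. *)
  have y0' : y m @[m --> \oo] --> (0 : R).
    have h : (E m - t2 m / s m) / b m @[m --> \oo] --> (kap - kap) / boo.
      apply: cvgM; first by apply: cvgB => //; exact: t2_scaled.
      by apply: cvgV => //; rewrite gt_eqF.
    rewrite subrr mul0r in h; apply: cvg_trans h; apply: near_eq_cvg; near=> m.
    by rewrite /E addrK mulfK// gt_eqF.
  have ly : ln (y m) @[m --> \oo] --> -oo by exact: ln_Noo.
  have h : 2 * ln (y m) @[m --> \oo] --> -oo.
    apply/cvgrNyPlt => A; near=> m.
    have : ln (y m) < A / 2 by near: m; move/cvgrNyPlt : ly; exact.
    by lra.
  have {}h := cvgD_Noo h (lnr r1); apply: cvg_trans h; apply: near_eq_cvg; near=> m.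
  by apply/esym; near: m.
have CE : C = 2 * C0.
  have h : L m / 2 / ell m * (2 * (ell m / N m)) @[m --> \oo] --> 1 * (2 * C0).
    by apply: cvgM; [exact/half_ratio|apply: cvgM => //; exact: cvg_cst].
  rewrite mul1r in h; apply: (cvg_unique _ LN) => //.
  apply: cvg_trans h; apply: near_eq_cvg; near=> m.
  have e0 : 0 < ell m by near: m; exact: near_gt_oo.
  have n0 := N0 m.
  by field; rewrite !gt_eqF.
have ly : ln (y m) @[m --> \oo] --> -oo.
  have h : L m - 2 * ell m - ln (ell m) - ln (L m / ell m) @[m --> \oo] --> -oo.
    by apply: cvgD_Noo z1 _; apply: cvgN; exact: lnr.
  apply/cvgrNyPlt => A; near=> m.
  have : L m - 2 * ell m - ln (ell m) - ln (L m / ell m) < 2 * A.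
    by near: m; move/cvgrNyPlt : h; exact.
  have -> : L m - 2 * ell m - ln (ell m) = 2 * ln (y m) + ln (L m / ell m) by near: m.
  by lra.
have yz : y m @[m --> \oo] --> (0 : R).
  apply: cvg_trans (expR_Noo ly); apply: near_eq_cvg; near=> m.
  have ym : 0 < y m by near: m.
  by rewrite lnK.
rewrite -[X in _ --> X]add0r; apply: cvgD; last exact: t2_scaled.
by rewrite -(mul0r boo); apply: cvgM.
Unshelve. all: by end_near. Qed.

End risk_comparison.

(** * Rates under assumption (A) and the criterion for risk ratios *)

Section optimality.
Context {R : realType} (nu : probability (measurableTypeR R) R) (sigma C : R).
Hypotheses (sigma0 : 0 < sigma) (C_ge0 : 0 <= C) (hC : assumptionC nu sigma C).
Variable (n : nat -> nat).
Hypotheses (hn : forall m, (0 < n m)%N) (noo : (n m)%:R @[m --> \oo] --> (+oo : set_system R)).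
Local Notation sN m := (Num.sqrt (n m)%:R : R).
Local Notation k m := (sN m / sigma).
Variables (D : nat -> R) (Dlim : \bar R).
Hypotheses (D0 : forall m, 0 < D m) (Dlim0 : (0 < Dlim)%E)
  (Dcvg : (D m)%:E @[m --> \oo] --> Dlim) (DN : 2 * ln (D m) / (n m)%:R @[m --> \oo] --> C).
Let L m := 2 * ln (D m * sN m).

Let N0 m : 0 < (n m)%:R :> R. Proof. by rewrite ltr0n. Qed.
Let sN0 m : 0 < sN m. Proof. exact: sN_gt0. Qed.

(** A limit in ]0, +oo] keeps f delta above a positive constant, so that D sqrt n diverges whether
    or not D is bounded. *)
Let D_low : exists2 e : R, 0 < e & \forall m \near \oo, e < D m.
Proof.
have [e e0 eD] : exists2 e : R, 0 < e & (e%:E < Dlim)%E.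
  move: Dlim0; case: (Dlim) => [r| |] //; last by exists 1 => //; rewrite ltry.
  by rewrite lte_fin => r0; exists (r / 2); rewrite ?lte_fin; lra.
exists e => //.
have h : nbhs Dlim [set x | (e%:E < x)%E].
  by apply: open_nbhs_nbhs; split; [exact: open_ereal_gt_ereal|].
exact: (Dcvg h).
Qed.

Lemma oracle_exponent_oo : L m @[m --> \oo] --> +oo.
Proof.
have [e e0 eD] := D_low.
have h : D m * sN m @[m --> \oo] --> +oo.
  apply/cvgryPgt => A; near=> m.
  have h1 : `|A| / e < sN m by near: m; apply: near_gt_oo; exact: sN_oo.
  apply: (@le_lt_trans _ _ `|A|); first exact: ler_norm.
  have h2 : e < D m by near: m.
  have h3 : `|A| < e * sN m by rewrite mulrC -ltr_pdivrMr.
  by apply: (lt_trans h3); rewrite ltr_pM2r.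
apply/cvgryPgt => A; near=> m.
have : A / 2 < ln (D m * sN m) by near: m; apply: near_gt_oo; exact: ln_oo.
by rewrite /L; lra.
Unshelve. all: by end_near. Qed.

Lemma oracle_exponent_rate : L m / (n m)%:R @[m --> \oo] --> C.
Proof.
have h : 2 * ln (D m) / (n m)%:R + 2 * (ln (sN m) / sN m / sN m) @[m --> \oo] --> C + 2 * 0.
  apply: cvgD => //; apply: cvgM; first exact: cvg_cst.
  by apply: cvg_div_oo (sN_oo hn noo); apply: ln_div_id_cvg0; exact: sN_oo.
rewrite mulr0 addr0 in h; apply: cvg_trans h; apply: near_eq_cvg; near=> m.
have s0 := sN0 m.
rewrite /L lnM ?posrE//.
have -> : (n m)%:R = sN m ^+ 2 :> R by rewrite sqr_sqrtr ?ler0n.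
by rewrite sqrtr_sqr gtr0_norm//; field; rewrite gt_eqF.
Unshelve. all: by end_near. Qed.

Variables (al F cB : nat -> R) (aloo C0 T0 : R).
Hypotheses (hal : forall m, 0 < al m < 1) (hF : forall m, 0 < F m) (hcB : forall m, 0 < cB m).
Hypothesis haloo : aloo < 1.
Hypothesis alcvg : al m @[m --> \oo] --> aloo.
Hypothesis Faloo : F m / al m @[m --> \oo] --> +oo.
Let ell m := ln (F m / al m).
Hypothesis ellN : ell m / (n m)%:R @[m --> \oo] --> C0.
Hypothesis hT0 : T0 = sigma * Num.sqrt (2 * C0).
Hypothesis nuT0 : (nu `](- T0)%R, T0[%classic < 1)%E.
Hypotheses (nl : nu [set - T0] = 0%E) (nr : nu [set T0] = 0%E).
Let t2 m := accept nu (k m) (- cB m) (cB m).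
Hypothesis bfdrE : forall m, F m * (2 * tail (cB m)) * (1 - al m) = al m * (1 - t2 m).
Variable rB : nat -> R.
Hypothesis B1 : \forall m \near \oo, forall c : R, 0 < c ->
  rB m <= D m * (2 * tail c) + accept nu (k m) (- c) c.
Hypothesis B0 : \forall m \near \oo, exists l r : R,
  l < 0 < r /\ rB m = D m * (tail (- l) + tail r) + accept nu (k m) l r.
Let rF m := D m * (2 * tail (cB m)) + t2 m.
Let s m := Num.sqrt (L m) / sN m.
Let y m := D m / (F m / al m) / s m.
Let b m := (1 - t2 m) / (1 - al m).

Let Fal0 m : 0 < F m / al m.
Proof. by rewrite divr_gt0//; case/andP: (hal m). Qed.
Let al1 m : 0 < 1 - al m. Proof. by have /andP[_ h] := hal m; rewrite subr_gt0. Qed.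

Let s_gt0 : \forall m \near \oo, 0 < s m.
Proof.
near=> m; rewrite /s divr_gt0// sqrtr_gt0; near: m; exact: near_gt_oo oracle_exponent_oo.
Unshelve. all: by end_near. Qed.

(** The oracle risk divided by [s] has the positive limit [kap], so a risk ratio tending to 1 means
    that the BFDR risk in the same units tends to [kap]. *)
Let abos_equiv : exists2 kap : R, 0 < kap &
  [/\ (rF m / rB m @[m --> \oo] --> (1 : R)) <-> (y m * b m + t2 m / s m @[m --> \oo] --> kap),
      kap * Num.sqrt C = fine (nu `](- (sigma * Num.sqrt C))%R, (sigma * Num.sqrt C)%R[%classic)
    & C = 2 * C0 -> t2 m / (cB m / sN m) @[m --> \oo] --> kap].
Proof.
have [kap [kap0 kapC acc1 acc2]] := accept_scaled sigma0 C_ge0 hC hn noo.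
have rBs : rB m / s m @[m --> \oo] --> kap.
  exact: (bayes_risk_asymp hn acc1 acc2 D0 oracle_exponent_oo oracle_exponent_rate B1 B0).
have rFE m : rF m / s m = y m * b m + t2 m / s m.
  have te : 2 * tail (cB m) = (1 - t2 m) / (1 - al m) / (F m / al m) by exact: tail_bfdr hal hF bfdrE m.
  by rewrite /rF te /y /b; ring.
exists kap => //; split => //; last first.
  move=> CE; apply: acc1; first exact: (threshold_oo hal hF haloo alcvg Faloo bfdrE).
  rewrite CE; exact: (threshold_sqr sigma0 hn noo hal hF hcB haloo alcvg Faloo ellN hT0 nuT0 nl nr bfdrE).
have -> : (fun m => y m * b m + t2 m / s m) = (fun m => rF m / s m).
  by apply/funext => m; rewrite rFE.
have nz : \forall m \near \oo, s m != 0 /\ rB m != 0.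
  near=> m.
  have sm : 0 < s m by near: m.
  have : 0 < rB m / s m by near: m; apply: (cvgr_gt _ rBs).
  by rewrite pmulr_lgt0 ?invr_gt0// => r0; rewrite !gt_eqF.
split => h.
  have {}h : rF m / rB m * (rB m / s m) @[m --> \oo] --> 1 * kap by exact: cvgM.
  rewrite mul1r in h; apply: cvg_trans h; apply: near_eq_cvg; near=> m.
  by have [h1 h2] : s m != 0 /\ rB m != 0; [near: m|field; apply/andP].
have {}h : rF m / s m / (rB m / s m) @[m --> \oo] --> kap / kap.
  by apply: cvgM => //; apply: cvgV => //; rewrite gt_eqF.
rewrite divff ?gt_eqF// in h; apply: cvg_trans h; apply: near_eq_cvg; near=> m.
by have [h1 h2] : s m != 0 /\ rB m != 0; [near: m|field; apply/andP].
Unshelve. all: by end_near. Qed.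

Lemma risk_ratio_cvg1 :
  ((rF m / rB m @[m --> \oo] --> (1 : R)) <->
    (ln (D m * sN m) / ell m @[m --> \oo] --> (1 : R)) /\
    (2 * ln (D m * sN m / (F m / al m)) - ln (ell m) @[m --> \oo] --> -oo)) /\
  (rF m / rB m @[m --> \oo] --> (1 : R) -> C0 = C / 2).
Proof.
have [kap kap0 [-> kapC acc]] := abos_equiv.
have elloo := ell_oo hal hF Faloo.
have cell := threshold_ell sigma0 hn noo hal hF hcB haloo alcvg Faloo ellN hT0 nuT0 nl nr bfdrE.
have t2cvg := type2_cvg sigma0 hn noo hal hF hcB haloo alcvg Faloo ellN hT0 nuT0 nl nr bfdrE.
have C1 := C1_gt0 nuT0.
have b0 m : 0 < b m by rewrite divr_gt0//; exact: (type2_lt1 hal hF bfdrE).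
have bcvg : b m @[m --> \oo] --> (1 - fine (nu `](- T0)%R, T0[%classic)) / (1 - aloo).
  apply: cvgM; first by apply: cvgB => //; exact: cvg_cst.
  by apply: cvgV; [rewrite subr_eq0 gt_eqF|apply: cvgB => //; exact: cvg_cst].
have boo0 : 0 < (1 - fine (nu `](- T0)%R, T0[%classic)) / (1 - aloo).
  by rewrite divr_gt0// subr_gt0.
have t20 m : 0 <= t2 m by exact: accept_ge0.
have y0 : \forall m \near \oo, 0 < y m.
  near=> m.
  have sm : 0 < s m by near: m.
  by rewrite /y (divr_gt0 (divr_gt0 _ _))//.
have lny : \forall m \near \oo, ln (y m) = L m / 2 - ell m - ln (L m) / 2.
  near=> m.
  have sm : 0 < s m by near: m.
  have L0 : 0 < L m by near: m; exact: near_gt_oo oracle_exponent_oo.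
  have l0 : 0 < Num.sqrt (L m) by rewrite sqrtr_gt0.
  have d0 : 0 < D m / (F m / al m) by rewrite divr_gt0.
  rewrite /y (@ln_div _ (D m / (F m / al m)) (s m)) ?posrE// (@ln_div _ (D m) (F m / al m)) ?posrE//.
  rewrite /s (@ln_div _ (Num.sqrt (L m)) (sN m)) ?posrE//.
  have lL : ln (L m) = 2 * ln (Num.sqrt (L m)).
    by rewrite -[in LHS](@sqr_sqrtr _ (L m)) ?(ltW L0)// lnXn// mulr_natl.
  have LE : L m = 2 * (ln (D m) + ln (sN m)) by rewrite /L lnM ?posrE.
  by rewrite -/(ell m); lra.
(* By contraposition: a radius [T0] above T would capture strictly more mass, as the density is
   positive next to T. *)
have nuT : fine (nu `](- T0)%R, T0[%classic) <= kap * Num.sqrt C -> 2 * C0 <= C.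
  rewrite kapC => h; rewrite leNgt; apply/negP => CC0.
  have TT : sigma * Num.sqrt C < T0 by rewrite hT0 ltr_pM2l// ltr_sqrt// (le_lt_trans C_ge0).
  by move: h; apply/negP; rewrite -ltNge; exact: (prob_sym_lt sigma0 hC).
have crit := risk_ratio_criterion N0 noo kap0 boo0 oracle_exponent_oo oracle_exponent_rate elloo ellN hcB
  cell b0 bcvg t20 t2cvg acc nuT y0 lny.
have expo := optimal_exponent N0 noo kap0 boo0 oracle_exponent_oo oracle_exponent_rate ellN
  b0 bcvg t20 t2cvg nuT y0 lny.
split; last by move/expo; lra.
rewrite crit.
have e1 m : L m / 2 / ell m = ln (D m * sN m) / ell m by congr (_ / _); rewrite /L; lra.
have e2 m : L m - 2 * ell m - ln (ell m) = 2 * ln (D m * sN m / (F m / al m)) - ln (ell m).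
  have ds : 0 < D m * sN m by exact: mulr_gt0.
  by rewrite (@ln_div _ (D m * sN m) (F m / al m)) ?posrE// /L -/(ell m); lra.
by rewrite (funext e1) (funext e2).
Unshelve. all: by end_near. Qed.

End optimality.

(** * The oracle equation as a level of the likelihood ratio *)

Section oracle.
Context {R : realType} (nu : probability (measurableTypeR R) R).

(** With y = k x, k^2 = n / sigma^2, the exponent of the oracle equation becomes that of
    [lik_ratio], and the level is f delta. *)
Lemma oracle_equation_lik_ratio (n : nat) (p d0 dA sigma x : R) : 0 < p -> 0 < dA -> 0 < sigma ->
  oracle_equation n p d0 dA sigma nu x ->
  lik_ratio nu (Num.sqrt n%:R / sigma) (Num.sqrt n%:R / sigma * x) = (1 - p) / p * (d0 / dA).
Proof.
move=> p0 dA0 s0 E.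
have <- : \int[nu]_t expR (n%:R * (x * (t / sigma ^+ 2) - t ^+ 2 / (2 * sigma ^+ 2))) =
  lik_ratio nu (Num.sqrt n%:R / sigma) (Num.sqrt n%:R / sigma * x).
  rewrite /lik_ratio; apply: eq_Rintegral => t _; congr expR.
  rewrite -[in LHS](@sqr_sqrtr _ n%:R) ?ler0n//.
  by field; rewrite gt_eqF.
move: E; rewrite /oracle_equation; set I := \int[_]_(_ in _) _ => E.
have -> : (1 - p) / p * (d0 / dA) = (1 - p) * d0 / (p * dA) by field; rewrite !gt_eqF.
by rewrite E; field; rewrite !gt_eqF.
Qed.

Lemma oracle_interval (k D l r : R) : 0 <= D -> l < 0 < r ->
  lik_ratio nu k l = D -> lik_ratio nu k r = D ->
  D * (1 - std_prob l r) + accept nu k l r = D * (tail (- l) + tail r) + accept nu k l r /\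
  forall c, 0 < c ->
    D * (1 - std_prob l r) + accept nu k l r <= D * (2 * tail c) + accept nu k (- c) c.
Proof.
move=> D0 /andP[l0 r0] El Er; have lr := lt_trans l0 r0.
split=> [|c c0]; first by rewrite std_probE.
have := @lik_ratio_test_optimal _ nu k l r D (- c) c D0 lr El Er.
have cc : - c < c by rewrite gtrN.
have -> : 1 - std_prob (- c) c = 2 * tail c by rewrite std_probE// opprK; lra.
exact.
Qed.

End oracle.

(** The number of tests and the factor p deltaA cancel in the quotient, leaving the risks in the
    normalization with D = f delta. *)
Lemma risk_quotient {R : realFieldType} (M q d0 dA x y u v : R) : 0 < M -> 0 < q -> 0 < dA ->
  M * (d0 * ((1 - q) * x) + dA * (q * y)) / (M * (d0 * ((1 - q) * u) + dA * (q * v))) =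
  ((1 - q) / q * (d0 / dA) * x + y) / ((1 - q) / q * (d0 / dA) * u + v).
Proof.
move=> M0 q0 dA0; have w0 : M * (q * dA) != 0 by rewrite gt_eqF// !mulr_gt0.
have E z w : M * (d0 * ((1 - q) * z) + dA * (q * w)) =
    M * (q * dA) * ((1 - q) / q * (d0 / dA) * z + w) by field; rewrite !gt_eqF.
by rewrite !E -mulf_div divff// mul1r.
Qed.

Lemma cvg_shiftP {R : realType} (u : nat -> R) (l : set_system R) :
  (u m.+1 @[m --> \oo] --> l) <-> (u m @[m --> \oo] --> l).
Proof. by rewrite -(@cvg_shiftS R u l). Qed.

Lemma near_shift (Q : nat -> Prop) : (\forall m \near \oo, Q m) -> \forall m \near \oo, Q m.+1.
Proof. by move=> [N _ H]; exists N => // m /= Nm; apply: H; exact: leqW. Qed.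

Unset Implicit Arguments.

Theorem theorem2p3 (R : realType)
  (sigma : R) (nu : probability (measurableTypeR R) R)
  (hsigma : 0 < sigma)
  (hnu0 : nu [set 0] = 0%E)
  (hnuneg : (0 < nu `]-oo, 0%R[%classic)%E) (hnupos : (0 < nu `]0%R, +oo[%classic)%E)
  (n : nat -> nat) (p delta0 deltaA alpha : nat -> R)
  (hn : forall m, (0 < n m)%N)
  (hp : forall m, 0 < p m < 1)
  (hdelta0 : forall m, 0 < delta0 m) (hdeltaA : forall m, 0 < deltaA m)
  (delta f : nat -> R)
  (hdelta : forall m, delta m = delta0 m / deltaA m)
  (hf : forall m, f m = (1 - p m) / p m)
  (d : nat -> measure_display) (Om : forall m, measurableType (d m))
  (P : forall m, probability (Om m) R)
  (mu : forall m, 'I_m -> {RV (P m) >-> R})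
  (X : forall m, 'I_(n m) -> 'I_m -> {RV (P m) >-> R})
  (hmodel : forall m, two_groups_model (p m) sigma nu (mu m) (X m))
  (a b : nat -> R)
  (hab : \forall m \near \oo,
    [/\ a m < 0 < b m,
        oracle_equation (n m) (p m) (delta0 m) (deltaA m) sigma nu (a m)
      & oracle_equation (n m) (p m) (delta0 m) (deltaA m) sigma nu (b m)])
  (halpha : forall m, 0 < alpha m < 1 - p m)
  (cB : nat -> R)
  (hcB : forall m, 0 < cB m)
  (hBFDR : forall m (i : 'I_m),
    let rej := symmetric_rule sigma (cB m) (X m) i in
    BFDR (p m) (type1_error (P m) (mu m i) rej)
               (type2_error (P m) (mu m i) rej) = alpha m)
  (C : R) (hA : assumptionA n delta f C) (hC : assumptionC nu sigma C)
  (alphaoo : R) (halphaoo : alphaoo < 1)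
  (halphacvg : alpha m @[m --> \oo] --> alphaoo)
  (hfalpha : f m / alpha m @[m --> \oo] --> +oo)
  (C0 : R) (hC0 : ln (f m / alpha m) / (n m)%:R @[m --> \oo] --> C0)
  (T0 : R) (hT0 : T0 = sigma * Num.sqrt (2 * C0))
  (hnuT0 : (nu `](- T0)%R, T0[%classic < 1)%E)
  (hatoml : nu [set - T0] = 0%E) (hatomr : nu [set T0] = 0%E) :
  let C1 := 1 - fine (nu `]- T0, T0[%classic) in
  let T := sigma * Num.sqrt C in
  let riskB m := risk (P m) (delta0 m) (deltaA m) (mu m)
                   (interval_rule (a m) (b m) (X m)) in
  let riskBFDR m := risk (P m) (delta0 m) (deltaA m) (mu m)
                      (symmetric_rule sigma (cB m) (X m)) in
  let ABOS := riskBFDR m / riskB m @[m --> \oo] --> (1 : R) in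
  [/\ cB m ^+ 2
        - (2 * ln (f m / alpha m) - ln (2 * ln (f m / alpha m))
           + 2 * ln (Num.sqrt 2 * (1 - alphaoo) / (Num.sqrt pi * C1)))
        @[m --> \oo] --> (0 : R),
      ABOS <->
        (ln (f m * delta m * Num.sqrt (n m)%:R) / ln (f m / alpha m)
           @[m --> \oo] --> (1 : R)) /\
        (2 * ln (alpha m * delta m * Num.sqrt (n m)%:R)
           - ln (ln (f m / alpha m)) @[m --> \oo] --> -oo)
    & ABOS -> C0 = C / 2 /\ C1 = 1 - fine (nu `]- T, T[%classic)].
Proof.
move=> C1 T riskB riskBFDR ABOS.
have p0 m : 0 < p m by case/andP: (hp m).
have p1 m : 0 < 1 - p m by case/andP: (hp m) => _; rewrite subr_gt0.
have f0 m : 0 < f m by rewrite hf divr_gt0.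
have de0 m : 0 < delta m by rewrite hdelta divr_gt0.
have al0 m : 0 < alpha m by case/andP: (halpha m).
have al1 m : 0 < alpha m < 1.
  by rewrite al0; case/andP: (halpha m) => _ h; have := p0 m; lra.
have [noo [Dlim Dlim0 Dcvg] DN C_ge0] := hA.
have nroo : (n m)%:R @[m --> \oo] --> (+oo : set_system R).
  exact: cvg_comp noo (@cvgr_idn R).
pose k m := Num.sqrt (n m)%:R / sigma.
pose t2 m := accept nu (k m) (- cB m) (cB m).
(* The errors do not depend on the test, so the first one is used. Positivity of the tail makes the
   denominator of [BFDR] positive, which allows clearing it. *)
have bfdrE m : f m.+1 * (2 * tail (cB m.+1)) * (1 - alpha m.+1) = alpha m.+1 * (1 - t2 m.+1).
  have := hBFDR m.+1 ord0; rewrite /=.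
  rewrite (type1_error_symmetric (hn _) (hp _) hsigma (hmodel _) hnu0 _ (hcB _)).
  rewrite (type2_error_symmetric (hn _) (hp _) hsigma (hmodel _) hnu0 _ (hcB _)).
  rewrite -/(t2 m.+1) std_probE ?gtrN// opprK /BFDR hf.
  have tp := tail_gt0 (cB m.+1).
  have t21 : t2 m.+1 <= 1 by exact: accept_le1.
  have pp := p0 m.+1; have pp' := p1 m.+1.
  set t := tail _ in tp *; set q := p _ in pp pp' *; set u := t2 _ in t21 *.
  have den : 0 < (1 - q) * (t + t) + q * (1 - u).
    have h1 : 0 < (1 - q) * (t + t) by rewrite mulr_gt0// addr_gt0.
    have h2 : 0 <= q * (1 - u) by rewrite mulr_ge0 ?(ltW pp)// subr_ge0.
    lra.
  by move=> <-; field; rewrite !gt_eqF.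
pose D m := f m * delta m.
have D0 m : 0 < D m by rewrite mulr_gt0.
have DE : D = (fun m => delta m * f m) by apply/funext => m; rewrite /D mulrC.
pose rB m := D m * (1 - std_prob (k m * a m) (k m * b m)) + accept nu (k m) (k m * a m) (k m * b m).
pose rF m := D m * (2 * tail (cB m)) + t2 m.
have opt : \forall m \near \oo,
    rB m = D m * (tail (- (k m * a m)) + tail (k m * b m)) + accept nu (k m) (k m * a m) (k m * b m) /\
    k m * a m < 0 < k m * b m /\
    forall c, 0 < c -> rB m <= D m * (2 * tail c) + accept nu (k m) (- c) c.
  near=> m.
  have k0 : 0 < k m by rewrite divr_gt0// sqrtr_gt0 ltr0n.
  have [/andP[am bm] oa ob] : [/\ a m < 0 < b m,
        oracle_equation (n m) (p m) (delta0 m) (deltaA m) sigma nu (a m)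
      & oracle_equation (n m) (p m) (delta0 m) (deltaA m) sigma nu (b m)] by near: m.
  have DmE : D m = (1 - p m) / p m * (delta0 m / deltaA m) by rewrite /D hf hdelta.
  have ab : k m * a m < 0 < k m * b m by rewrite pmulr_rlt0// am mulr_gt0.
  have la : lik_ratio nu (k m) (k m * a m) = D m.
    by rewrite DmE; exact: (oracle_equation_lik_ratio (p0 m) (hdeltaA m) hsigma oa).
  have lb : lik_ratio nu (k m) (k m * b m) = D m.
    by rewrite DmE; exact: (oracle_equation_lik_ratio (p0 m) (hdeltaA m) hsigma ob).
  by have [h1 h2] := oracle_interval (ltW (D0 m)) ab la lb.
have ratio m : riskBFDR m.+1 / riskB m.+1 = rF m.+1 / rB m.+1.
  rewrite /riskBFDR /riskB.
  rewrite (risk_symmetric_rule (hn _) (hp _) hsigma (hmodel _) hnu0 _ _ (hcB _)).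
  rewrite (risk_interval_rule (hn _) (hp _) hsigma (hmodel _) hnu0).
  rewrite -/(k m.+1) -/(t2 m.+1) std_probE ?gtrN// opprK.
  have -> : tail (cB m.+1) + tail (cB m.+1) = 2 * tail (cB m.+1) by ring.
  rewrite /rF /rB /D hf hdelta; exact: risk_quotient.
(* [hBFDR] is vacuous for [m = 0], so all sequences are shifted by one. *)
have sh (u : nat -> R) (l : set_system R) : (u m @[m --> \oo] --> l) -> (u m.+1 @[m --> \oo] --> l).
  by move=> h; apply/(cvg_shiftP u).
have exp0 := threshold_expansion hsigma (fun m => hn m.+1) (sh _ _ nroo) (fun m => al1 m.+1)
  (fun m => f0 m.+1) (fun m => hcB m.+1) halphaoo (sh _ _ halphacvg) (sh _ _ hfalpha) (sh _ _ hC0)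
  hT0 hnuT0 hatoml hatomr bfdrE.
have Dcvg' : (D m.+1)%:E @[m --> \oo] --> Dlim.
  by rewrite (@cvg_shiftS _ (fun m => (D m)%:E)) DE.
have DN' : 2 * ln (D m) / (n m)%:R @[m --> \oo] --> C by rewrite DE.
have opt' := near_shift opt.
have B1 : \forall m \near \oo, forall c : R, 0 < c ->
    rB m.+1 <= D m.+1 * (2 * tail c) + accept nu (k m.+1) (- c) c.
  by apply: filterS opt' => m [_ [_ h]].
have B0 : \forall m \near \oo, exists l r : R,
    l < 0 < r /\ rB m.+1 = D m.+1 * (tail (- l) + tail r) + accept nu (k m.+1) l r.
  by apply: filterS opt' => m [h1 [h2 _]]; exists (k m.+1 * a m.+1), (k m.+1 * b m.+1).
have [main expo] := risk_ratio_cvg1 hsigma C_ge0 hC (fun m => hn m.+1) (sh _ _ nroo) (fun m => D0 m.+1)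
  Dlim0 Dcvg' (sh _ _ DN') (fun m => al1 m.+1)
  (fun m => f0 m.+1) (fun m => hcB m.+1) halphaoo (sh _ _ halphacvg) (sh _ _ hfalpha) (sh _ _ hC0)
  hT0 hnuT0 hatoml hatomr bfdrE B1 B0.
have ABOSE : ABOS <-> (rF m.+1 / rB m.+1 @[m --> \oo] --> (1 : R)).
  by rewrite /ABOS -(cvg_shiftP (fun m => riskBFDR m / riskB m)) (funext ratio).
split.
- exact/(cvg_shiftP (fun m => cB m ^+ 2 - _)).
- rewrite ABOSE main.
  rewrite -(cvg_shiftP (fun m => ln (f m * delta m * Num.sqrt (n m)%:R) / ln (f m / alpha m))).
  rewrite -(cvg_shiftP (fun m => 2 * ln (alpha m * delta m * Num.sqrt (n m)%:R) - _)).
  have E m : D m.+1 * Num.sqrt (n m.+1)%:R / (f m.+1 / alpha m.+1) =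
      alpha m.+1 * delta m.+1 * Num.sqrt (n m.+1)%:R.
    have f1 := f0 m.+1; have a1 := al0 m.+1.
    by rewrite /D; field; rewrite !gt_eqF.
  by under [X in _ /\ (X @ _ --> _) <-> _]eq_fun do rewrite E.
- move=> /ABOSE/expo C0E; split => //.
  have -> : T = T0 by rewrite hT0 C0E /T; congr (_ * Num.sqrt _); lra.
  by [].
Unshelve. all: by end_near. Qed.
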